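(* Let $N\ge2$, let $\Omega\subset\mathbb{R}^N$ be a domain with compact $C^2$ boundary, $a\in\partial\Omega$, $q_c=2N-1$, and let $g:\mathbb{R}\to\mathbb{R}$ be continuous with $$\liminf_{r\to\infty}\frac{g(r)}{r^{q_c}}>0\quad\text{and}\quad\limsup_{r\to-\infty}\frac{g(r)}{|r|^{q_c}}<0.$$ Let $u\in C^1(\overline\Omega\setminus\{a\})$ be a solution of $-\operatorname{div}(|Du|^{N-2}Du)+g(u)=0$ in $\Omega$ which coincides on $\partial\Omega\setminus\{a\}$ with some $\phi\in C^1(\partial\Omega)$. Then $u$ extends to $\overline\Omega$ as a continuous function.
   Context: Solutions are understood in the weak sense. *)

(* Defs.v *)
From HB Require Import structures.
From mathcomp Require Import all_boot all_order all_algebra.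
From mathcomp Require Import all_classical all_reals all_analysis.
Set Implicit Arguments. Unset Strict Implicit. Unset Printing Implicit Defensive.
Import Order.TTheory GRing.Theory Num.Theory.
Import numFieldNormedType.Exports.
Local Open Scope classical_set_scope.
Local Open Scope ring_scope.

Section Defs.
Variables (R : realType) (N : nat).
Notation V := 'rV[R]_N.

Definition evec (i : 'I_N) : V := \row_(j < N) (i == j)%:R.

(* classical partial derivative d f / d x_i (a total function, meaningful
   where f is differentiable) *)
Definition partial (i : 'I_N) (f : V -> R) : V -> R :=
  fun x => derive f x (evec i).

Definition grad (f : V -> R) (x : V) : V := \row_(i < N) partial i f x.
Definition dotR (v w : V) : R := \sum_(i < N) v ord0 i * w ord0 i.
Definition enorm (v : V) : R := Num.sqrt (dotR v v).

Fixpoint Ck (k : nat) (f : V -> R) : Prop :=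
  match k with
  | 0 => continuous f
  | k'.+1 => (forall x, differentiable f x) /\ (forall i, Ck k' (partial i f))
  end.
Definition smooth (f : V -> R) : Prop := forall k, Ck k f.

Definition bdry (A : set V) : set V := closure A `\` interior A.

Definition C2_boundary (O : set V) : Prop :=
  forall p, bdry O p ->
    exists U : set V, exists rho : V -> R,
      [/\ open U, U p, Ck 2 rho, grad rho p != 0 &
          O `&` U = [set x | U x /\ rho x < 0]].

Definition domain_compact_C2_boundary (O : set V) : Prop :=
  [/\ open O, O !=set0, connected O, compact (bdry O) & C2_boundary O].

Definition C1_closure_minus (O : set V) (a : V) (u : V -> R) : Prop :=
  [/\ {within closure O `\ a, continuous u},
      (forall x, O x -> differentiable u x) &
      forall i, exists G : V -> R,
        {within closure O `\ a, continuous G} /\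
        (forall x, O x -> G x = partial i u x)].

(* phi in C^1(boundary): restriction of a C^1 function on R^N *)
Definition C1_on_boundary (phi : V -> R) : Prop := Ck 1 phi.

Definition compact_support_in (O : set V) (f : V -> R) : Prop :=
  exists K : set V, [/\ compact K, K `<=` O & forall x, ~ K x -> f x = 0].

(* Lebesgue integral over R^N, written as iterated one-dimensional Lebesgue
   integrals (used only for continuous compactly supported integrands,
   for which it coincides with the N-dimensional Lebesgue integral). *)
Fixpoint iint (n : nat) (F : (nat -> R) -> R) : R :=
  match n with
  | 0 => F (fun _ => 0)
  | k.+1 => Rintegral (@lebesgue_measure R) setT
      (fun t : R => iint k (fun x => F (fun j => if j == k then t else x j)))
  end.
Definition integral_RN (F : V -> R) : R :=
  iint N (fun x => F (\row_(i < N) x i)).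

Definition weak_solution (O : set V) (g : R -> R) (u : V -> R) : Prop :=
  forall zeta : V -> R, smooth zeta -> compact_support_in O zeta ->
    integral_RN (fun x =>
      (if x \in O then
        enorm (grad u x) ^+ (N - 2) * dotR (grad u x) (grad zeta x)
        + g (u x) * zeta x
      else 0)) = 0.

End Defs.

(* Main.v *)
(** Near [a] the second-order form of the equation is tested against smooth
    barriers.  If a quadratic function with nonzero gradient touches [u] from
    above at an interior point, the weak formulation with the test function
    [max(u - w + eta, 0)^2] and the monotonicity of [p |-> |p|^(N-2) p] give the
    pointwise inequality for [w] (viscosity principle); since test functions are
    only smooth by hypothesis, they are first extended to [C^1] ones by a
    quasi-interpolation that needs no Fubini theorem.

    The [N]-Laplacian is conformally invariant, so an inversion at [a], shifted
    along the inner normal [e], carries the domain near [a] into the half space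
    [e . z > 0] near infinity, and a comparison principle holds on the rescaled
    shells [1 <= |z| <= 4] against five explicit barriers: a Keller--Osserman one
    ([u = O(|z|)]), one vanishing on the boundary ([u = O(e . z)]), a perturbation
    of [K (e . z)] which, because [2N - 1] is exactly the critical exponent,
    lowers [K] and hence forces [u = o(e . z)], the linear function itself ([u]
    bounded above), and an exponential one which lowers any positive upper limit
    of [u] minus its boundary value.  The same applies to [-u]. *)
Require Import Defs.
From HB Require Import structures.
From mathcomp Require Import all_boot all_order all_algebra.
From mathcomp Require Import all_classical all_reals all_analysis.
From mathcomp Require Import ring lra.
Import Order.TTheory GRing.Theory Num.Theory.
Import numFieldNormedType.Exports.
Local Open Scope classical_set_scope.
Local Open Scope ring_scope.

(** * Iterated integrals of continuous compactly supported functions *)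

(** Why [2N - 1] is critical: on a shell [|x - a|] is of order [1 / rho], so the inversion
    multiplies the absorption by about [rho ^- N]. Where [u] has size [rho], the absorption has size
    [rho ^+ (2N - 1 - N)], exactly the size of the N-Laplacian, which is homogeneous of degree
    [N - 1]. Gains on a constant can therefore be chosen independently of [rho]. Each improving
    estimate lives on one shell: known bounds enter on the spheres of radius 1 and 4, the gain is
    read on radius 2, and every point close to [a] lies on such a middle sphere for a suitable
    [rho]. Gains are not iterated: the admissible constants form an upward closed set whose infimum
    cannot be positive. The argument runs at two levels [M]. At a high level the growth of [g] is
    available wherever [u > M], and it yields boundedness. At a level just above the boundary value
    at [a] the sign of [g] is unknown; but [u] is now bounded, so [g (u x)] is bounded below and the
    weight [rho ^- N] makes a negative contribution negligible. *)

Section IntegralReal.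
Variable R : realType.
Notation mu := (@lebesgue_measure R).

Definition supp_in (K : R) (f : R -> R) := forall t, K < `|t| -> f t = 0.

Lemma supp_in_patch (K : R) (f : R -> R) : supp_in K f -> f = f \_ `[- K, K].
Proof.
move=> sf; apply/funext => t; rewrite patchE; case: ifPn => // tK.
apply: sf; rewrite ltNge ler_norml; apply/negP => tK'.
by move: tK; rewrite notin_setE /= in_itv /= tK'.
Qed.

Lemma supp_in_integrable (K : R) (f : R -> R) : continuous f -> supp_in K f ->
  mu.-integrable setT (EFin \o f).
Proof.
move=> cf sf; rewrite (supp_in_patch _ _ sf).
have -> : EFin \o (f \_ `[- K, K]) = (EFin \o f) \_ `[- K, K].
  by apply/funext => t; rewrite /= !patchE; case: ifP.
have mK : measurable (`[- K, K]%classic : set (measurableTypeR R)).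
  exact: measurable_itv.
apply/(integrable_mkcond (mu := mu) (EFin \o f) mK).
apply: continuous_compact_integrable; first exact: segment_compact.
exact: continuous_subspaceT.
Qed.

Lemma Rint_bound (K c : R) (f : R -> R) : 0 <= K -> continuous f -> supp_in K f ->
  (forall t, `|f t| <= c) -> `|Rintegral mu setT f| <= 2 * K * c.
Proof.
move=> K0 cf sf fc.
have c0 : 0 <= c by apply: le_trans (fc 0).
rewrite (supp_in_patch _ _ sf) -Rintegral_mkcond.
have itf : mu.-integrable `[- K, K] (EFin \o f).
  apply: continuous_compact_integrable; first exact: segment_compact.
  exact: continuous_subspaceT.
have mK : measurable (`[- K, K]%classic : set (measurableTypeR R)).
  exact: measurable_itv.
apply: le_trans; first exact: (le_normr_Rintegral mK itf).
have fin : (mu `[(- K)%R, K]%classic < +oo)%E.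
  by rewrite lebesgue_measure_itv /=; case: ifP => _; rewrite ?ltry.
apply: (@le_trans _ _ (Rintegral mu `[- K, K] (cst c))).
  apply: le_Rintegral => //.
  - have := integrable_abse itf; apply: eq_integrable => //.
  - apply: measurable_bounded_integrable => //.
    by exists c; split; rewrite ?num_real // => M cM t _; rewrite /= ger0_norm // ltW.
rewrite Rintegral_cst //.
have muK : mu `[(- K)%R, K]%classic = (2 * K)%:E.
  rewrite lebesgue_measure_itv /= lte_fin; case: ltP => KK /=.
    by rewrite -EFinB; congr _%:E; ring.
  by congr _%:E; lra.
by rewrite [X in fine X]muK /= mulrC.
Qed.

Lemma Rint_ge0_gt0 (K : R) (f : R -> R) (t0 : R) : continuous f -> supp_in K f ->
  (forall t, 0 <= f t) -> 0 < f t0 -> 0 < Rintegral mu setT f.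
Proof.
move=> cf sf f0 ft0.
have : \forall t \near t0, f t0 / 2 < f t.
  by apply: (cvgr_gt _ (cf t0)); lra.
move=> /nbhs_ballP [d /= d0 bd].
pose D : set (measurableTypeR R) := `[t0, t0 + d / 2]%classic.
have mD : measurable D by exact: measurable_itv.
have itf : mu.-integrable setT (EFin \o f) by exact: supp_in_integrable sf.
have itD : mu.-integrable D (EFin \o f) by apply: integrableS itf.
have fin : (mu D < +oo)%E.
  by rewrite lebesgue_measure_itv /=; case: ifP => _; rewrite ?ltry.
have step : Rintegral mu D (cst (f t0 / 2)) <= Rintegral mu D f.
  apply: le_Rintegral => //.
  - apply: measurable_bounded_integrable => //.
    exists (f t0 / 2); split; rewrite ?num_real // => M cM t _.
    by rewrite /= ger0_norm ?ltW //; lra.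
  - move=> t; rewrite /D /= in_itv /= => /andP[t1 t2]; apply/ltW/bd.
    by rewrite /ball /= distrC ger0_norm; lra.
apply: lt_le_trans (_ : Rintegral mu D f <= _).
  apply: lt_le_trans step; rewrite Rintegral_cst //.
  have muD : mu D = (d / 2)%:E.
    rewrite /D lebesgue_measure_itv /= lte_fin ifT; last by lra.
    by rewrite -EFinB; congr _%:E; ring.
  by rewrite [X in fine X]muD /= mulr_gt0 //; lra.
rewrite Rintegral_mkcond; apply: le_Rintegral => //.
- have /(integrable_mkcond (mu := mu) (EFin \o f) mD) := itD.
  by apply: eq_integrable => // t _; rewrite /= !patchE; case: ifP.
- by move=> t _; rewrite patchE; case: ifP => // _; exact: f0.
Qed.

Lemma Rint_shift (K : R) (f : R -> R) (h : R) : continuous f -> supp_in K f -> 0 < K ->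
  Rintegral mu setT (fun t => f (t + h)) = Rintegral mu setT f.
Proof.
move=> cf sf K0.
(* Both [[a, b]] and [[a + h, b + h]] contain [[- K, K]], so each integral reduces to a segment and
   the substitution formula applies. *)
pose a := - K - `|h|; pose b := K + `|h|.
have hh := ler_norm h; have hN := ler_norm (- h); rewrite normrN in hN.
have h0 := normr_ge0 h.
have ab : a < b by rewrite /a /b; lra.
have dF (x : R) : is_derive x 1 (fun t : R => t + h) 1.
  by apply: is_derive_eq; rewrite addr0.
have dF1 : derive1 (fun t : R => t + h) = cst 1.
  by apply/funext => x; rewrite derive1E; apply: derive_val.
have cshift : continuous (fun t : R => t + h).
  by move=> x; apply: cvgD; [exact: cvg_id|exact: cvg_cst].
have patch1 : f = f \_ `[a + h, b + h].
  apply/funext => t; rewrite patchE; case: ifPn => // tK; apply: sf.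
  rewrite ltNge ler_norml; apply/negP => /andP[t1 t2].
  by move: tK; rewrite notin_setE /= in_itv /= /a /b; apply; lra.
have patch2 : (fun t => f (t + h)) = (fun t => f (t + h)) \_ `[a, b].
  apply/funext => t; rewrite patchE; case: ifPn => // tK; apply: sf.
  rewrite ltNge ler_norml; apply/negP => /andP[t1 t2].
  by move: tK; rewrite notin_setE /= in_itv /= /a /b; apply; lra.
rewrite [in RHS]patch1 patch2 -!Rintegral_mkcond /Rintegral.
rewrite (@integration_by_substitution_increasing _ (fun t => t + h) f a b (ltW ab)).
- by congr fine; apply: eq_integral => t _; rewrite dF1 /= mulr1.
- by move=> x y _ _ xy; rewrite ltrD2r.
- by rewrite dF1 => x _; exact: cvg_cst.
- by rewrite dF1; exact: is_cvg_cst.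
- by rewrite dF1; exact: is_cvg_cst.
- split => [x _||]; first exact: ex_derive.
  + by apply: cvg_at_right_filter; exact: cshift.
  + by apply: cvg_at_left_filter; exact: cshift.
- exact: continuous_subspaceT.
Qed.

End IntegralReal.

Section IteratedIntegral.
Variable R : realType.
Implicit Types (F G : (nat -> R) -> R) (K c h : R) (n : nat).

Definition upd n (t : R) (x : nat -> R) : nat -> R :=
  fun j => if j == n then t else x j.

(** Integrands take sequences, as in [iint]; only the first [n] coordinates are integrated, and only
    they are constrained. *)
Definition box_supp n K F :=
  forall x, (exists2 j, (j < n)%N & K < `|x j|) -> F x = 0.

(** Uniformity is what survives slicing and integration. The condition also forces [F] to depend on
    the first [n] coordinates alone. *)
Definition unif_cont n F := forall e, 0 < e -> exists2 d, 0 < d &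
  forall x y, (forall j, (j < n)%N -> `|x j - y j| < d) -> `|F x - F y| <= e.

Lemma box_supp_upd n K F t : box_supp n.+1 K F -> box_supp n K (F \o upd n t).
Proof.
move=> sF x [j jn xj]; apply: sF; exists j; first exact: ltnW.
by rewrite /upd ltn_eqF.
Qed.

Lemma upd_out n K F t x : box_supp n.+1 K F -> K < `|t| -> F (upd n t x) = 0.
Proof. by move=> sF tK; apply: sF; exists n => //; rewrite /upd eqxx. Qed.

Lemma unif_cont_upd n F t : unif_cont n.+1 F -> unif_cont n (F \o upd n t).
Proof.
move=> uF e /uF[d d0 Fd]; exists d => // x y xy; apply: Fd => j jn.
rewrite /upd; case: eqP => [_|/eqP jn']; first by rewrite subrr normr0.
by apply: xy; rewrite ltn_neqAle jn' -ltnS.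
Qed.

Lemma box_suppB n K F G : box_supp n K F -> box_supp n K G ->
  box_supp n K (fun x => F x - G x).
Proof. by move=> sF sG x hx; rewrite sF // sG // subrr. Qed.

Lemma unif_contB n F G : unif_cont n F -> unif_cont n G ->
  unif_cont n (fun x => F x - G x).
Proof.
move=> uF uG e e0.
have [d1 d10 h1] := uF (e / 2) ltac:(lra).
have [d2 d20 h2] := uG (e / 2) ltac:(lra).
exists (Num.min d1 d2); first by rewrite lt_min d10.
move=> x y xy.
have h3 : `|F x - F y| <= e / 2.
  by apply: h1 => j /xy; rewrite lt_min => /andP[].
have h4 : `|G x - G y| <= e / 2.
  by apply: h2 => j /xy; rewrite lt_min => /andP[].
have -> : F x - G x - (F y - G y) = (F x - F y) - (G x - G y) by ring.
by apply: le_trans (ler_normB _ _) _; lra.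
Qed.

(** The two laws go through the induction together: continuity of the slices, which makes the outer
    integral at [n + 1] meaningful, needs both the difference law and the sup bound at [n]. *)
Definition iint_lin n :=
  (forall K F G, 0 <= K -> box_supp n K F -> box_supp n K G ->
     unif_cont n F -> unif_cont n G ->
     iint n (fun x => F x - G x) = iint n F - iint n G) /\
  (forall K c F, 0 <= K -> box_supp n K F -> unif_cont n F ->
     (forall x, `|F x| <= c) -> `|iint n F| <= (2 * K) ^+ n * c).

Lemma slice_cont_lin n K F : iint_lin n -> 0 <= K ->
  box_supp n.+1 K F -> unif_cont n.+1 F ->
  continuous (fun t : R => iint n (F \o upd n t)) /\
  supp_in R K (fun t : R => iint n (F \o upd n t)).
Proof.
move=> [linS linB] K0 sF uF; split; last first.
  move=> t tK; apply/normr0_eq0/le_anti; rewrite normr_ge0 andbT.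
  rewrite -[leRHS](mulr0 ((2 * K) ^+ n)); apply: linB => //.
  - exact: box_supp_upd.
  - exact: unif_cont_upd.
  - by move=> x; rewrite /= (upd_out n K) // normr0.
move=> t; apply/cvgrPdist_le => e e0.
pose C := (2 * K) ^+ n.
have C0 : 0 <= C by apply: exprn_ge0; lra.
(* [C] may vanish, so the division is by [C + 1]; the same device recurs below. *)
have [d d0 Fd] := uF (e / (C + 1)) ltac:(by apply: divr_gt0; lra).
near=> s.
have ts : `|t - s| < d by near: s; apply: cvgr_dist_lt.
rewrite -(linS K) //; try exact: box_supp_upd; try exact: unif_cont_upd.
apply: le_trans (linB K (e / (C + 1)) _ K0 _ _ _) _.
- by apply: box_suppB; exact: box_supp_upd.
- by apply: unif_contB; exact: unif_cont_upd.
- move=> x /=; apply: Fd => j _; rewrite /upd.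
  by case: eqP => // _; rewrite subrr normr0.
- rewrite -/C mulrCA ler_piMr ?(ltW e0) // ler_pdivrMr; lra.
Unshelve. all: by end_near. Qed.

Lemma iint_linP n : iint_lin n.
Proof.
elim: n => [|n IH].
  by split => //= K c F _ _ _ Fc; rewrite expr0 mul1r.
split.
  move=> K F G K0 sF sG uF uG /=.
  have [cF suF] := slice_cont_lin _ _ _ IH K0 sF uF.
  have [cG suG] := slice_cont_lin _ _ _ IH K0 sG uG.
  rewrite -RintegralB //; first last.
  - exact: (supp_in_integrable _ _ _ cG suG).
  - exact: (supp_in_integrable _ _ _ cF suF).
  apply: eq_Rintegral => t _; rewrite -(IH.1 K) //;
    by [exact: box_supp_upd|exact: unif_cont_upd].
move=> K c F K0 sF uF Fc /=.
have [cF suF] := slice_cont_lin _ _ _ IH K0 sF uF.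
rewrite exprS -mulrA; apply: Rint_bound => // t.
apply: (IH.2 K c (F \o upd n t)) => //.
- exact: box_supp_upd.
- exact: unif_cont_upd.
- by move=> x; exact: Fc.
Qed.

Lemma slice_cont n K F : 0 <= K -> box_supp n.+1 K F -> unif_cont n.+1 F ->
  continuous (fun t : R => iint n (F \o upd n t)) /\
  supp_in R K (fun t : R => iint n (F \o upd n t)).
Proof. exact: slice_cont_lin (iint_linP n). Qed.

Lemma iintB n K F G : 0 <= K -> box_supp n K F -> box_supp n K G ->
  unif_cont n F -> unif_cont n G ->
  iint n (fun x => F x - G x) = iint n F - iint n G.
Proof. by have [h _] := iint_linP n; exact: h. Qed.

Lemma iint_bound n K c F : 0 <= K -> box_supp n K F -> unif_cont n F ->
  (forall x, `|F x| <= c) -> `|iint n F| <= (2 * K) ^+ n * c.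
Proof. by have [_ h] := iint_linP n; exact: h. Qed.

Lemma iintZ n K c F : 0 <= K -> box_supp n K F -> unif_cont n F ->
  iint n (fun x => c * F x) = c * iint n F.
Proof.
elim: n F => [//|n IH] F K0 sF uF /=.
have [cF suF] := slice_cont n K F K0 sF uF.
rewrite -RintegralZl //; last exact: supp_in_integrable suF.
apply: eq_Rintegral => t _; apply: IH => //.
  exact: box_supp_upd.
exact: unif_cont_upd.
Qed.

Lemma iint_ge0 n F : (forall x, 0 <= F x) -> 0 <= iint n F.
Proof.
elim: n F => [F F0|n IH F F0 /=]; first exact: F0.
by apply: Rintegral_ge0 => t _; apply: IH => x; exact: F0.
Qed.

Lemma iint_gt0 n K F x0 : 0 <= K -> box_supp n K F -> unif_cont n F ->
  (forall x, 0 <= F x) -> 0 < F x0 -> 0 < iint n F.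
Proof.
elim: n F => [|n IH] F K0 sF uF F0 Fx0.
  (* With no coordinate left, uniform continuity says that [F] is constant, so the value at [x0] is
     the value integrated. *)
  apply: lt_le_trans Fx0 _; rewrite -subr_le0; apply/ler_addgt0Pr => e e0.
  have [d _ Fd] := uF e e0; rewrite add0r.
  by apply: le_trans (ler_norm _) _; apply: Fd.
have [cF suF] := slice_cont n K F K0 sF uF.
apply: (Rint_ge0_gt0 _ K _ (x0 n)) => //.
  by move=> t; apply: iint_ge0 => x; exact: F0.
apply: IH => //; [exact: box_supp_upd|exact: unif_cont_upd|].
suff e : upd n (x0 n) x0 = x0 by rewrite -[F _]/(F (upd n (x0 n) x0)) e.
by apply/funext => j; rewrite /upd; case: eqP => [->|].
Qed.

Lemma iint_shift n K F i h : 0 < K -> (i < n)%N ->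
  box_supp n K F -> unif_cont n F ->
  iint n (fun x => F (upd i (x i + h) x)) = iint n F.
Proof.
elim: n F => [//|n IH] F K0; rewrite ltnS leq_eqVlt => /predU1P[->|ni] sF uF /=.
  have [cF suF] := slice_cont n K F (ltW K0) sF uF.
  rewrite -(Rint_shift _ K _ h cF suF K0).
  apply: eq_Rintegral => t _; congr iint; apply/funext => x /=.
  by congr F; apply/funext => j; rewrite /upd eqxx; case: eqP.
apply: eq_Rintegral => t _.
rewrite -(IH (F \o upd n t)) //; last first.
- exact: unif_cont_upd.
- exact: box_supp_upd.
congr iint; apply/funext => x /=; congr F; apply/funext => j; rewrite /upd.
rewrite (ltn_eqF ni); case: (eqVneq j n) => // ->.
by rewrite gtn_eqF.
Qed.

End IteratedIntegral.

Section IntegralRN.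
Variables (R : realType) (N : nat).
Notation V := 'rV[R]_N.
Implicit Types (f g : V -> R).

(** The norm on row vectors is the sup norm, so the support lies in a cube, as [box_supp]
    requires. *)
Definition cc (K : R) f := continuous f /\ forall x, K < `|x| -> f x = 0.

Let rowf (x : nat -> R) : V := \row_i x i.

(** Heine's theorem on the ball of radius [K + 1]. The modulus is taken below 1, so that for [x]
    outside this ball both points lie outside the support. *)
Lemma cc_unif_cont K f : cc K f -> forall e, 0 < e -> exists2 d, 0 < d &
  forall x y, `|x - y| < d -> `|f x - f y| <= e.
Proof.
move=> [cf sf] e e0.
have cK : compact [set x : V | `|x| <= K + 1].
  apply: bounded_closed_compact.
    exists (K + 1); split; first by rewrite num_real.
    by move=> M KM x /= xK; apply: le_trans xK (ltW KM).
  apply: closed_comp (@closed_le _ (K + 1)) => x _; exact: norm_continuous.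
have cov : forall x, [set x : V | `|x| <= K + 1] x -> \forall x' \near x &
    d \near 0^'+, forall y, `|x' - y| < d -> `|f x' - f y| <= e.
  move=> x _.
  have /cvgrPdist_le /(_ (e / 2) ltac:(lra)) := cf x.
  move=> /nbhs_ballP[d /= d0 fd].
  exists (ball x (d / 2), [set t | t < d / 2]) => /=.
    split; first by apply: nbhsx_ballx; lra.
    by apply: nbhs_right_lt; lra.
  move=> [x' t] [/= xx' td] y x'y; rewrite -ball_normE /= in xx'.
  have h1 : `|f x - f x'| <= e / 2.
    by apply: fd; rewrite -ball_normE /=; lra.
  have h2 : `|f x - f y| <= e / 2.
    apply: fd; rewrite -ball_normE /=.
    have := ler_distD x' x y; lra.
  have := ler_distD (f x) (f x') (f y); rewrite (distrC (f x') (f x)); lra.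
have /compact_near_coveringP /(_ R _ _ _ cov) near_d := cK.
have [d [/= Kd d0 d1]] : exists d, [/\ [set x : V | `|x| <= K + 1] `<=`
    (fun x => forall y, `|x - y| < d -> `|f x - f y| <= e), 0 < d & d < 1].
  have nd : \forall d \near (0 : R)^'+, 0 < d /\ d < 1.
    by apply: filterI; [exact: nbhs_right_gt|exact: nbhs_right_lt].
  have nd2 := filterI near_d nd.
  have [d [h1 [h2 h3]]] :=
    @filter_ex _ _ (at_right_proper_filter (0 : R)) _ (nd2 _).
  by exists d; split.
exists d => // x y xy; have [xK|xK] := leP `|x| (K + 1); first exact: Kd.
have yK : K < `|y|.
  have := ler_dist_dist x y; have := ler_norm (`|x| - `|y|); lra.
rewrite !sf ?subrr ?normr0 ?(ltW e0) //; lra.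
Qed.

Lemma row_norm_lt (x : V) (d : R) : 0 < d -> (forall i, `|x ord0 i| < d) -> `|x| < d.
Proof.
move=> d0 xd; rewrite [`|x|]/Num.norm /= mx_normrE; apply/bigmax_ltP; split => //.
by move=> [i j] _ /=; rewrite ord1.
Qed.

Lemma coord_le_norm (x : V) i : `|x ord0 i| <= `|x|.
Proof.
rewrite [`|x|]/Num.norm /= mx_normrE.
by apply: (le_bigmax _ (fun ij => `|x ij.1 ij.2|) (ord0, i)).
Qed.

Lemma cc_unif K f : cc K f -> unif_cont R N (f \o rowf).
Proof.
move=> ccf e /(cc_unif_cont _ _ ccf)[d d0 fd]; exists d => // x y xy.
apply: fd; apply: row_norm_lt => // i; rewrite !mxE; exact: xy.
Qed.

Lemma cc_box K f : cc K f -> box_supp R N K (f \o rowf).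
Proof.
move=> [_ sf] x [j jN Kj]; apply: sf; apply: lt_le_trans Kj _.
by have := coord_le_norm (rowf x) (Ordinal jN); rewrite mxE.
Qed.

Lemma integral_RNB K f g : 0 <= K -> cc K f -> cc K g ->
  integral_RN (fun x => f x - g x) = integral_RN f - integral_RN g.
Proof.
move=> K0 cf cg; apply: (iintB _ _ K (f \o rowf) (g \o rowf)) => //;
  by [exact: cc_box|exact: cc_unif cf|exact: cc_unif cg].
Qed.

Lemma integral_RNZ K c f : 0 <= K -> cc K f ->
  integral_RN (fun x => c * f x) = c * integral_RN f.
Proof.
move=> K0 cf; apply: (iintZ _ _ K _ (f \o rowf)) => //;
  by [exact: cc_box|exact: cc_unif cf].
Qed.

Lemma integral_RN_bound K c f : 0 <= K -> cc K f -> (forall x, `|f x| <= c) ->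
  `|integral_RN f| <= (2 * K) ^+ N * c.
Proof.
move=> K0 cf fc; apply: iint_bound => //;
  by [exact: cc_box|exact: cc_unif cf|move=> x; exact: fc].
Qed.

Lemma integral_RN_gt0 K f x0 : 0 <= K -> cc K f -> (forall x, 0 <= f x) ->
  0 < f x0 -> 0 < integral_RN f.
Proof.
move=> K0 cf f0 fx0.
pose x1 : nat -> R := fun j => if insub j is Some i then x0 ord0 i else 0.
apply: (iint_gt0 _ _ K (f \o rowf) x1) => //; first exact: cc_box.
- exact: cc_unif cf.
- by move=> x; exact: f0.
rewrite /= (_ : rowf x1 = x0) //; apply/rowP => i; rewrite mxE /x1.
by rewrite insubT // => iN; congr (x0 _ _); apply: val_inj.
Qed.

Lemma integral_RN_shift K f i h : 0 < K -> cc K f ->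
  integral_RN (fun x => f (x + h *: evec R i)) = integral_RN f.
Proof.
move=> K0 cf; rewrite /integral_RN.
rewrite -(iint_shift R N K (f \o rowf) i h) //; last first.
- exact: cc_unif cf.
- exact: cc_box.
congr iint; apply/funext => x /=; congr f; apply/rowP => j.
rewrite !mxE /upd (inj_eq val_inj) [j == i]eq_sym.
by case: eqP => [->|_]; rewrite ?mulr1 ?mulr0 ?addr0.
Qed.

End IntegralRN.

(** * Smooth approximation of C^1 test functions *)

Section Derive.
Variables (R : realType) (V : normedModType R).

(** First-order expansion with the case [h = 0] included: derivatives can then be checked by
    inequalities without dividing. *)
Lemma is_derive_eps (f : V -> R) (x v : V) (d : R) :
  is_derive x v f d <-> (forall e : R, 0 < e -> exists2 r : R, 0 < r &
    forall h : R, `|h| < r -> `|f (x + h *: v) - f x - d * h| <= e * `|h|).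
Proof.
split=> [[dv <-] e e0|H].
  have /cvgrPdist_le /(_ e e0) := dv.
  rewrite near_withinE => /nbhs_ballP[r /= r0 hr].
  exists r => // h hr'; have [->|hz] := eqVneq h 0.
    by rewrite scale0r addr0 subrr mulr0 subrr !normr0 mulr0.
  have := hr h; rewrite -ball_normE /= sub0r normrN => /(_ hr' hz).
  rewrite -/(derive f x v) (addrC (h *: v)) => H.
  have -> : f (x + h *: v) - f x - 'D_v f x * h =
     - (h * ('D_v f x - h^-1 * (f (x + h *: v) - f x))).
    by rewrite mulrBr mulrA mulfV // mul1r; ring.
  by rewrite normrN normrM mulrC ler_wpM2r.
have cv : (fun h : R => h^-1 *: ((f \o shift x) (h *: v) - f x)) @ 0^' --> d.
  apply/cvgrPdist_le => e e0; have [r r0 hr] := H e e0.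
  rewrite near_withinE; apply/nbhs_ballP; exists r => //= h.
  rewrite -ball_normE /= sub0r normrN => /hr hh hz.
  rewrite (addrC (h *: v)).
  have -> : d - h^-1 *: (f (x + h *: v) - f x) =
      - (h^-1 * (f (x + h *: v) - f x - d * h)).
    by rewrite -[_ *: _]/(h^-1 * _); field.
  have h0 : 0 < `|h| by rewrite normr_gt0.
  by rewrite normrN normrM normfV ler_pdivrMl // [leRHS]mulrC.
split; first by apply/cvg_ex; exists d.
by apply: cvg_lim cv.
Qed.

End Derive.
Arguments is_derive_eps {R V f x v d}.

Section DeriveLine.
Variables (R : realType) (V : normedModType R).

(** Reduces directional derivatives to one variable, where the mean value theorem and the chain rule
    are available. *)
Lemma is_derive_line (f : V -> R) (x v : V) (t d : R) :
  is_derive (x + t *: v) v f d <->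
  is_derive t (1 : R) (fun s : R => f (x + s *: v)) d.
Proof.
split=> H; apply: is_derive_eps.2 => e e0.
  have [r r0 hr] := is_derive_eps.1 H e e0; exists r => // h /hr.
  by rewrite /= scalerDl addrA -[h *: 1]/(h * 1) mulr1.
have [r r0 hr] := is_derive_eps.1 H e e0; exists r => // h /hr.
by rewrite /= -[h *: 1]/(h * 1) mulr1 scalerDl addrA.
Qed.

End DeriveLine.
Arguments is_derive_line {R V f x v t d}.

(** * Smooth functions of one variable and a kernel reproducing affine functions *)

Section SmoothReal.
Variable R : realType.
Implicit Types (f g : R -> R).

Fixpoint Cn (k : nat) (f : R -> R) : Prop :=
  match k with
  | 0 => continuous f
  | k'.+1 => exists2 f', (forall x : R, is_derive x (1 : R) f (f' x)) & Cn k' f'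
  end.

Lemma is_derive1_continuous (f : R -> R) (x d : R) :
  is_derive x (1 : R) f d -> {for x, continuous f}.
Proof.
move=> h; apply: differentiable_continuous; apply/derivable1_diffP.
exact: ex_derive.
Qed.

Lemma CnS k f : Cn k.+1 f -> Cn k f.
Proof.
elim: k f => [|k IH] f [f' df cf'].
  by move=> x; apply: is_derive1_continuous.
by exists f' => //; apply: IH.
Qed.

Lemma Cn_cst k (c : R) : Cn k (cst c).
Proof.
elim: k c => [|k IH] c; first by move=> x; apply: cvg_cst.
by exists (cst 0) => // x; apply: is_derive_cst.
Qed.

Lemma Cn_id k : Cn k id.
Proof.
case: k => [|k]; first by move=> x; apply: cvg_id.
by exists (cst 1); [move=> x; apply: is_derive_id|exact: Cn_cst].
Qed.

Lemma CnD k f g : Cn k f -> Cn k g -> Cn k (fun x => f x + g x).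
Proof.
elim: k f g => [|k IH] f g; first by move=> cf cg x; apply: cvgD; [exact: cf|exact: cg].
move=> [f' df cf'] [g' dg cg']; exists (fun x => f' x + g' x); last exact: IH.
by move=> x; apply: is_deriveD.
Qed.

Lemma CnM k f g : Cn k f -> Cn k g -> Cn k (fun x => f x * g x).
Proof.
elim: k f g => [|k IH] f g; first by move=> cf cg x; apply: cvgM; [exact: cf|exact: cg].
move=> cf cg; have sf := CnS _ _ cf; have sg := CnS _ _ cg.
case: cf cg => [f' df cf'] [g' dg cg'].
exists (fun x => f x * g' x + g x * f' x).
  by move=> x; apply: is_deriveM.
by apply: CnD; apply: IH.
Qed.

Lemma Cn_comp k f g : Cn k f -> Cn k g -> Cn k (fun x => f (g x)).
Proof.
elim: k f g => [|k IH] f g.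
  by move=> cf cg x; apply: continuous_comp; [exact: cg|exact: cf].
move=> cf cg; have sf := CnS _ _ cf; have sg := CnS _ _ cg.
case: cf cg => [f' df cf'] [g' dg cg'].
exists (fun x => f' (g x) * g' x).
  move=> x; have := is_derive1_comp (df (g x)) (dg x).
  by [].
by apply: CnM => //; apply: IH.
Qed.

Lemma CnZ k (c : R) f : Cn k f -> Cn k (fun x => c * f x).
Proof. by move=> cf; apply: CnM => //; exact: Cn_cst. Qed.

(** The powers of [t^-1] make the family stable under differentiation up to linear combinations, so
    smoothness becomes an induction over all [n] at once. *)
Definition flat_exp (n : nat) (t : R) : R :=
  if 0 < t then (t^-1) ^+ n * expR (- t^-1) else 0.

Lemma flat_exp_le0 n t : t <= 0 -> flat_exp n t = 0.
Proof. by rewrite /flat_exp leNgt => /negbTE ->. Qed.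

Lemma flat_exp_ge0 n t : 0 <= flat_exp n t.
Proof.
rewrite /flat_exp; case: ifP => // t0.
by rewrite mulr_ge0 ?expR_ge0 // exprn_ge0 // invr_ge0 ltW.
Qed.

(** A quadratic bound at 0 is what makes the derivative there vanish. It follows from
    [y / m <= exp (y / m)] raised to the power [m = n + 2], at [y = t^-1]. *)
Lemma flat_exp_le n t : `|flat_exp n t| <= (n.+2)%:R ^+ n.+2 * t ^+ 2.
Proof.
rewrite ger0_norm ?flat_exp_ge0 // /flat_exp; case: ifP => t0; last first.
  by rewrite mulr_ge0 ?sqr_ge0 // exprn_ge0.
have y0 : 0 < t^-1 by rewrite invr_gt0.
set m := n.+2.
have m0 : 0 < (m%:R : R) by rewrite ltr0n.
have h : (t^-1 / m%:R) ^+ m <= expR (t^-1).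
  have -> : expR (t^-1) = expR (t^-1 / m%:R) ^+ m.
    rewrite -expRM_natl; congr expR; field; lra.
  apply: lerXn2r; rewrite ?nnegrE ?expR_ge0 ?divr_ge0 ?(ltW y0) ?(ltW m0) //.
  have := expR_ge1Dx (t^-1 / m%:R); lra.
rewrite expRN.
have e0 := expR_gt0 (t^-1).
rewrite ler_pdivrMr //.
apply: le_trans (ler_wpM2l _ h); last first.
  by rewrite mulr_ge0 ?sqr_ge0 // exprn_ge0 // ltW.
rewrite expr_div_n /m -addn2 [in leRHS]exprD.
rewrite [leRHS](_ : _ = (t^-1) ^+ n) //.
have nz : (n + 2)%:R != 0 :> R by rewrite pnatr_eq0 addn2.
rewrite exprD; field; rewrite -natrD nz expf_neq0 //=.
by rewrite gt_eqF.
Qed.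

Lemma flat_exp_derive n (t : R) : is_derive t (1 : R) (flat_exp n)
  (- n%:R * flat_exp n.+1 t + flat_exp n.+2 t).
Proof.
have [t0|t0|->] := ltgtP t 0.
- rewrite !flat_exp_le0 ?ltW // mulr0 addr0.
  have d0 : is_derive t (1 : R) (cst (0 : R)) 0 by exact: is_derive_cst.
  apply: near_eq_is_derive d0.
  near=> s; rewrite flat_exp_le0 //; apply/ltW; near: s.
  exact: lt_nbhsl.
- have tz : t != 0 by rewrite gt_eqF.
  have di := @is_deriveV _ id t 1 1 tz (is_derive_id _ _).
  have dn := is_deriveX n di.
  have de := @is_derive1_comp _ expR (fun s : R => - s^-1) t _ _
    (is_derive_expR (- t^-1)) (is_deriveN di).
  have dp := is_deriveM dn de.
  apply: (near_eq_is_derive _ (is_derive_eq dp _)).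
    near=> s; have s0 : 0 < s by near: s; exact: lt_nbhsr.
    by rewrite /flat_exp s0 fctE exprfctE.
  rewrite /flat_exp t0 !exprS.
  case: n dn dp => [|n] dn dp; rewrite !exprfctE.
    by rewrite /GRing.scale /= !mulr1 !expr0 !mul0r mulr0; field.
  by rewrite /GRing.scale /= !mulr1 !exprS -[n.+1%:R]natr1; field.
- rewrite !flat_exp_le0 // mulr0 addr0.
  apply: (is_derive_eps).2 => e e0.
  pose c : R := (n.+2)%:R ^+ n.+2.
  have c0 : 0 <= c by rewrite exprn_ge0.
  exists (e / (c + 1)) => [|h]; first by apply: divr_gt0 => //; lra.
  rewrite ltr_pdivlMr; last by lra.
  move=> he; rewrite [flat_exp n 0]flat_exp_le0 // mul0r !subr0 add0r.
  rewrite -[h *: 1]/(h * 1) mulr1; apply: le_trans (flat_exp_le _ _) _.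
  rewrite -/c -[h ^+ 2]ger0_norm ?sqr_ge0 // normrX.
  rewrite expr2 mulrA ler_wpM2r //; have := normr_ge0 h; nra.
Unshelve. all: by end_near. Qed.

Lemma Cn_flat_exp k n : Cn k (flat_exp n).
Proof.
elim: k n => [|k IH] n.
  by move=> x; apply: is_derive1_continuous (flat_exp_derive n x).
exists (fun t => - n%:R * flat_exp n.+1 t + flat_exp n.+2 t).
  exact: flat_exp_derive.
by apply: CnD => //; apply: CnZ.
Qed.

Lemma flat_exp_mono (s t : R) : s <= t -> flat_exp 0 s <= flat_exp 0 t.
Proof.
move=> st; have [s0|s0] := lerP s 0.
  by rewrite flat_exp_le0 // flat_exp_ge0.
have t0 := lt_le_trans s0 st.
by rewrite /flat_exp s0 t0 !expr0 !mul1r ler_expR lerN2 lef_pV2.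
Qed.

Lemma flat_exp1_gt0 : 0 < flat_exp 0 1.
Proof. by rewrite /flat_exp ltr01 expr0 mul1r expR_gt0. Qed.

(** Composing [flat_exp 0] with itself replaces the usual quotient of two flat functions; only sums,
    constant multiples and compositions have to preserve smoothness. *)
Definition smooth_step (t : R) : R :=
  1 - flat_exp 0 (1 - flat_exp 0 t / flat_exp 0 1) / flat_exp 0 1.

Lemma smooth_step_le0 t : t <= 0 -> smooth_step t = 0.
Proof.
move=> t0; rewrite /smooth_step (flat_exp_le0 0 t t0) mul0r subr0 mulfV ?subrr //.
by rewrite gt_eqF // flat_exp1_gt0.
Qed.

Lemma smooth_step_ge1 t : 1 <= t -> smooth_step t = 1.
Proof.
move=> t1; rewrite /smooth_step (flat_exp_le0 0 (1 - _)) ?mul0r ?subr0 //.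
by rewrite subr_le0 ler_pdivlMr ?flat_exp1_gt0 // mul1r flat_exp_mono.
Qed.

Lemma Cn_smooth_step k : Cn k smooth_step.
Proof.
have h : forall a, Cn k (fun t => 1 - flat_exp 0 (a t) / flat_exp 0 1) <->
    Cn k (fun t => 1 + (- (flat_exp 0 1)^-1) * flat_exp 0 (a t)).
  move=> a; rewrite (_ : (fun t => 1 - _) =
    (fun t => 1 + (- (flat_exp 0 1)^-1) * flat_exp 0 (a t))) //.
  by apply/funext => t; rewrite mulNr mulrC.
apply/h; apply: CnD; first exact: Cn_cst.
apply: CnZ; apply: (Cn_comp k (flat_exp 0)); first exact: Cn_flat_exp.
apply/(h id); apply: CnD; first exact: Cn_cst.
by apply: CnZ; exact: Cn_flat_exp.
Qed.

(** A smooth substitute for the positive part, exact outside [[0, 1]]; its second difference will be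
    the approximation kernel. *)
Definition smooth_pos (t : R) : R := t * smooth_step t.

Lemma Cn_smooth_pos k : Cn k smooth_pos.
Proof. by apply: CnM; [exact: Cn_id|exact: Cn_smooth_step]. Qed.

Lemma smooth_pos_le0 t : t <= 0 -> smooth_pos t = 0.
Proof. by move=> t0; rewrite /smooth_pos smooth_step_le0 ?mulr0. Qed.

Lemma smooth_pos_ge1 t : 1 <= t -> smooth_pos t = t.
Proof. by move=> t1; rewrite /smooth_pos smooth_step_ge1 ?mulr1. Qed.

Lemma near_cst_derive (f : R -> R) (t d c : R) :
  is_derive t (1 : R) f d -> (\forall s \near t, f s = c) -> d = 0.
Proof.
move=> df fc; have d0 : is_derive t (1 : R) (cst c) 0 by exact: is_derive_cst.
have df' : is_derive t (1 : R) f 0.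
  by apply: near_eq_is_derive d0; near do apply/esym.
by have [_ <-] := df; have [_ ->] := df'.
Unshelve. all: by end_near. Qed.

(* The second difference of [S], whose integer translates reproduce affine
   functions because [S] is [t] for large [t] and [0] for negative [t]. *)
Definition diff2 (S : R -> R) (t : R) : R := S (t + 1) - 2 * S t + S (t - 1).

Lemma sum_diff2 (S : R -> R) (n : nat) (t : R) :
  \sum_(k < n) diff2 S (t - k%:R) =
  S (t + 1) - S t - (S (t + 1 - n%:R) - S (t - n%:R)).
Proof.
elim: n => [|n IH]; first by rewrite big_ord0 !subr0 subrr.
rewrite big_ord_recr /= IH /diff2 -[n.+1%:R]natr1.
have -> : t - n%:R + 1 = t + 1 - n%:R by ring.
have -> : t - (n%:R + 1) = t - n%:R - 1 by ring.
have -> : t + 1 - (n%:R + 1) = t - n%:R by ring.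
ring.
Qed.

Lemma sum_diff2_mul (S : R -> R) (n : nat) (t : R) :
  \sum_(k < n) k%:R * diff2 S (t - k%:R) =
  S t - n%:R * (S (t + 1 - n%:R) - S (t - n%:R)) - S (t - n%:R).
Proof.
elim: n => [|n IH]; first by rewrite big_ord0 mul0r !subr0 subrr.
rewrite big_ord_recr /= IH /diff2 -[n.+1%:R]natr1.
have -> : t - n%:R + 1 = t + 1 - n%:R by ring.
have -> : t - (n%:R + 1) = t - n%:R - 1 by ring.
have -> : t + 1 - (n%:R + 1) = t - n%:R by ring.
ring.
Qed.

(* [u |-> max (-2) (min u 3)] grows by one over [[u, u + 1]] whenever
   [|u| <= 2], so the sum telescopes. *)
Lemma sum_translates_bound (f : R -> R) (c t : R) (n : nat) :
  (forall u, 2 < `|u| -> f u = 0) -> (forall u, `|f u| <= c) ->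
  \sum_(k < n) `|f (t - k%:R)| <= 5 * c.
Proof.
move=> f0 fc; pose H (u : R) : R := Num.max (- 2) (Num.min u 3).
have c0 : 0 <= c by apply: le_trans (fc 0).
have Hb u : - 2 <= H u <= 3.
  rewrite /H le_max lexx /= ge_max ge_min lexx orbT andbT; lra.
have fH u : `|f u| <= c * (H (u + 1) - H u).
  have [u2|u2] := ltP 2 `|u|.
    rewrite f0 // normr0 mulr_ge0 // subr_ge0 /H.
    by rewrite le_max2 // le_min2 // lerDl.
  move: u2; rewrite ler_norml => /andP[u1 u2].
  have -> : H (u + 1) - H u = 1.
    rewrite /H.
    have -> : Num.min (u + 1) 3 = u + 1 by apply/min_idPl; lra.
    have -> : Num.min u 3 = u by apply/min_idPl; lra.
    have -> : Num.max (- 2) (u + 1) = u + 1 by apply/max_idPr; lra.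
    by have -> : Num.max (- 2) u = u by [apply/max_idPr; lra]; ring.
  by rewrite mulr1.
apply: (@le_trans _ _ (\sum_(k < n) c * (H (t - k%:R + 1) - H (t - k%:R)))).
  by apply: ler_sum => k _; exact: fH.
rewrite -mulr_sumr mulrC ler_wpM2r //.
have -> : \sum_(k < n) (H (t - k%:R + 1) - H (t - k%:R)) =
    H (t + 1) - H (t + 1 - n%:R).
  elim: n => [|m IH]; first by rewrite big_ord0 subr0 subrr.
  rewrite big_ord_recr /= IH -[m.+1%:R]natr1.
  have -> : t - m%:R + 1 = t + 1 - m%:R by ring.
  have -> : t + 1 - (m%:R + 1) = t - m%:R by ring.
  ring.
have := Hb (t + 1); have := Hb (t + 1 - n%:R); lra.
Qed.

End SmoothReal.

(** The kernel is [diff2 S], and its derivative is [diff2 S']. The four moment identities are the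
    telescoped sums: [1 < t] puts [t] and [t + 1] in the range where [S] is the identity, and
    [t + 1 < n] puts [t - n] and [t + 1 - n] in the range where it vanishes. The support bound 2 is
    the range [[0, 1]] enlarged by the shifts by 1. *)
Lemma quasi_kernel_of (R : realType) (S : R -> R) :
  (forall k, Cn R k S) -> (forall t, t <= 0 -> S t = 0) ->
  (forall t, 1 <= t -> S t = t) -> exists (b b' : R -> R) (c : R),
  [/\ forall k, Cn R k b,
      forall t, is_derive t (1 : R) b (b' t),
      forall u, 2 < `|u| -> b u = 0 /\ b' u = 0,
      forall u, `|b u| <= c /\ `|b' u| <= c &
      forall (n : nat) (t : R), 1 < t -> t + 1 < n%:R ->
      [/\ \sum_(k < n) b (t - k%:R) = 1, \sum_(k < n) (k%:R - t) * b (t - k%:R) = 0,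
          \sum_(k < n) b' (t - k%:R) = 0 &
          \sum_(k < n) (k%:R - t) * b' (t - k%:R) = 1]].
Proof.
move=> CS Sle0 Sge1.
have [S' dS cS'] := CS 1%N.
have S'0 t : t < 0 -> S' t = 0.
  move=> t0; apply: (near_cst_derive R S t _ 0 (dS t)); near=> s.
  by apply: Sle0; apply/ltW; near: s; exact: lt_nbhsl.
have S'1 t : 1 < t -> S' t = 1.
  move=> t1.
  have d1 : is_derive t (1 : R) (fun s => S s - s) (S' t - 1).
    by apply: is_deriveB.
  apply/eqP; rewrite -subr_eq0; apply/eqP.
  apply: (near_cst_derive R _ t _ 0 d1); near=> s.
  rewrite Sge1 ?subrr //; apply/ltW; near: s; exact: lt_nbhsr.
have dshift (f f' : R -> R) (a : R) : (forall t, is_derive t (1 : R) f (f' t)) ->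
    forall t, is_derive t (1 : R) (fun s => f (s + a)) (f' (t + a)).
  move=> df t.
  have h : is_derive t (1 : R) (fun s : R => s + a) 1.
    by apply: is_derive_eq; rewrite addr0.
  by have := @is_derive1_comp R f (fun s => s + a) t _ _ (df (t + a)) h;
    rewrite mulr1.
have Cshift k (a : R) : Cn R k (fun t => S (t + a)).
  apply: (Cn_comp R k S); first exact: CS.
  by apply: CnD; [exact: Cn_id|exact: Cn_cst].
have bnd (f : R -> R) : continuous f -> (forall u, 2 < `|u| -> f u = 0) ->
    exists c, forall u, `|f u| <= c.
  move=> cf f0.
  have cnf : {within `[(-2 : R), 2], continuous (fun u => `|f u|)}.
    apply: continuous_subspaceT => u; apply: continuous_comp; first exact: cf.
    exact: norm_continuous.
  have [x _ hx] := @EVT_max R _ (- 2) 2 ltac:(lra) cnf.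
  exists `|f x| => u; have [u2|u2] := ltP 2 `|u|; first by rewrite f0 // normr0.
  by apply: hx; rewrite in_itv /= -ler_norml.
have cdiff (f : R -> R) : continuous f -> continuous (diff2 R f).
  move=> cf u.
  have cs (a : R) : continuous_at u (fun s => f (s + a)).
    apply: (@continuous_comp _ _ _ (fun s : R => s + a) f); last exact: cf.
    by apply: cvgD; [exact: cvg_id|exact: cvg_cst].
  apply: cvgD; last exact: cs.
  apply: cvgB; first exact: cs.
  by apply: cvgM; [exact: cvg_cst|exact: cf].
have b0 u : 2 < `|u| -> diff2 R S u = 0 /\ diff2 R S' u = 0.
  move=> u2; have [u0|u0] := lerP 0 u.
    rewrite ger0_norm // in u2.
    by rewrite /diff2 !Sge1 ?S'1; [split; ring| lra..].
  rewrite ltr0_norm // in u2.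
  by rewrite /diff2 !Sle0 ?S'0; [split; ring| lra..].
have cS : continuous S := CS 0%N.
have [c1 h1] := bnd (diff2 R S) (cdiff _ cS) (fun u h => (b0 u h).1).
have [c2 h2] := bnd (diff2 R S') (cdiff _ cS') (fun u h => (b0 u h).2).
exists (diff2 R S), (diff2 R S'), (Num.max c1 c2); split => //.
- move=> k; rewrite /diff2.
  have -> : (fun t => S (t + 1) - 2 * S t + S (t - 1)) =
     (fun t => (S (t + 1) + (- 2) * S t) + S (t - 1)).
    by apply/funext => t; ring.
  apply: CnD; last exact: Cshift.
  by apply: CnD; [exact: Cshift|apply: CnZ; exact: CS].
- move=> t; have e1 := dshift _ _ 1 dS t; have e2 := dshift _ _ (- 1) dS t.
  have e3 := is_deriveZ 2 (dS t).
  exact: is_deriveD (is_deriveB e1 e3) e2.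
- by move=> u; split; rewrite le_max ?h1 ?h2 ?orbT.
move=> n t t1 tn.
have s0 (f : R -> R) : \sum_(k < n) (k%:R - t) * f (t - k%:R) =
    \sum_(k < n) k%:R * f (t - k%:R) - t * \sum_(k < n) f (t - k%:R).
  by rewrite mulr_sumr -sumrB; apply: eq_bigr => k _; ring.
have e1 : S (t + 1) = t + 1 by apply: Sge1; lra.
have e2 : S t = t by apply: Sge1; lra.
have e3 : S (t + 1 - n%:R) = 0 by apply: Sle0; lra.
have e4 : S (t - n%:R) = 0 by apply: Sle0; lra.
have e1' : S' (t + 1) = 1 by apply: S'1; lra.
have e2' : S' t = 1 by apply: S'1; lra.
have e3' : S' (t + 1 - n%:R) = 0 by apply: S'0; lra.
have e4' : S' (t - n%:R) = 0 by apply: S'0; lra.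
by split; rewrite ?s0 ?sum_diff2_mul !sum_diff2 ?e1 ?e2 ?e3 ?e4 ?e1' ?e2' ?e3' ?e4';
  ring.
Unshelve. all: by end_near. Qed.

Lemma quasi_kernel (R : realType) : exists (b b' : R -> R) (c : R),
  [/\ forall k, Cn R k b,
      forall t, is_derive t (1 : R) b (b' t),
      forall u, 2 < `|u| -> b u = 0 /\ b' u = 0,
      forall u, `|b u| <= c /\ `|b' u| <= c &
      forall (n : nat) (t : R), 1 < t -> t + 1 < n%:R ->
      [/\ \sum_(k < n) b (t - k%:R) = 1, \sum_(k < n) (k%:R - t) * b (t - k%:R) = 0,
          \sum_(k < n) b' (t - k%:R) = 0 &
          \sum_(k < n) (k%:R - t) * b' (t - k%:R) = 1]].
Proof.
apply: (quasi_kernel_of R (smooth_pos R)).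
- exact: Cn_smooth_pos.
- exact: smooth_pos_le0.
- exact: smooth_pos_ge1.
Qed.

(** * Tensor products of one-variable functions *)

Section Tensor.
Variables (R : realType) (N : nat).
Notation V := 'rV[R]_N.

Definition tensor (f : 'I_N -> R -> R) (x : V) : R := \prod_l f l (x ord0 l).

Definition subst_at (i : 'I_N) (f : 'I_N -> R -> R) (g : R -> R) :=
  fun l => if l == i then g else f l.

Lemma tensor_subst i f g x :
  tensor (subst_at i f g) x = g (x ord0 i) * \prod_(l | l != i) f l (x ord0 l).
Proof.
rewrite /tensor (bigD1 i) //= /subst_at eqxx; congr (_ * _).
by apply: eq_bigr => l /negbTE ->.
Qed.

Lemma tensor_derive (f : 'I_N -> R -> R) i (g : R -> R) (x : V) :
  (forall t, is_derive t (1 : R) (f i) (g t)) ->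
  is_derive x (evec R i) (tensor f) (tensor (subst_at i f g) x).
Proof.
move=> df; apply: is_derive_eps.2 => e e0.
pose P := \prod_(l | l != i) f l (x ord0 l).
have P0 := normr_ge0 P.
have [r r0 hr] := is_derive_eps.1 (df (x ord0 i)) (e / (`|P| + 1))
  ltac:(by apply: divr_gt0 => //; lra).
exists r => // h /hr {}hr.
have -> : tensor f (x + h *: evec R i) = f i (x ord0 i + h) * P.
  rewrite /tensor (bigD1 i) //=; congr (_ * _).
    by rewrite !mxE eqxx mulr1.
  by apply: eq_bigr => l li; rewrite !mxE eq_sym (negbTE li) mulr0 addr0.
have -> : tensor f x = f i (x ord0 i) * P by rewrite /tensor (bigD1 i).
rewrite tensor_subst -/P.
move: hr; rewrite -[h *: 1]/(h * 1) mulr1 => hr.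
have -> : f i (x ord0 i + h) * P - f i (x ord0 i) * P - g (x ord0 i) * P * h =
  (f i (x ord0 i + h) - f i (x ord0 i) - g (x ord0 i) * h) * P by ring.
rewrite normrM; apply: le_trans (ler_wpM2r P0 hr) _.
rewrite mulrAC ler_wpM2r // mulrAC ler_pdivrMr; [nra|lra].
Qed.

Lemma tensor_differentiable (f : 'I_N -> R -> R) (x : V) :
  (forall l, Cn R 1 (f l)) -> differentiable (tensor f) x.
Proof.
move=> cf; rewrite /tensor.
elim: (index_enum _) => [|l r IH].
  rewrite (_ : (fun x => _) = cst (1 : R)); first exact: differentiable_cst.
  by apply/funext => y; rewrite big_nil.
rewrite (_ : (fun x => _) = (fun x : V => f l (x ord0 l)) *
   (fun x : V => \prod_(l <- r) f l (x ord0 l))); last first.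
  by apply/funext => y; rewrite big_cons.
apply: differentiableM => //.
apply: (@differentiable_comp _ _ _ _ (fun x : V => x ord0 l) (f l)).
  exact: differentiable_coord.
by apply/derivable1_diffP; have [f' df _] := cf l; exact: ex_derive.
Qed.

Lemma partialE i (f : V -> R) x d : is_derive x (evec R i) f d ->
  partial i f x = d.
Proof. by move=> [_]. Qed.

Lemma Ck_tensor k (f : 'I_N -> R -> R) :
  (forall l j, Cn R j (f l)) -> Ck k (tensor f).
Proof.
(* One order is sacrificed: at order 0 continuity is deduced from differentiability, which asks for
   [C^1] factors. *)
suff H : (forall l, Cn R k.+1 (f l)) -> Ck k (tensor f) by move=> h; apply: H.
elim: k f => [|k IH] f cf.
  by move=> x; apply: differentiable_continuous; apply: tensor_differentiable.
split.
  move=> x; apply: tensor_differentiable => l.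
  elim: k {IH} cf => [|k IHk] cf; first exact/CnS/cf.
  by apply: IHk => j; exact/CnS/cf.
move=> i; have [f' df cf'] := cf i.
rewrite (_ : partial i _ = tensor (subst_at i f f')); last first.
  by apply/funext => x; apply: partialE; exact: tensor_derive.
apply: IH => l; rewrite /subst_at; case: eqP => // _; exact/CnS/cf.
Qed.

Lemma Ck_cst k (c : R) : @Ck R N k (cst c).
Proof.
elim: k c => [|k IH] c /=; first by move=> x; exact: cst_continuous.
split=> [x|i]; first exact: differentiable_cst.
rewrite (_ : partial i _ = cst 0) //.
by apply/funext => x; apply: partialE; exact: is_derive_cst.
Qed.

Lemma diff_partial (f : V -> R) x i : differentiable f x ->
  is_derive x (evec R i) f (partial i f x).
Proof. by move=> df; split => //; exact: diff_derivable. Qed.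

Lemma CkD k (f g : V -> R) : Ck k f -> Ck k g -> Ck k (fun x => f x + g x).
Proof.
elim: k f g => [|k IH] f g.
  by move=> cf cg x; exact: (continuousD (cf x) (cg x)).
move=> [df cf] [dg cg]; split=> [x|i]; first exact: differentiableD.
rewrite (_ : partial i _ = (fun x => partial i f x + partial i g x)).
  exact: (IH _ _ (cf i) (cg i)).
apply/funext => x; apply: partialE.
by apply: is_deriveD; exact: diff_partial.
Qed.

Lemma CkZ k (c : R) (f : V -> R) : Ck k f -> Ck k (fun x => c * f x).
Proof.
elim: k f => [|k IH] f.
  move=> cf x; apply: (@continuousM _ _ (cst c) f x _ (cf x)).
  exact: cst_continuous.
move=> [df cf]; split=> [x|i]; first exact: differentiableZ.
rewrite (_ : partial i _ = (fun x => c * partial i f x)).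
  exact: (IH _ (cf i)).
apply/funext => x; apply: partialE.
by apply: is_deriveZ; exact: diff_partial.
Qed.

Lemma Ck_sum k (I : Type) (r : seq I) (c : I -> R) (F : I -> V -> R) :
  (forall a, Ck k (F a)) -> Ck k (fun x => \sum_(a <- r) c a * F a x).
Proof.
move=> cF; elim: r => [|a r IH].
  rewrite (_ : (fun x => _) = cst 0); first exact: Ck_cst.
  by apply/funext => x; rewrite big_nil.
rewrite (_ : (fun x => _) =
   (fun x => c a * F a x + \sum_(a <- r) c a * F a x)).
  by apply: CkD => //; exact: CkZ.
by apply/funext => x; rewrite big_cons.
Qed.

Lemma derive_sum_seq (I : Type) (r : seq I) (c : I -> R) (F dF : I -> V -> R)
    (x v : V) :
  (forall a, is_derive x v (F a) (dF a x)) ->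
  is_derive x v (fun x => \sum_(a <- r) c a * F a x)
    (\sum_(a <- r) c a * dF a x).
Proof.
move=> h; elim: r => [|a r IH].
  rewrite big_nil (_ : (fun x => _) = cst 0); first exact: is_derive_cst.
  by apply/funext => y; rewrite big_nil.
rewrite big_cons (_ : (fun x => _) =
   (fun x => c a * F a x + \sum_(a <- r) c a * F a x)).
  by apply: is_deriveD => //; exact: is_deriveZ.
by apply/funext => y; rewrite big_cons.
Qed.

Lemma sum_evec (v : V) : v = \sum_i v ord0 i *: evec R i.
Proof.
apply/rowP => j; rewrite summxE (bigD1 j) //= !mxE eqxx mulr1 big1 ?addr0 //.
by move=> l lj; rewrite !mxE (negbTE lj) mulr0.
Qed.

Lemma differentiable_derive (f : V -> R) (x v : V) : differentiable f x ->
  is_derive x v f (\sum_i v ord0 i * partial i f x).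
Proof.
move=> df; split; first exact: diff_derivable.
rewrite deriveE // [in LHS](sum_evec v) linear_sum; apply: eq_bigr => i _.
by rewrite linearZ /partial deriveE.
Qed.

(** Differentiability is recorded as directional derivatives linear in the direction: this form is
    directly checkable for functions cut off by zero. *)
Definition C1c (K : R) (f : V -> R) :=
  [/\ cc R N K f,
      forall x v, is_derive x v f (\sum_i v ord0 i * partial i f x) &
      forall i, cc R N K (partial i f)].

(** The remainder is uniform in [x]: the mean value theorem on the segment moves the gradient to an
    intermediate point, and the partial derivatives are uniformly continuous. *)
Lemma C1c_taylor K (f : V -> R) : C1c K f -> forall e : R, 0 < e ->
  exists2 r : R, 0 < r & forall x y : V, `|y - x| < r ->
    `|f y - f x - \sum_i (y - x) ord0 i * partial i f x| <= e * `|y - x|.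
Proof.
move=> [_ df cdf] e e0.
have [r r0 hr] : exists2 r : R, 0 < r & forall i (x y : V), `|x - y| < r ->
    `|partial i f x - partial i f y| <= e / N.+1%:R.
  have e1 : 0 < e / N.+1%:R by apply: divr_gt0.
  have h i := cc_unif_cont _ _ _ _ (cdf i) _ e1.
  pose rr i := projT1 (cid2 (h i)).
  have hrr i : 0 < rr i /\ (forall x y : V, `|x - y| < rr i ->
     `|partial i f x - partial i f y| <= e / N.+1%:R).
    by rewrite /rr; case: cid2.
  exists (\big[Num.min/1]_i rr i).
    elim/big_ind: _ => // [a b|i _]; last by have [] := hrr i.
    by rewrite lt_min => -> ->.
  move=> i x y xy; apply: (hrr i).2; apply: lt_le_trans xy _.
  exact: bigmin_le_cond.
exists r => // x y xy; set v := y - x.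
pose p (t : R) := f (x + t *: v).
pose dp (t : R) := \sum_i v ord0 i * partial i f (x + t *: v).
have hp t : is_derive t (1 : R) p (dp t).
  exact: (is_derive_line.1 (df _ v)).
have cp : {within `[0 : R, 1], continuous p}.
  apply: continuous_subspaceT => t; exact: is_derive1_continuous (hp t).
have [c c01 hc] := MVT ltr01 (fun t _ => hp t) cp.
have -> : f y - f x = dp c.
  move: hc; rewrite /p scale1r scale0r addr0 subr0 mulr1 => <-.
  by rewrite /v (addrC x) subrK.
rewrite /dp -sumrB; apply: le_trans (ler_norm_sum _ _ _) _.
apply: (@le_trans _ _ (\sum_(i < N) `|v| * (e / N.+1%:R))).
  apply: ler_sum => i _; rewrite -mulrBr normrM ler_pM // ?coord_le_norm //.
  apply: hr; rewrite addrC addKr normrZ.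
  move: c01; rewrite in_itv /= => /andP[c0 c1].
  rewrite gtr0_norm //; apply: le_lt_trans xy; rewrite -/v.
  by rewrite ler_piMl // ltW.
have -> : \sum_(i < N) `|v| * (e / N.+1%:R) = `|v| * e * (N%:R / N.+1%:R).
  by rewrite sumr_const card_ord -[LHS]mulr_natr; ring.
rewrite mulrC [e * _]mulrC mulrC ler_piMr ?mulr_ge0 ?(ltW e0) //.
by rewrite ler_pdivrMr // mul1r ler_nat.
Qed.

End Tensor.

(** * Approximation in [C^1] by lattice sums *)

Section QuasiInterpolation.
Variables (R : realType) (N : nat).
Notation V := 'rV[R]_N.

Lemma tensor_sum (n : nat) (F : 'I_N -> 'I_n -> R) :
  \sum_(k : {ffun 'I_N -> 'I_n}) \prod_l F l (k l) = \prod_l \sum_(j < n) F l j.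
Proof. by rewrite bigA_distr_bigA. Qed.

(** Sums over lattice points of product weights factor into one-dimensional sums, so their total
    mass is at most [c ^+ N], whatever the number of nodes; the coefficients matter only where the
    weight is nonzero. *)
Lemma tensor_sum_bound (n : nat) (F : 'I_N -> 'I_n -> R) (a : {ffun 'I_N -> 'I_n} -> R)
    (c e : R) : 0 <= e -> (forall l, \sum_(j < n) `|F l j| <= c) ->
  (forall k : {ffun 'I_N -> 'I_n}, \prod_l F l (k l) != 0 -> `|a k| <= e) ->
  `|\sum_(k : {ffun 'I_N -> 'I_n}) a k * \prod_l F l (k l)| <= e * c ^+ N.
Proof.
move=> e0 Fc ae; apply: le_trans (ler_norm_sum _ _ _) _.
apply: (@le_trans _ _ (\sum_(k : {ffun 'I_N -> 'I_n}) e * \prod_l `|F l (k l)|)).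
  apply: ler_sum => k _; rewrite normrM normr_prod.
  have [/eqP P0|/ae h] := boolP (\prod_l F l (k l) == 0).
    rewrite -!normr_prod P0 normr0 mulr0 mulr0; exact: lexx.
  by rewrite ler_wpM2r // prodr_ge0.
rewrite -mulr_sumr (tensor_sum n (fun l j => `|F l j|)) ler_wpM2l //.
have -> : c ^+ N = \prod_(l < N) c by rewrite prodr_const card_ord.
by apply: ler_prod => l _; rewrite Fc sumr_ge0.
Qed.

(* [\sum_k psi (h k) b (x / h - k)] over a lattice of mesh [h] converges to
   [psi] in [C^1] because the translates of [b] reproduce affine functions. *)
Lemma smooth_approx (K : R) (psi : V -> R) : 0 < K -> C1c R N K psi ->
  forall e : R, 0 < e -> exists zeta : V -> R,
  [/\ smooth zeta, forall x, `|zeta x - psi x| <= e,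
      forall x i, `|partial i zeta x - partial i psi x| <= e &
      forall x, zeta x != 0 -> exists2 y, psi y != 0 & `|y - x| <= e].
Proof.
move=> K0 C1psi e e0.
have [b [b' [c [cb db b0 bc bsum]]]] := quasi_kernel R.
have c0 : 0 <= c by apply: le_trans (bc 0).1.
pose C : R := (5 * c) ^+ N.
have C0 : 0 <= C by rewrite exprn_ge0 // mulr_ge0.
pose e1 : R := e / (2 * C + 1).
have e10 : 0 < e1 by apply: divr_gt0; lra.
have e1C : e1 * 2 * C <= e.
  rewrite /e1 -mulrA mulrAC ler_pdivrMr; last lra.
  by rewrite ler_wpM2l ?(ltW e0) //; lra.
have e1C' : e1 * C <= e.
  by apply: le_trans e1C; rewrite -mulrA ler_wpM2l ?(ltW e10) //; lra.
have [ccpsi dpsi ccdpsi] := C1psi.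
have [r1 r10 hr1] := C1c_taylor R N K psi C1psi e1 e10.
have [r2 r20 hr2] := cc_unif_cont R N K psi ccpsi e1 e10.
have [h [h0 hr1' hr2' he]] : exists h : R, [/\ 0 < h, 2 * h < r1, 2 * h < r2 & 2 * h <= e].
  exists (Num.min r1 (Num.min r2 e) / 3).
  have m0 : 0 < Num.min r1 (Num.min r2 e) by rewrite !lt_min r10 r20 e0.
  have [m1 m2 m3] : [/\ Num.min r1 (Num.min r2 e) <= r1,
    Num.min r1 (Num.min r2 e) <= r2 & Num.min r1 (Num.min r2 e) <= e].
    by rewrite !ge_min !lexx ?orbT.
  split; lra.
have hz : h != 0 by rewrite gt_eqF.
(* Number of nodes on each side of the origin: for [|x| <= K + 2 * h] all rescaled coordinates
   [tt x l] then lie in the range where the moment identities of the kernel hold. *)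
pose m := (Num.truncn ((K + 2 * h) / h + 1)).+1.
have hm : (K + 2 * h) / h + 1 < m%:R by rewrite truncnS_gt.
pose n := (m + m)%N.
pose node (k : {ffun 'I_N -> 'I_n}) : V := \row_l (h * ((k l)%:R - m%:R)).
pose tt (x : V) (l : 'I_N) : R := x ord0 l / h + m%:R.
pose F (x : V) l (j : 'I_n) : R := b (tt x l - j%:R).
pose bl (k : {ffun 'I_N -> 'I_n}) (l : 'I_N) (s : R) : R := b (s / h + m%:R - (k l)%:R).
pose bl' (k : {ffun 'I_N -> 'I_n}) (l : 'I_N) (s : R) : R :=
  h^-1 * b' (s / h + m%:R - (k l)%:R).
pose zeta (x : V) : R := \sum_k psi (node k) * tensor R N (bl k) x.
have dbl k l s : is_derive s (1 : R) (bl k l) (bl' k l s).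
  have d1 : is_derive s (1 : R) (fun s : R => s / h + m%:R - (k l)%:R) h^-1.
    have d2 : is_derive s (1 : R) (fun s : R => h^-1 * s) (h^-1 * 1).
      by apply: is_deriveZ.
    have d3 : is_derive s (1 : R) (fun s : R => h^-1 * s + (m%:R - (k l)%:R))
      (h^-1 * 1 + 0) by apply: is_deriveD.
    rewrite mulr1 addr0 in d3.
    rewrite (_ : (fun s => _) = (fun s : R => h^-1 * s + (m%:R - (k l)%:R))) //.
    by apply/funext => u; ring.
  have := @is_derive1_comp R b _ s _ _ (db _) d1.
  by rewrite mulrC.
have dzeta x i : partial i zeta x =
   \sum_k psi (node k) * tensor R N (subst_at R N i (bl k) (bl' k i)) x.
  apply: partialE; apply: (derive_sum_seq R N _ _ _ _
    (fun k => tensor R N (subst_at R N i (bl k) (bl' k i)))) => k.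
  exact: tensor_derive.
have nodeE x (k : {ffun 'I_N -> 'I_n}) l :
    (node k - x) ord0 l = h * ((k l)%:R - tt x l).
  by rewrite !mxE /tt; field.
have far x (k : {ffun 'I_N -> 'I_n}) (f : 'I_N -> R -> R) :
    (forall l u, 2 < `|u| -> f l u = 0) ->
    \prod_l f l (tt x l - (k l)%:R) != 0 -> `|node k - x| <= 2 * h.
  move=> f0 P0; rewrite leNgt; apply/negP => far; case/negP: P0.
  have [l hl] : exists l, 2 * h < `|(node k - x) ord0 l|.
    apply: contrapT => H; move: far; apply/negP; rewrite -leNgt.
    apply/ler_addgt0Pr => d d0; apply/ltW; apply: row_norm_lt; first lra.
    move=> l; rewrite ltNge; apply/negP => hl; apply: H; exists l; lra.
  rewrite (bigD1 l) //= f0 ?mul0r // distrC.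
  move: hl; rewrite nodeE normrM gtr0_norm // mulrC; by rewrite ltr_pM2l.
have inside x l : `|x| <= K + 2 * h -> 1 < tt x l /\ tt x l + 1 < n%:R.
  move=> xK; have := le_trans (coord_le_norm _ _ x l) xK.
  rewrite /tt /n natrD ler_norml => /andP[x1 x2].
  have y1 : - ((K + 2 * h) / h) <= x ord0 l / h.
    by rewrite -mulNr ler_pM2r ?invr_gt0.
  have y2 : x ord0 l / h <= (K + 2 * h) / h by rewrite ler_pM2r ?invr_gt0.
  by split; lra.
have zero x : K + 2 * h < `|x| -> forall k : {ffun 'I_N -> 'I_n},
    `|node k - x| <= 2 * h -> psi (node k) = 0.
  move=> xK k kx; apply: ccpsi.2.
  have := ler_normB (node k) (node k - x).
  rewrite opprB addrC subrK; lra.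
(* Factors of the kernel after differentiation in direction [i], without the factor [h^-1]. *)
pose gam (i l : 'I_N) : R -> R := if l == i then b' else b.
have gam0 i l (u : R) : 2 < `|u| -> gam i l u = 0.
  by rewrite /gam => /b0[? ?]; case: ifP.
have dzetaE x i : partial i zeta x = h^-1 *
    \sum_(k : {ffun 'I_N -> 'I_n}) psi (node k) *
      \prod_l gam i l (tt x l - (k l)%:R).
  rewrite dzeta mulr_sumr; apply: eq_bigr => k _; rewrite tensor_subst.
  rewrite [in RHS]mulrCA; congr (_ * _); rewrite [in RHS](bigD1 i) //= /gam eqxx mulrA.
  by congr (_ * _); apply: eq_bigr => l /negbTE ->.
exists zeta; split.
- by move=> k; apply: Ck_sum => a; apply: Ck_tensor => l j; rewrite /bl;
    apply: (Cn_comp R j b) => //; apply: CnD; last exact: Cn_cst;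
    apply: CnD; last exact: Cn_cst; apply: CnM; [exact: Cn_id|exact: Cn_cst].
- move=> x; have [xK|xK] := lerP `|x| (K + 2 * h); last first.
    rewrite /zeta big1 ?(ccpsi.2 x) ?subr0 ?normr0 ?(ltW e0) //; first lra.
    move=> k _; have [/eqP ->|h1] := boolP (tensor R N (bl k) x == 0).
      by rewrite mulr0.
    rewrite (zero x) ?mul0r //; apply: (far x k (fun=> b)) => // l u.
    by move=> /b0[].
  have one : \sum_(k : {ffun 'I_N -> 'I_n}) \prod_l b (tt x l - (k l)%:R) = 1.
    rewrite (tensor_sum n (fun l j => b (tt x l - j%:R))) big1 // => l _.
    by have [t1 t2] := inside x l xK; have [] := bsum n _ t1 t2.
  rewrite -[psi x]mulr1 -one mulr_sumr /zeta -sumrB.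
  under eq_bigr => k _ do rewrite /tensor -mulrBl.
  apply: le_trans e1C'.
  apply: (tensor_sum_bound n (fun l j => b (tt x l - j%:R))
    (fun k => psi (node k) - psi x) (5 * c)); first exact: ltW.
    move=> l; apply: sum_translates_bound => u; first by move=> /b0[].
    by have [] := bc u.
  move=> k h1; apply: hr2; apply: le_lt_trans hr2'.
  by apply: (far x k (fun=> b)) => // l u; move=> /b0[].
- move=> x i; have [xK|xK] := lerP `|x| (K + 2 * h); last first.
    rewrite dzetaE big1 ?((ccdpsi i).2 x) ?mulr0 ?subr0 ?normr0 ?(ltW e0) //; first lra.
    move=> k _; have [/eqP ->|h1] := boolP (\prod_l gam i l (tt x l - (k l)%:R) == 0).
      by rewrite mulr0.
    by rewrite (zero x) ?mul0r //; exact: (far x k (gam i) (gam0 i)).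
  have zer : \sum_(k : {ffun 'I_N -> 'I_n}) \prod_l gam i l (tt x l - (k l)%:R) = 0.
    rewrite (tensor_sum n (fun l j => gam i l (tt x l - j%:R))) (bigD1 i) //=.
    have [t1 t2] := inside x i xK; have [_ _ + _] := bsum n _ t1 t2.
    by rewrite /gam eqxx => ->; rewrite mul0r.
  (* The zeroth moment of [b'] is 0 and its first moment is 1, so the first moments of the product
     form the Kronecker symbol; this reproduces the gradient exactly. *)
  have lin j : \sum_(k : {ffun 'I_N -> 'I_n}) ((k j)%:R - tt x j) *
      \prod_l gam i l (tt x l - (k l)%:R) = (j == i)%:R.
    pose G (l : 'I_N) (q : 'I_n) := (if l == j then q%:R - tt x l else 1) *
       gam i l (tt x l - q%:R).
    transitivity (\sum_(k : {ffun 'I_N -> 'I_n}) \prod_l G l (k l)).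
      apply: eq_bigr => k _; rewrite /G big_split /=; congr (_ * _).
      rewrite (bigD1 j) //= eqxx big1 ?mulr1 // => l /negbTE -> //.
    rewrite tensor_sum (bigD1 i) //=.
    have [t1 t2] := inside x i xK; have [_ _ z1 z2] := bsum n _ t1 t2.
    have [ji|ji] := eqVneq j i.
      rewrite /G ji eqxx /gam eqxx z2 mul1r big1 // => l li.
      rewrite (negbTE li).
      have [s1 s2] := inside x l xK; have [q1 _ _ _] := bsum n _ s1 s2.
      by rewrite -[RHS]q1; apply: eq_bigr => q _; rewrite mul1r.
    rewrite /G [i == j]eq_sym (negbTE ji) /gam eqxx.
    under eq_bigr => q _ do rewrite mul1r.
    by rewrite z1 mul0r.
  (* Differentiation costs a factor [h^-1], but the moment identities replace nodal values by Taylor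
     remainders, which are at most [e1 * (2 * h)] on the active nodes; the mesh cancels. *)
  pose D := \sum_(k : {ffun 'I_N -> 'I_n})
    (psi (node k) - psi x - \sum_j (node k - x) ord0 j * partial j psi x) *
      \prod_l gam i l (tt x l - (k l)%:R).
  have DE : D = h * (partial i zeta x - partial i psi x).
    rewrite dzetaE mulrBr mulrA mulfV // mul1r /D.
    under eq_bigr => k _ do rewrite !mulrBl.
    rewrite !sumrB -[X in _ - X - _]mulr_sumr zer mulr0 subr0; congr (_ - _).
    under eq_bigr => k _ do rewrite mulr_suml.
    rewrite exchange_big /=.
    transitivity (\sum_j h * partial j psi x * (j == i)%:R).
      apply: eq_bigr => j _; rewrite -lin mulr_sumr; apply: eq_bigr => k _.
      by rewrite nodeE; ring.
    rewrite (bigD1 i) //= eqxx mulr1 big1 ?addr0 // => j /negbTE ->.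
    by rewrite mulr0.
  have : `|D| <= e1 * (2 * h) * C.
    apply: (tensor_sum_bound n (fun l j => gam i l (tt x l - j%:R)) _ (5 * c)).
    + by apply: mulr_ge0; [exact: ltW|lra].
    + move=> l; apply: sum_translates_bound => u; first exact: gam0.
      by rewrite /gam; have [] := bc u; case: ifP.
    + move=> k h1; have kx : `|node k - x| <= 2 * h by exact: (far x k (gam i) (gam0 i)).
      apply: le_trans (hr1 _ _ _) _; first exact: le_lt_trans hr1'.
      by rewrite ler_wpM2l // ltW.
  rewrite DE normrM gtr0_norm //.
  have -> : e1 * (2 * h) * C = h * (e1 * 2 * C) by ring.
  by rewrite ler_pM2l // => /le_trans; apply.
- move=> x zx; apply: contrapT => H; case/negP: zx; rewrite /zeta big1 // => k _.
  have [/eqP ->|h1] := boolP (tensor R N (bl k) x == 0); first by rewrite mulr0.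
  have [/eqP ->|h2] := boolP (psi (node k) == 0); first by rewrite mul0r.
  case: H; exists (node k) => //; apply: le_trans he.
  by apply: (far x k (fun=> b)) => // l u; move=> /b0[].
Qed.

End QuasiInterpolation.

(** * The weak formulation tested on quadratic functions *)

Section Cutoff.
Variables (R : realType) (N : nat).
Notation V := 'rV[R]_N.
Implicit Types (f g : V -> R).

Lemma is_derive_chain (f : R -> R) (g : V -> R) (x v : V) (a b : R) :
  is_derive (g x) (1 : R) f a -> is_derive x v g b ->
  is_derive x v (fun y => f (g y)) (a * b).
Proof.
move=> df dg; have x0 : x = x + (0 : R) *: v by rewrite scale0r addr0.
rewrite x0; apply/is_derive_line; rewrite x0 in dg df.
exact: (@is_derive1_comp R f (fun s => g (x + s *: v)) 0 a b df (is_derive_line.1 dg)).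
Qed.

Lemma cont_sum (I : Type) (r : seq I) (F : I -> V -> R) (x : V) :
  (forall i, {for x, continuous (F i)}) ->
  {for x, continuous (fun y => \sum_(i <- r) F i y)}.
Proof.
move=> cF; elim: r => [|i r IH].
  rewrite (_ : (fun y => _) = cst 0); first exact: cst_continuous.
  by apply/funext => y; rewrite big_nil.
rewrite (_ : (fun y => _) = (fun y => F i y + \sum_(i <- r) F i y)).
  exact: (continuousD (cF i) IH).
by apply/funext => y; rewrite big_cons.
Qed.

Lemma cont_mul f g (x : V) : {for x, continuous f} -> {for x, continuous g} ->
  {for x, continuous (fun y => f y * g y)}.
Proof. by move=> cf cg; exact: (continuousM cf cg). Qed.

Lemma cont_comp (h : R -> R) f (x : V) : {for x, continuous f} ->
  {for f x, continuous h} -> {for x, continuous (fun y => h (f y))}.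
Proof. by move=> cf ch; exact: (continuous_comp cf ch). Qed.

Lemma cont_exp f n (x : V) : {for x, continuous f} ->
  {for x, continuous (fun y => f y ^+ n)}.
Proof.
move=> cf; elim: n => [|n IH].
  rewrite (_ : (fun y => _) = cst 1); first exact: cst_continuous.
  by apply/funext => y; rewrite expr0.
rewrite (_ : (fun y => _) = (fun y => f y * f y ^+ n)).
  exact: cont_mul.
by apply/funext => y; rewrite exprS.
Qed.

Lemma near_norm_lt (x0 x : V) (d : R) : `|x - x0| < d ->
  \forall y \near x, `|y - x0| < d.
Proof.
move=> xd; apply/nbhs_ballP; exists (d - `|x - x0|) => /=; first lra.
move=> y; rewrite -ball_normE /= distrC => yx.
have := ler_distD x y x0; lra.
Qed.

Lemma near_norm_gt (x0 x : V) (d : R) : d < `|x - x0| ->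
  \forall y \near x, d < `|y - x0|.
Proof.
move=> xd; apply/nbhs_ballP; exists (`|x - x0| - d) => /=; first lra.
move=> y; rewrite -ball_normE /= => yx.
have := ler_distD y x x0; lra.
Qed.

(** Extension by zero of a function meaningful only in a ball. If it already vanishes on an outer
    annulus ([supp_ball]), continuity and derivatives survive. *)
Definition cut (x0 : V) (d : R) f (x : V) : R :=
  if `|x - x0| < d then f x else 0.

Definition supp_ball (x0 : V) (r d : R) f :=
  forall x, r < `|x - x0| -> `|x - x0| < d -> f x = 0.

Lemma cut_near (x0 x : V) d f : `|x - x0| < d -> \near x, f x = cut x0 d f x.
Proof. by move=> xd; near do rewrite /cut ifT //; exact: near_norm_lt.
Unshelve. all: by end_near. Qed.

Lemma cut_far (x0 x : V) r d f : supp_ball x0 r d f -> r < `|x - x0| ->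
  \near x, 0 = cut x0 d f x.
Proof.
move=> sf xr; near=> y; rewrite /cut; case: ifP => // yd; rewrite sf //.
by near: y; exact: near_norm_gt.
Unshelve. all: by end_near. Qed.

Lemma cont_near f g (x : V) : (\near x, f x = g x) ->
  {for x, continuous f} -> {for x, continuous g}.
Proof.
move=> fg cf; have e := nbhs_singleton fg; rewrite /prop_for /continuous_at -e.
move=> A fA; have h : nbhs x (f @^-1` A) := cf A fA.
by apply: filterS2 fg h => y; rewrite /preimage /= => ->.
Qed.

Lemma cut_cc (x0 : V) r d f : r < d -> supp_ball x0 r d f ->
  (forall x, `|x - x0| < d -> {for x, continuous f}) ->
  cc R N (`|x0| + d) (cut x0 d f).
Proof.
move=> rd sf cf; split=> [x|x xd].
  have [xd|xd] := ltP `|x - x0| d.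
    by apply: cont_near (cf _ xd); exact: cut_near.
  have xr : r < `|x - x0| by lra.
  by apply: cont_near (cut_far _ _ _ _ _ sf xr) _; exact: cst_continuous.
rewrite /cut; case: ifP => // xd'; exfalso.
have := ler_normD (x - x0) x0; rewrite subrK; lra.
Qed.

Lemma cut_derive (x0 : V) r d f (df : V -> R) v : r < d -> supp_ball x0 r d f ->
  (forall x, `|x - x0| < d -> is_derive x v f (df x)) ->
  forall x, is_derive x v (cut x0 d f) (cut x0 d df x).
Proof.
move=> rd sf hf x; have [xd|xd] := ltP `|x - x0| d.
  rewrite [cut x0 d df x]ifT //.
  by apply: near_eq_is_derive (hf x xd); exact: cut_near.
have xr : r < `|x - x0| by lra.
rewrite [cut x0 d df x]ifF; last by apply/negbTE; rewrite -leNgt.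
have d0 : is_derive x v (cst (0 : R)) 0 by exact: is_derive_cst.
by apply: near_eq_is_derive d0; exact: cut_far sf xr.
Qed.

(** Integration by parts from translation invariance: the increment [f (x + t e_i) - f x] has
    integral zero, and it is [t * df x] up to an error [t] times a small uniform constant. The step
    [t] is at most 1, so all supports stay in the cube of size [K + 1]. *)
Lemma integral_RN_derive0 (K : R) f (df : V -> R) i : 0 < K ->
  cc R N K f -> cc R N K df -> (forall x, is_derive x (evec R i) f (df x)) ->
  integral_RN df = 0.
Proof.
move=> K0 cf cdf hf.
have ev1 : `|evec R i| <= (1 : R).
  apply/ler_addgt0Pr => d d0; apply/ltW; apply: row_norm_lt; first lra.
  by move=> j; rewrite mxE; case: (i == j); rewrite ?normr1 ?normr0; lra.
apply/normr0_eq0/le_anti; rewrite normr_ge0 andbT.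
apply/ler_addgt0Pr => e e0; rewrite add0r.
pose C : R := (2 * (K + 1)) ^+ N.
have C0 : 0 <= C by rewrite exprn_ge0 //; lra.
have [r r0 hr] := cc_unif_cont R N K df cdf (e / (C + 1))
  ltac:(by apply: divr_gt0; lra).
pose t := Num.min (r / 2) 1.
have [t0 tr t1] : [/\ 0 < t, t < r & t <= 1].
  have [m1 m2] : t <= r / 2 /\ t <= 1 by rewrite /t !ge_min !lexx orbT.
  by split => //; [rewrite lt_min; apply/andP; split|]; lra.
have widen f' : cc R N K f' -> cc R N (K + 1) f'.
  by move=> [c1 c2]; split => // x xK; apply: c2; lra.
have cshift : cc R N (K + 1) (fun x => f (x + t *: evec R i)).
  split=> [x|x xK].
    apply: (@continuous_comp _ _ _ (fun x : V => x + t *: evec R i) f).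
      have h1 : {for x, continuous (@idfun V)} by exact: cvg_id.
      have h2 : {for x, continuous (fun _ : V => t *: evec R i)}.
        exact: cst_continuous.
      exact: (continuousD h1 h2).
    exact: cf.1.
  apply: cf.2; have := ler_normB (x + t *: evec R i) (t *: evec R i).
  rewrite addrK normrZ gtr0_norm //.
  have : t * `|evec R i| <= t * 1 by rewrite ler_wpM2l // ltW.
  lra.
have K1 : 0 <= K + 1 by lra.
have cdf1 := widen _ cdf; have cf1 := widen _ cf.
have ctdf : cc R N (K + 1) (fun x => t * df x).
  split=> [x|x xK]; last by rewrite cdf1.2 // mulr0.
  by apply: cont_mul; [exact: cst_continuous|exact: cdf.1].
have cB f1 f2 : cc R N (K + 1) f1 -> cc R N (K + 1) f2 ->
    cc R N (K + 1) (fun x => f1 x - f2 x).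
  move=> [c1 z1] [c2 z2]; split=> [x|x xK]; last by rewrite z1 // z2 // subrr.
  exact: (continuousB (c1 x) (c2 x)).
have E : integral_RN (fun x => (f (x + t *: evec R i) - f x) - t * df x) =
    - (t * integral_RN df).
  rewrite (integral_RNB R N (K + 1)) //; last exact: cB.
  rewrite (integral_RNB R N (K + 1)) // (integral_RN_shift R N K) //.
  by rewrite subrr sub0r (integral_RNZ R N (K + 1)).
have : `|integral_RN (fun x => (f (x + t *: evec R i) - f x) - t * df x)| <=
    C * (t * (e / (C + 1))).
  apply: integral_RN_bound => //; first by do 2?apply: (cB) => //.
  move=> x.
  pose p (s : R) := f (x + s *: evec R i).
  have hp s : is_derive s (1 : R) p (df (x + s *: evec R i)).
    by apply: is_derive_line.1; exact: hf.
  have cp : {within `[0 : R, t], continuous p}.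
    apply: continuous_subspaceT => s; exact: is_derive1_continuous (hp s).
  have [c c01 hc] := MVT t0 (fun s _ => hp s) cp.
  move: hc; rewrite /p scale0r addr0 subr0 => ->.
  rewrite mulrC -mulrBr normrM gtr0_norm // ler_wpM2l ?(ltW t0) //.
  apply: hr; rewrite addrC addKr normrZ.
  move: c01; rewrite in_itv /= => /andP[c0 c1].
  rewrite gtr0_norm //; apply: le_lt_trans tr.
  have : c * `|evec R i| <= c * 1 by rewrite ler_wpM2l // ltW.
  lra.
rewrite E normrN normrM gtr0_norm // mulrCA ler_pM2l // => /le_trans; apply.
by rewrite mulrA ler_pdivrMr; [nra|lra].
Qed.

End Cutoff.

(** * Euclidean norm and quadratic forms *)

Section Euclid.
Variables (R : realType) (N : nat).
Notation V := 'rV[R]_N.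
Implicit Types (v w a b : V) (X : 'M[R]_N).

Lemma dotRE v w : dotR v w = (v *m w^T) ord0 ord0.
Proof. by rewrite mxE; apply: eq_bigr => i _; rewrite mxE. Qed.

Lemma dotRC v w : dotR v w = dotR w v.
Proof. by apply: eq_bigr => i _; rewrite mulrC. Qed.

Lemma dotRDl v w a : dotR (v + w) a = dotR v a + dotR w a.
Proof. by rewrite !dotRE mulmxDl mxE. Qed.

Lemma dotRDr v w a : dotR a (v + w) = dotR a v + dotR a w.
Proof. by rewrite !(dotRC a) dotRDl. Qed.

Lemma dotRZl (c : R) v w : dotR (c *: v) w = c * dotR v w.
Proof. by rewrite !dotRE -scalemxAl mxE. Qed.

Lemma dotRZr (c : R) v w : dotR v (c *: w) = c * dotR v w.
Proof. by rewrite !(dotRC v) dotRZl. Qed.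

Lemma dotRNl v w : dotR (- v) w = - dotR v w.
Proof. by rewrite -scaleN1r dotRZl mulN1r. Qed.

Lemma dotRNr v w : dotR v (- w) = - dotR v w.
Proof. by rewrite -scaleN1r dotRZr mulN1r. Qed.

Lemma dotRBl v w a : dotR (v - w) a = dotR v a - dotR w a.
Proof. by rewrite dotRDl dotRNl. Qed.

Lemma dotRBr v w a : dotR a (v - w) = dotR a v - dotR a w.
Proof. by rewrite dotRDr dotRNr. Qed.

Lemma dotR0l v : dotR 0 v = 0.
Proof. by rewrite /dotR big1 // => i _; rewrite mxE mul0r. Qed.

Lemma dotR0r v : dotR v 0 = 0.
Proof. by rewrite dotRC dotR0l. Qed.

Definition dotE := (dotRDl, dotRDr, dotRNl, dotRNr, dotRZl, dotRZr, dotR0l, dotR0r).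

Lemma dotR_mulmx v w X : dotR (v *m X) w = dotR v (w *m X^T).
Proof. by rewrite !dotRE trmx_mul trmxK mulmxA. Qed.

Lemma dotR_ge0 v : 0 <= dotR v v.
Proof. by apply: sumr_ge0 => i _; rewrite -expr2 sqr_ge0. Qed.

Lemma dotR_eq0 v : dotR v v = 0 -> v = 0.
Proof.
move=> /eqP; rewrite psumr_eq0 => [/allP h|i _]; last by rewrite -expr2 sqr_ge0.
apply/rowP => i; rewrite mxE; apply/eqP.
by have := h i (mem_index_enum i); rewrite -expr2 sqrf_eq0.
Qed.

Lemma dotR_gt0 v : v != 0 -> 0 < dotR v v.
Proof.
move=> v0; rewrite lt_neqAle dotR_ge0 andbT eq_sym; apply: contra v0 => /eqP h.
by apply/eqP; exact: dotR_eq0.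
Qed.

Lemma enorm_ge0 v : 0 <= enorm v.
Proof. exact: sqrtr_ge0. Qed.

Lemma enorm_sqr v : enorm v ^+ 2 = dotR v v.
Proof. by rewrite sqr_sqrtr // dotR_ge0. Qed.

Lemma enorm_gt0 v : v != 0 -> 0 < enorm v.
Proof. by move=> v0; rewrite sqrtr_gt0 dotR_gt0. Qed.

Lemma enormZ (c : R) v : enorm (c *: v) = `|c| * enorm v.
Proof.
by rewrite /enorm dotRZl dotRZr mulrA -expr2 sqrtrM ?sqr_ge0 // sqrtr_sqr.
Qed.

Lemma dotR_evec v i : dotR v (evec R i) = v ord0 i.
Proof.
rewrite /dotR (bigD1 i) //= mxE eqxx mulr1 big1 ?addr0 // => j ji.
by rewrite mxE eq_sym (negbTE ji) mulr0.
Qed.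

Lemma cauchy_schwarz v w : dotR v w <= enorm v * enorm w.
Proof.
have [->|v0] := eqVneq v 0; first by rewrite dotR0l mulr_ge0 ?enorm_ge0.
have [->|w0] := eqVneq w 0; first by rewrite dotR0r mulr_ge0 ?enorm_ge0.
have a0 := enorm_gt0 _ v0; have b0 := enorm_gt0 _ w0.
have := dotR_ge0 (enorm w *: v - enorm v *: w).
rewrite !dotE -!enorm_sqr (dotRC w v) => h.
rewrite -subr_ge0 -(pmulr_rge0 _ a0) -(pmulr_rge0 _ b0).
nra.
Qed.

Lemma cauchy_schwarz_abs v w : `|dotR v w| <= enorm v * enorm w.
Proof.
rewrite ler_norml cauchy_schwarz andbT lerNl -dotRNl.
apply: le_trans (cauchy_schwarz _ _) _.
by rewrite -scaleN1r enormZ normrN1 mul1r.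
Qed.

Lemma enorm_triangle v w : enorm (v + w) <= enorm v + enorm w.
Proof.
rewrite -(@ler_pXn2r _ 2) ?nnegrE ?addr_ge0 ?enorm_ge0 // enorm_sqr !dotE.
have := cauchy_schwarz v w; rewrite sqrrD !enorm_sqr (dotRC w v); nra.
Qed.

Lemma norm_le_enorm v : `|v| <= enorm v.
Proof.
apply/ler_addgt0Pr => e e0; apply/ltW; apply: row_norm_lt.
  have := enorm_ge0 v; lra.
move=> i; apply: (@le_lt_trans _ _ (enorm v)); last by rewrite ltrDl.
rewrite -(@ler_pXn2r _ 2) ?nnegrE ?enorm_ge0 // enorm_sqr -normrX.
rewrite ger0_norm ?sqr_ge0 // /dotR (bigD1 i) //= -expr2 lerDl.
by apply: sumr_ge0 => j _; rewrite -expr2 sqr_ge0.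
Qed.

Lemma enorm_sqr_le_norm v : dotR v v <= N%:R * `|v| ^+ 2.
Proof.
have -> : N%:R * `|v| ^+ 2 = \sum_(i < N) `|v| ^+ 2.
  by rewrite sumr_const card_ord mulr_natl.
apply: ler_sum => i _; rewrite -expr2 -[_ ^+ 2]ger0_norm ?sqr_ge0 // normrX.
by rewrite ler_pXn2r ?nnegrE // coord_le_norm.
Qed.

(** Cauchy-Schwarz on the cross terms reduces the claim to
    [(|a|^(n+1) - |b|^(n+1)) (|a| - |b|) >= 0]. *)
Lemma enorm_monotone (n : nat) a b :
  0 <= dotR (enorm a ^+ n *: a - enorm b ^+ n *: b) (a - b).
Proof.
have cs := cauchy_schwarz a b.
have a0 := enorm_ge0 a; have b0 := enorm_ge0 b.
have an : 0 <= enorm a ^+ n by rewrite exprn_ge0.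
have bn : 0 <= enorm b ^+ n by rewrite exprn_ge0.
rewrite !dotE (dotRC b a) -!enorm_sqr.
have h : 0 <= (enorm a ^+ n.+1 - enorm b ^+ n.+1) * (enorm a - enorm b).
  have [ab|ba] := leP (enorm a) (enorm b).
    by rewrite mulr_le0 // subr_le0 // lerXn2r ?nnegrE.
  by rewrite mulr_ge0 // subr_ge0 ?lerXn2r ?nnegrE // ltW.
move: h; rewrite !exprS.
set s := enorm a ^+ n in an *; set t := enorm b ^+ n in bn *.
nra.
Qed.

Definition qf X v := dotR (v *m X) v.

Lemma qfD X v w : X^T = X ->
  qf X (v + w) = qf X v + 2 * dotR (v *m X) w + qf X w.
Proof.
move=> sX; rewrite /qf mulmxDl !dotE [dotR (w *m X) v]dotR_mulmx sX.
by rewrite (dotRC w); ring.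
Qed.

Lemma qfZ X (c : R) v : qf X (c *: v) = c ^+ 2 * qf X v.
Proof. by rewrite /qf -scalemxAl !dotE; ring. Qed.

Lemma qf_addM X Y v : qf (X + Y) v = qf X v + qf Y v.
Proof. by rewrite /qf mulmxDr dotRDl. Qed.

Lemma qf_scaleM X (c : R) v : qf (c *: X) v = c * qf X v.
Proof. by rewrite /qf -scalemxAr dotRZl. Qed.

Lemma qf_oppM X v : qf (- X) v = - qf X v.
Proof. by rewrite /qf mulmxN dotRNl. Qed.

Lemma qf_scalar (c : R) v : qf c%:M v = c * dotR v v.
Proof. by rewrite /qf mul_mx_scalar dotRZl. Qed.

End Euclid.

(** * Extension of the weak formulation to [C^1] test functions *)

Section WeakSolution.
Variables (R : realType) (N : nat).
Notation V := 'rV[R]_N.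
Variables (O : set V) (g : R -> R) (u : V -> R).
Hypothesis openO : open O.
Hypothesis weak_u : weak_solution O g u.
Hypothesis du : forall x, O x -> differentiable u x.
Hypothesis cdu : forall x i, O x -> {for x, continuous (partial i u)}.
Hypothesis cg : continuous g.

Lemma cont_u x : O x -> {for x, continuous u}.
Proof. by move=> Ox; exact: differentiable_continuous (du x Ox). Qed.

Definition flux (i : 'I_N) (x : V) : R :=
  enorm (grad u x) ^+ (N - 2) * partial i u x.

Lemma cont_enorm (F : V -> V) (x : V) :
  (forall i, {for x, continuous (fun y => F y ord0 i)}) ->
  {for x, continuous (fun y => enorm (F y))}.
Proof.
move=> cF; apply: (cont_comp R N Num.sqrt); last exact: sqrt_continuous.
by apply: cont_sum => i; apply: cont_mul.
Qed.

Lemma cont_flux i x : O x -> {for x, continuous (flux i)}.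
Proof.
move=> Ox; apply: cont_mul; last exact: cdu.
apply: cont_exp; apply: cont_enorm => j.
rewrite (_ : (fun y => _) = partial j u); first exact: cdu.
by apply/funext => y; rewrite mxE.
Qed.

(** The integrand of the weak formulation, written through the components of the flux
    [|Du|^(N-2) Du]. *)
Definition dens (zeta : V -> R) (x : V) : R :=
  \sum_i flux i x * partial i zeta x + g (u x) * zeta x.

Lemma densE zeta x : enorm (grad u x) ^+ (N - 2) * dotR (grad u x) (grad zeta x)
  + g (u x) * zeta x = dens zeta x.
Proof.
congr (_ + _); rewrite /dotR mulr_sumr; apply: eq_bigr => i _.
by rewrite !mxE mulrA.
Qed.

Lemma cont_dens zeta x : O x -> {for x, continuous zeta} ->
  (forall i, {for x, continuous (partial i zeta)}) ->
  {for x, continuous (dens zeta)}.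
Proof.
move=> Ox cz cdz; have h1 : {for x, continuous (fun y => \sum_i flux i y * partial i zeta y)}.
  by apply: cont_sum => i; apply: cont_mul => //; exact: cont_flux.
have h2 : {for x, continuous (fun y => g (u y) * zeta y)}.
  apply: cont_mul => //; apply: (cont_comp R N g); last exact: cg.
  exact: cont_u.
exact: (continuousD h1 h2).
Qed.

Lemma closed_ball_compact (x0 : V) (r : R) : compact [set x : V | `|x - x0| <= r].
Proof.
apply: bounded_closed_compact.
  exists (r + `|x0|); split; first by rewrite num_real.
  by move=> M KM x /= xK; have := ler_normD (x - x0) x0; rewrite subrK; lra.
have clA : closed [set y : R | y <= r] by exact: closed_le.
apply: (@closed_comp _ _ (fun x : V => `|x - x0|)) clA => x _.
have h1 : {for x, continuous (@idfun V)} by exact: cvg_id.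
have h2 : {for x, continuous (fun _ : V => x0)} by exact: cst_continuous.
exact: (continuous_comp (continuousB h1 h2) (@norm_continuous _ _ _)).
Qed.

Lemma ball_bound (x0 : V) (r : R) (f : V -> R) : 0 <= r ->
  (forall x, `|x - x0| <= r -> {for x, continuous f}) ->
  exists2 B : R, 0 <= B & forall x, `|x - x0| <= r -> `|f x| <= B.
Proof.
move=> r0 cf; pose A := [set x : V | `|x - x0| <= r].
have A0 : A !=set0 by exists x0; rewrite /A /= subrr normr0.
have cA : compact A.
  exact: closed_ball_compact.
have cfA : {within A, continuous (fun x => `|f x|)}.
  apply: continuous_in_subspaceT => x /set_mem xA.
  by apply: (cont_comp R N Num.norm); [exact: cf|exact: norm_continuous].
have [c _ hc] := EVT_max_rV A0 cA cfA.
by exists `|f c| => // x xr; apply: hc; rewrite inE.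
Qed.

Lemma partial_far (x0 : V) (r : R) (f : V -> R) i :
  (forall y, r < `|y - x0| -> f y = 0) ->
  forall x, r < `|x - x0| -> partial i f x = 0.
Proof.
move=> f0 x xr; apply: partialE.
have d0 : is_derive x (evec R i) (cst (0 : R)) 0 by exact: is_derive_cst.
apply: near_eq_is_derive d0; near=> y; rewrite f0 //; near: y.
exact: near_norm_gt.
Unshelve. all: by end_near. Qed.

(** The integrand is linear in the test function and its gradient, with coefficients bounded on a
    compact ball inside [O]. A [C^1]-close smooth function therefore changes the integral
    arbitrarily little. *)
Lemma weak_C1c (x0 : V) (r d K : R) (psi : V -> R) : 0 <= r -> r < d ->
  (forall x, `|x - x0| < d -> O x) -> 0 < K -> C1c R N K psi ->
  (forall x, r < `|x - x0| -> psi x = 0) ->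
  integral_RN (cut R N x0 d (dens psi)) = 0.
Proof.
move=> r0 rd ballO K0 C1psi psi0.
pose r1 := (r + d) / 2.
have [rr1 r1d] : r < r1 /\ r1 < d by rewrite /r1; split; lra.
have [ccpsi _ ccdpsi] := C1psi.
pose L := `|x0| + d.
have L0 : 0 <= L by rewrite /L; have := normr_ge0 x0; lra.
pose S x := \sum_i `|flux i x| + `|g (u x)|.
have [B B0 hB] : exists2 B : R, 0 <= B & forall x, `|x - x0| <= r1 -> `|S x| <= B.
  apply: ball_bound; first lra.
  move=> x xr; have Ox : O x by apply: ballO; lra.
  have h1 : {for x, continuous (fun y => \sum_i `|flux i y|)}.
    apply: cont_sum => i; apply: (cont_comp R N Num.norm).
      exact: cont_flux.
    exact: norm_continuous.
  have h2 : {for x, continuous (fun y => `|g (u y)|)}.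
    apply: (cont_comp R N (fun s => `|g s|)); first exact: cont_u.
    exact: (continuous_comp (cg (u x)) (@norm_continuous _ _ _)).
  exact: (continuousD h1 h2).
apply/normr0_eq0/le_anti; rewrite normr_ge0 andbT.
apply/ler_addgt0Pr => e e0; rewrite add0r.
pose C : R := (2 * L) ^+ N.
have C0 : 0 <= C by rewrite exprn_ge0 //; lra.
have CB0 : 0 <= C * B by rewrite mulr_ge0.
(* The first bound keeps the support of the approximant within radius [r1], the second makes the
   error of the integral at most [e]. *)
pose s := Num.min ((r1 - r) / 2) (e / (C * B + 1)).
have [s0 s1 s2] : [/\ 0 < s, s <= (r1 - r) / 2 & s <= e / (C * B + 1)].
  rewrite /s lt_min !ge_min !lexx orbT; split => //.
  by apply/andP; split; [lra|apply: divr_gt0; lra].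
have [zeta [sz z1 z2 z3]] := smooth_approx R N K psi K0 C1psi s s0.
have zfar x : r1 < `|x - x0| -> zeta x = 0.
  move=> xr; apply/eqP; apply: contraT => /z3[y /negP py yx]; exfalso; apply: py.
  apply/eqP/psi0.
  have := ler_distD y x x0; rewrite (distrC x y); lra.
have pfar x : r1 < `|x - x0| -> psi x = 0 by move=> xr; apply: psi0; lra.
have far0 f x : (forall y, r1 < `|y - x0| -> f y = 0) -> r1 < `|x - x0| ->
    dens f x = 0.
  move=> f0 xr; rewrite /dens f0 // mulr0 addr0 big1 // => i _.
  by rewrite (partial_far _ _ _ _ f0) // mulr0.
have cz x : {for x, continuous zeta}.
  by have [df _] := sz 1%N; exact: differentiable_continuous (df x).
have cdz x i : {for x, continuous (partial i zeta)}.
  by have [_ /(_ i) h] := sz 1%N; exact: h.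
have iz : integral_RN (cut R N x0 d (dens zeta)) = 0.
  rewrite -[RHS](weak_u zeta sz).
    congr integral_RN; apply/funext => x; rewrite /cut densE.
    case: ifPn => xd; first by rewrite ifT // inE; exact: ballO.
    rewrite far0 //; first by case: ifP.
    by rewrite -leNgt in xd; lra.
  exists [set x | `|x - x0| <= r1]; split.
  - exact: closed_ball_compact.
  - by move=> x /= xr; apply: ballO; lra.
  - by move=> x /= /negP; rewrite -ltNge => /zfar.
have ccz : cc R N L (cut R N x0 d (dens zeta)).
  apply: (cut_cc R N x0 r1) => //; first by move=> x xr _; exact: far0.
  by move=> x xd; apply: cont_dens => //; exact: ballO.
have ccp : cc R N L (cut R N x0 d (dens psi)).
  apply: (cut_cc R N x0 r1) => //; first by move=> x xr _; exact: far0.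
  move=> x xd; apply: cont_dens; first exact: ballO.
    exact: ccpsi.1.
  by move=> i; exact: (ccdpsi i).1.
rewrite -[integral_RN _]subr0 -iz -(integral_RNB R N L) //.
apply: le_trans (integral_RN_bound R N L (B * s) _ L0 _ _) _.
- split=> [x|x xL]; last by rewrite ccp.2 // ccz.2 // subrr.
  exact: (continuousB (ccp.1 x) (ccz.1 x)).
- move=> x; rewrite /cut; case: ifP => xd; last first.
    by rewrite subrr normr0 mulr_ge0 // ltW.
  have [xr|xr] := ltP r1 `|x - x0|.
    by rewrite !far0 // subrr normr0 mulr_ge0 // ltW.
  have -> : dens psi x - dens zeta x =
     \sum_i flux i x * (partial i psi x - partial i zeta x) +
     g (u x) * (psi x - zeta x).
    rewrite /dens [in RHS](eq_bigr (fun i => flux i x * partial i psi x -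
      flux i x * partial i zeta x)); last by move=> i _; rewrite mulrBr.
    by rewrite sumrB; ring.
  apply: le_trans (_ : S x * s <= _); last first.
    rewrite ler_wpM2r ?(ltW s0) //; apply: le_trans (hB x xr).
    exact: ler_norm.
  apply: le_trans (ler_normD _ _) _; rewrite /S mulrDl lerD //.
    apply: le_trans (ler_norm_sum _ _ _) _; rewrite mulr_suml.
    by apply: ler_sum => i _; rewrite normrM ler_wpM2l // distrC.
  by rewrite normrM ler_wpM2l // distrC.
rewrite -/C mulrA.
apply: le_trans (ler_wpM2l CB0 s2) _.
by rewrite mulrA ler_pdivrMr; [nra|lra].
Qed.

End WeakSolution.

(** * Quadratic functions touching the solution *)

Section Touch.
Variables (R : realType) (N : nat).
Notation V := 'rV[R]_N.
Variables (O : set V) (g : R -> R) (u : V -> R).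
Hypothesis openO : open O.
Hypothesis weak_u : weak_solution O g u.
Hypothesis du : forall x, O x -> differentiable u x.
Hypothesis cdu : forall x i, O x -> {for x, continuous (partial i u)}.
Hypothesis cg : continuous g.

(** The square makes the truncation [C^1], hence admissible in [weak_C1c]. *)
Definition pos2 (t : R) : R := Num.max t 0 ^+ 2.

Lemma pos2_derive (t : R) : is_derive t (1 : R) pos2 (2 * Num.max t 0).
Proof.
apply: is_derive_eps.2 => e e0; exists e => // h he.
rewrite -[h *: 1]/(h * 1) mulr1.
apply: (@le_trans _ _ (h ^+ 2)).
  rewrite /pos2 ler_norml; case: (leP t 0) => t0; case: (leP (t + h) 0) => th;
  apply/andP; split; nra.
rewrite -[h ^+ 2]ger0_norm ?sqr_ge0 // normrX expr2 ler_wpM2r //.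
exact: ltW.
Qed.

Lemma cont_max0 : continuous (fun t : R => Num.max t 0).
Proof.
move=> t; apply/cvgrPdist_le => e e0; apply/nbhs_ballP; exists e => //= s.
rewrite /ball /= => ts; apply: le_trans (ltW ts).
by rewrite ler_norml; have := ler_norm (t - s); have := ler_norm (- (t - s));
  rewrite normrN; case: (leP t 0) => t0; case: (leP s 0) => s0;
  have := normr_ge0 (t - s); move=> ? ? ?; apply/andP; split; lra.
Qed.

Variables (x0 p : V) (X : 'M[R]_N).
Hypothesis symX : X^T = X.

Definition affP (x : V) : V := p + (x - x0) *m X.
Definition quadw (x : V) : R := u x0 + dotR p (x - x0) + 2^-1 * qf R N X (x - x0).

Lemma quadw_derive (x v : V) :
  is_derive x v quadw (\sum_i v ord0 i * affP x ord0 i).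
Proof.
apply: is_derive_eps.2 => e e0.
pose Q := `|qf R N X v|.
have Q0 : 0 <= Q by exact: normr_ge0.
exists (e / (Q + 1)) => [|h]; first by apply: divr_gt0; lra.
rewrite ltr_pdivlMr; last lra.
move=> hQ.
have -> : \sum_i v ord0 i * affP x ord0 i = dotR v (affP x) by [].
have -> : quadw (x + h *: v) - quadw x - dotR v (affP x) * h =
   2^-1 * h ^+ 2 * qf R N X v.
  rewrite /quadw /affP.
  have -> : x + h *: v - x0 = (x - x0) + h *: v by rewrite addrAC.
  rewrite (qfD R N X) // qfZ !dotE (dotRC R N v p) (dotRC R N v).
  by field.
rewrite !normrM -/Q.
rewrite (ger0_norm (_ : 0 <= 2^-1)); last lra.
have := normr_ge0 h; nra.
Qed.

Lemma affP_derive (x v : V) j :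
  is_derive x v (fun y => affP y ord0 j) ((v *m X) ord0 j).
Proof.
apply: is_derive_eps.2 => e e0; exists 1 => // h _.
have -> : affP (x + h *: v) ord0 j - affP x ord0 j - (v *m X) ord0 j * h = 0.
  rewrite /affP.
  have -> : x + h *: v - x0 = (x - x0) + h *: v by rewrite addrAC.
  by rewrite mulmxDl -scalemxAl !mxE; ring.
by rewrite normr0 mulr_ge0 // ltW.
Qed.

Lemma cont_affP x j : {for x, continuous (fun y => affP y ord0 j)}.
Proof.
have h l : {for x, continuous (fun y : V => y ord0 l)}.
  exact: differentiable_continuous (differentiable_coord _ _ _).
rewrite (_ : (fun y => _) = (fun y : V => p ord0 j + \sum_l (y ord0 l - x0 ord0 l) * X l j)).
  apply: continuousD; first exact: cst_continuous.
  apply: cont_sum => l; apply: cont_mul; last exact: cst_continuous.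
  by apply: continuousB; [exact: h|exact: cst_continuous].
apply/funext => y; rewrite /affP !mxE; congr (_ + _).
by apply: eq_bigr => l _; rewrite !mxE.
Qed.

Lemma cont_quadw x : {for x, continuous quadw}.
Proof.
have h l : {for x, continuous (fun y : V => y ord0 l - x0 ord0 l)}.
  apply: continuousB; last exact: cst_continuous.
  exact: differentiable_continuous (differentiable_coord _ _ _).
have h1 : {for x, continuous (fun y : V => \sum_l p ord0 l * (y ord0 l - x0 ord0 l))}.
  by apply: cont_sum => l; apply: cont_mul; [exact: cst_continuous|exact: h].
have h2 : {for x, continuous (fun y : V =>
    2^-1 * \sum_l (affP y ord0 l - p ord0 l) * (y ord0 l - x0 ord0 l))}.
  apply: cont_mul; first exact: cst_continuous.
  apply: cont_sum => l; apply: cont_mul; last exact: h.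
  by apply: continuousB; [exact: cont_affP|exact: cst_continuous].
have h0 : {for x, continuous (fun _ : V => u x0)} by exact: cst_continuous.
have E : quadw = (fun y => u x0 + (\sum_l p ord0 l * (y ord0 l - x0 ord0 l)) +
    2^-1 * \sum_l (affP y ord0 l - p ord0 l) * (y ord0 l - x0 ord0 l)).
  apply/funext => y; rewrite /quadw /affP /qf /dotR; congr (_ + _ + _ * _).
    by apply: eq_bigr => l _; rewrite !mxE.
  apply: eq_bigr => l _; rewrite [(p + _) ord0 l]mxE [((y - x0) : V) ord0 l]mxE.
  by rewrite [(- x0) ord0 l]mxE; congr (_ * _); ring.
rewrite E; exact: (continuousD (continuousD h0 h1) h2).
Qed.

(** Flux of the quadratic function [quadw], whose gradient is [affP]; the sum of the [fieldDW i] is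
    its divergence, the N-Laplacian of [quadw]. *)
Definition fieldW (i : 'I_N) (x : V) : R := enorm (affP x) ^+ (N - 2) * affP x ord0 i.
Definition fieldDW (i : 'I_N) (x : V) : R :=
  enorm (affP x) ^+ (N - 2) * X i i +
  affP x ord0 i * ((N - 2)%:R * enorm (affP x) ^+ (N - 2).-1 *
     ((enorm (affP x))^-1 * dotR (affP x) (evec R i *m X))).

Lemma enorm_affP_derive (x v : V) : affP x != 0 ->
  is_derive x v (fun y => enorm (affP y)) ((enorm (affP x))^-1 * dotR (affP x) (v *m X)).
Proof.
move=> Px.
have d1 : is_derive x v (fun y => dotR (affP y) (affP y))
    (\sum_i (1 : R) * (affP x ord0 i * (v *m X) ord0 i + affP x ord0 i * (v *m X) ord0 i)).
  rewrite (_ : (fun y => _) = (fun y => \sum_i (1 : R) * (affP y ord0 i * affP y ord0 i))).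
    apply: (derive_sum_seq R N _ _ (fun=> 1) _ (fun i y =>
      affP y ord0 i * (v *m X) ord0 i + affP y ord0 i * (v *m X) ord0 i)) => i.
    by apply: is_deriveM; exact: affP_derive.
  by apply/funext => y; apply: eq_bigr => i _; rewrite mul1r.
have d2 := is_derive1_sqrt (dotR_gt0 R N _ Px).
have := is_derive_chain R N _ _ x v _ _ d2 d1.
rewrite (_ : _ * _ = (enorm (affP x))^-1 * dotR (affP x) (v *m X)) //.
rewrite -/(enorm (affP x)) /dotR.
have -> : \sum_i (1 : R) * (affP x ord0 i * (v *m X) ord0 i + affP x ord0 i * (v *m X) ord0 i)
   = 2 * \sum_i affP x ord0 i * (v *m X) ord0 i.
  by rewrite mulr_sumr; apply: eq_bigr => i _; ring.
have e0 : enorm (affP x) != 0 by rewrite gt_eqF // enorm_gt0.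
by field.
Qed.

Lemma evec_mul i : (evec R i *m X) ord0 i = X i i.
Proof.
rewrite mxE (bigD1 i) //= mxE eqxx mul1r big1 ?addr0 // => j ji.
by rewrite mxE eq_sym (negbTE ji) mul0r.
Qed.

Lemma fieldW_derive (x : V) i : affP x != 0 ->
  is_derive x (evec R i) (fieldW i) (fieldDW i x).
Proof.
move=> Px.
have d1 := enorm_affP_derive x (evec R i) Px.
have d2 : is_derive x (evec R i) (fun y => enorm (affP y) ^+ (N - 2))
   ((N - 2)%:R * enorm (affP x) ^+ (N - 2).-1 *
     ((enorm (affP x))^-1 * dotR (affP x) (evec R i *m X))).
  apply: (is_derive_chain R N (fun s => s ^+ (N - 2)) _ _ _ _ _ _ d1).
  have := is_deriveX (N - 2) (is_derive_id (enorm (affP x)) (1 : R)).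
  by rewrite exprfctE -[_ *: _]/(_ * _) mulr1.
have d3 := affP_derive x (evec R i) i.
have := is_deriveM d2 d3.
by rewrite evec_mul.
Qed.

Lemma cont_enorm_affP x : {for x, continuous (fun y => enorm (affP y))}.
Proof. by apply: cont_enorm => j; exact: cont_affP. Qed.

Lemma cont_fieldW x i : {for x, continuous (fieldW i)}.
Proof.
apply: cont_mul; last exact: cont_affP.
by apply: cont_exp; exact: cont_enorm_affP.
Qed.

Lemma cont_fieldDW x i : affP x != 0 -> {for x, continuous (fieldDW i)}.
Proof.
move=> Px; apply: continuousD.
  apply: cont_mul; last exact: cst_continuous.
  by apply: cont_exp; exact: cont_enorm_affP.
apply: cont_mul; first exact: cont_affP.
apply: cont_mul.
  apply: cont_mul; first exact: cst_continuous.
  by apply: cont_exp; exact: cont_enorm_affP.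
apply: cont_mul.
  apply: (cont_comp R N (fun s => s^-1)); first exact: cont_enorm_affP.
  apply: inv_continuous; exact: lt0r_neq0 (enorm_gt0 R N _ Px).
apply: cont_sum => j; apply: cont_mul; first exact: cont_affP.
exact: cst_continuous.
Qed.

Lemma div_fieldW : p != 0 -> dotR p p * \sum_i fieldDW i x0 =
  enorm p ^+ (N - 2) * (dotR p p * \tr X + (N - 2)%:R * qf R N X p).
Proof.
move=> p0; have e0 : enorm p != 0 by rewrite gt_eqF // enorm_gt0.
have aff0 : affP x0 = p by rewrite /affP subrr mul0mx addr0.
rewrite /fieldDW aff0 big_split /= -mulr_sumr -/(\tr X).
have -> : \sum_i p ord0 i * ((N - 2)%:R * enorm p ^+ (N - 2).-1 *
     ((enorm p)^-1 * dotR p (evec R i *m X))) =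
   (N - 2)%:R * enorm p ^+ (N - 2).-1 * (enorm p)^-1 * qf R N X p.
  transitivity (\sum_i ((N - 2)%:R * enorm p ^+ (N - 2).-1 * (enorm p)^-1) *
     (p ord0 i * (p *m X) ord0 i)).
    apply: eq_bigr => i _.
    have -> : dotR p (evec R i *m X) = (p *m X) ord0 i.
      by rewrite dotRC dotR_mulmx symX dotRC dotR_evec.
    by ring.
  rewrite -mulr_sumr; congr (_ * _).
  by rewrite /qf /dotR; apply: eq_bigr => i _; rewrite mulrC.
rewrite -enorm_sqr; case: (N - 2)%N => [|n].
  by rewrite !mul0r addr0 expr0; ring.
by rewrite /= !exprS; field.
Qed.

(** Otherwise [G], the excess of [g (u x)] over the N-Laplacian of [quadw], is positive near [x0].
    Subtracting the divergence identity for [quadw] from the weak formulation for [u], both tested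
    with [psi], leaves a monotone term plus [G * psi]: nonnegative, positive at [x0], yet of
    integral zero. *)
Lemma touch_strict (e d : R) : O x0 -> p != 0 -> 0 < e -> 0 < d ->
  (forall h, `|h| < d -> u (x0 + h) <= u x0 + dotR p h + 2^-1 * qf R N X h -
     e * dotR h h) ->
  dotR p p * g (u x0) <=
  enorm p ^+ (N - 2) * (dotR p p * \tr X + (N - 2)%:R * qf R N X p).
Proof.
move=> Ox0 p0 e0 d0 hu; rewrite leNgt; apply/negP => strict.
have aff0 : affP x0 = p by rewrite /affP subrr mul0mx addr0.
pose G x := g (u x) - \sum_i fieldDW i x.
have G0 : 0 < G x0.
  rewrite /G subr_gt0 -(ltr_pM2l (dotR_gt0 R N _ p0)).
  by rewrite div_fieldW.
have Pn0 : enorm (affP x0) != 0 by rewrite aff0 gt_eqF // enorm_gt0.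
have affn x : enorm (affP x) != 0 -> affP x != 0.
  by apply: contra => /eqP ->; rewrite /enorm dotR0l sqrtr0.
have cgu x : O x -> {for x, continuous (fun y => g (u y))}.
  by move=> Ox; apply: (cont_comp R N g); [exact: (cont_u R N O u du)|exact: cg].
have cG : {for x0, continuous G}.
  apply: continuousB; first exact: cgu.
  by apply: cont_sum => i; apply: cont_fieldDW; exact: affn.
have : \forall x \near x0, [/\ O x, 0 < enorm (affP x) & 0 < G x].
  have n1 : \forall x \near x0, O x by exact: open_nbhs_nbhs.
  have n2 : \forall x \near x0, 0 < enorm (affP x).
    apply: (cvgr_gt _ (cont_enorm_affP x0)).
    by rewrite lt_neqAle enorm_ge0 eq_sym Pn0.
  have n3 : \forall x \near x0, 0 < G x by apply: (cvgr_gt _ cG).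
  by near=> x; split; near: x.
move=> /nbhs_ballP[d' /= d'0 hd'].
pose d1 := Num.min d d'.
have [d10 d1d d1d'] : [/\ 0 < d1, d1 <= d & d1 <= d'].
  by rewrite /d1 lt_min d0 d'0 !ge_min !lexx orbT.
have ball x : `|x - x0| < d1 -> [/\ O x, affP x != 0 & 0 < G x].
  move=> xd; have [|h1 h2 h3] := hd' x; first by rewrite -ball_normE /= distrC; lra.
  by split => //; apply: affn; rewrite gt_eqF.
pose r := d1 / 2.
have [r0 rd] : 0 < r /\ r < d1 by rewrite /r; split; lra.
(* The strict margin [e * dotR h h] exceeds [eta] beyond radius [r], so the raised difference [q] is
   positive at [x0] but not on the annulus: its positive part has compact support. *)
pose eta := e * r ^+ 2.
have eta0 : 0 < eta by rewrite /eta mulr_gt0 // exprn_gt0.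
pose q x := u x - quadw x + eta.
have qneg x : r < `|x - x0| -> `|x - x0| < d1 -> q x <= 0.
  move=> xr xd; have := hu (x - x0) ltac:(lra).
  rewrite addrC subrK => h.
  have h2 : r ^+ 2 <= dotR (x - x0) (x - x0).
    rewrite -enorm_sqr lerXn2r ?nnegrE ?enorm_ge0 ?(ltW r0) //.
    apply: le_trans (norm_le_enorm R N _); exact: ltW.
  have h3 : e * r ^+ 2 <= e * dotR (x - x0) (x - x0) by rewrite ler_pM2l.
  rewrite /q /quadw /eta; lra.
pose mx x := Num.max (q x) 0.
have mx0 x : r < `|x - x0| -> `|x - x0| < d1 -> mx x = 0.
  by move=> xr xd; rewrite /mx; apply/max_idPr; exact: qneg.
have dq x v : `|x - x0| < d1 -> is_derive x v q
    (\sum_i v ord0 i * (partial i u x - affP x ord0 i)).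
  move=> xd; have [Ox _ _] := ball x xd.
  have h1 := differentiable_derive R N u x v (du _ Ox).
  have h2 := quadw_derive x v.
  have h3 := is_deriveD (is_deriveB h1 h2) (is_derive_cst eta x v).
  apply: is_derive_eq h3 _; rewrite addr0 -sumrB.
  by apply: eq_bigr => i _; rewrite mulrBr.
have dpq x v : `|x - x0| < d1 -> is_derive x v (fun y => pos2 (q y))
    (2 * mx x * \sum_i v ord0 i * (partial i u x - affP x ord0 i)).
  by move=> xd; exact: (is_derive_chain R N _ _ _ _ _ _ (pos2_derive _) (dq x v xd)).
have sumE (F : 'I_N -> V -> R) (x : V) (i : 'I_N) :
    \sum_j evec R i ord0 j * F j x = F i x.
  rewrite (bigD1 i) //= mxE eqxx mul1r big1 ?addr0 // => j ji.
  by rewrite mxE eq_sym (negbTE ji) mul0r.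
have cmx x : `|x - x0| < d1 -> {for x, continuous mx}.
  move=> xd; have [Ox _ _] := ball x xd.
  apply: (cont_comp R N (fun s => Num.max s 0)); last exact: cont_max0.
  have h2 : {for x, continuous (fun _ : V => eta)} by exact: cst_continuous.
  exact: (continuousD (continuousB (cont_u R N O u du x Ox) (cont_quadw x)) h2).
have cpq x : `|x - x0| < d1 -> {for x, continuous (fun y => pos2 (q y))}.
  by move=> xd; apply: cont_exp; exact: cmx.
pose psi := cut R N x0 d1 (fun y => pos2 (q y)).
pose Dpsi i := cut R N x0 d1 (fun x => 2 * mx x * (partial i u x - affP x ord0 i)).
have spq : supp_ball R N x0 r d1 (fun y => pos2 (q y)).
  by move=> x xr xd; rewrite /pos2 -/(mx x) mx0 // expr2 mul0r.
have dpsi x v := cut_derive R N x0 r d1 _ _ v rd spq (fun y yd => dpq y v yd) x.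
have partial_psi i : partial i psi = Dpsi i.
  apply/funext => x; apply: partialE; rewrite /psi /Dpsi.
  apply: is_derive_eq (dpsi x (evec R i)) _.
  rewrite /cut; case: ifP => // _.
  by congr (_ * _); exact: (sumE (fun i x => partial i u x - affP x ord0 i) x i).
have cpu x i : `|x - x0| < d1 ->
    {for x, continuous (fun x => partial i u x - affP x ord0 i)}.
  move=> xd; have [Ox _ _] := ball x xd.
  by apply: continuousB; [exact: cdu|exact: cont_affP].
have cDp x i : `|x - x0| < d1 ->
    {for x, continuous (fun x => 2 * mx x * (partial i u x - affP x ord0 i))}.
  move=> xd; apply: cont_mul; last exact: cpu.
  by apply: cont_mul; [exact: cst_continuous|exact: cmx].
pose L := `|x0| + d1.
have L0 : 0 < L by rewrite /L; have := normr_ge0 x0; lra.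
have C1psi : C1c R N L psi.
  split.
  - exact: (cut_cc R N x0 r).
  - move=> x v; apply: is_derive_eq (dpsi x v) _.
    rewrite (eq_bigr (fun i => v ord0 i * Dpsi i x)); last first.
      by move=> i _; rewrite partial_psi.
    rewrite /Dpsi /cut; case: ifP => _; last first.
      by rewrite big1 // => i _; rewrite mulr0.
    by rewrite mulr_sumr; apply: eq_bigr => i _; ring.
  - move=> i; rewrite partial_psi; apply: (cut_cc R N x0 r) => //.
    + by move=> x xr xd; rewrite mx0 // mulr0 mul0r.
    + by move=> x xd; exact: cDp.
have psi_far x : r < `|x - x0| -> psi x = 0.
  move=> xr; rewrite /psi /cut; case: ifP => // xd.
  by rewrite /pos2 -/(mx x) mx0 // expr2 mul0r.
have I1 : integral_RN (cut R N x0 d1 (dens R N g u psi)) = 0.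
  apply: (weak_C1c R N O g u weak_u du cdu cg x0 r d1 L) => //; first exact: ltW.
  by move=> x /ball[].
(* The derivative in direction [i] of [fieldW i] times the test function; it integrates to zero. *)
pose T i x := fieldW i x * (2 * mx x * (partial i u x - affP x ord0 i)) +
  pos2 (q x) * fieldDW i x.
have cT x i : `|x - x0| < d1 -> {for x, continuous (T i)}.
  move=> xd; have [_ Px _] := ball x xd; apply: continuousD.
    by apply: cont_mul; [exact: cont_fieldW|exact: cDp].
  by apply: cont_mul; [exact: cpq|exact: cont_fieldDW].
have sT i : supp_ball R N x0 r d1 (T i).
  by move=> x xr xd; rewrite /T spq // mx0 // !(mul0r, mulr0) addr0.
have ccT i : cc R N L (cut R N x0 d1 (T i)).
  by apply: (cut_cc R N x0 r) => // x xd; exact: cT.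
have I2 i : integral_RN (cut R N x0 d1 (T i)) = 0.
  pose f := cut R N x0 d1 (fun x => fieldW i x * pos2 (q x)).
  have sf : supp_ball R N x0 r d1 (fun x => fieldW i x * pos2 (q x)).
    by move=> x xr xd; rewrite spq // mulr0.
  have dWq x : `|x - x0| < d1 ->
      is_derive x (evec R i) (fun x => fieldW i x * pos2 (q x)) (T i x).
    move=> xd; have [_ Px _] := ball x xd.
    have h1 := is_deriveM (fieldW_derive x i Px) (dpq x (evec R i) xd).
    apply: is_derive_eq h1 _; rewrite /T; congr (_ * (_ * _) + _).
    exact: (sumE (fun i x => partial i u x - affP x ord0 i) x i).
  apply: (integral_RN_derive0 R N L f _ i) => //.
    apply: (cut_cc R N x0 r) => // x xd.
    by apply: cont_mul; [exact: cont_fieldW|exact: cpq].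
  exact: (cut_derive R N x0 r d1 _ (T i) (evec R i) rd sf dWq).
pose sumT x := \sum_i T i x.
have ccsum (s : seq 'I_N) : cc R N L (cut R N x0 d1 (fun x => \sum_(i <- s) T i x)).
  apply: (cut_cc R N x0 r) => //.
    by move=> x xr xd; rewrite big1 // => i _; exact: sT.
  by move=> x xd; apply: cont_sum => i; exact: cT.
have I3 (s : seq 'I_N) :
    integral_RN (cut R N x0 d1 (fun x => \sum_(i <- s) T i x)) = 0.
  elim: s => [|i s IH].
    have := integral_RNB R N L _ _ (ltW L0) (ccsum [::]) (ccsum [::]).
    rewrite subrr => e1; apply: etrans e1; congr integral_RN; apply/funext => x.
    by rewrite subrr /cut big_nil; case: ifP.
  have := integral_RNB R N L _ _ (ltW L0) (ccsum (i :: s)) (ccsum s).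
  rewrite IH subr0 => <-; rewrite -[RHS](I2 i); congr integral_RN.
  apply/funext => x; rewrite /cut; case: ifP => _; rewrite ?subrr //.
  by rewrite big_cons addrK.
have dpsi_far x i : r < `|x - x0| -> `|x - x0| < d1 -> partial i psi x = 0.
  by move=> xr xd; rewrite partial_psi /Dpsi /cut xd mx0 // mulr0 mul0r.
have ccd : cc R N L (cut R N x0 d1 (dens R N g u psi)).
  have [c1 _ c2] := C1psi.
  apply: (cut_cc R N x0 r) => //.
    move=> x xr xd; rewrite /dens psi_far // mulr0 addr0 big1 // => i _.
    by rewrite dpsi_far // mulr0.
  move=> x xd; have [Ox _ _] := ball x xd.
  apply: (cont_dens R N O g u du cdu cg) => //; first exact: c1.1.
  by move=> i; exact: (c2 i).1.
have I4 : integral_RN (fun x => cut R N x0 d1 (dens R N g u psi) x -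
    cut R N x0 d1 (fun x => \sum_i T i x) x) = 0.
  by rewrite (integral_RNB R N L) ?(ltW L0) // I1 I3 subrr.
have DE x : `|x - x0| < d1 -> dens R N g u psi x - \sum_i T i x =
    2 * mx x * dotR (enorm (grad u x) ^+ (N - 2) *: grad u x -
      enorm (affP x) ^+ (N - 2) *: affP x) (grad u x - affP x) +
    G x * pos2 (q x).
  move=> xd; rewrite /dens /T big_split /=.
  rewrite (eq_bigr (fun i => flux R N u i x *
    (2 * mx x * (partial i u x - affP x ord0 i)))); last first.
    by move=> i _; rewrite partial_psi /Dpsi /cut xd.
  have -> : psi x = pos2 (q x) by rewrite /psi /cut xd.
  have -> : dotR (enorm (grad u x) ^+ (N - 2) *: grad u x -
      enorm (affP x) ^+ (N - 2) *: affP x) (grad u x - affP x) =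
      \sum_i (flux R N u i x - fieldW i x) * (partial i u x - affP x ord0 i).
    by apply: eq_bigr => i _; rewrite /flux /fieldW !mxE.
  have -> : 2 * mx x * (\sum_i (flux R N u i x - fieldW i x) *
      (partial i u x - affP x ord0 i)) =
    \sum_i flux R N u i x * (2 * mx x * (partial i u x - affP x ord0 i)) -
    \sum_i fieldW i x * (2 * mx x * (partial i u x - affP x ord0 i)).
    by rewrite mulr_sumr -sumrB; apply: eq_bigr => i _; ring.
  by rewrite /G mulrBl -mulr_sumr; ring.
have mxge0 x : 0 <= mx x by rewrite /mx le_max lexx orbT.
have D0 x : `|x - x0| < d1 -> G x * pos2 (q x) <=
    dens R N g u psi x - \sum_i T i x.
  move=> xd; rewrite DE // lerDr mulr_ge0 ?mulr_ge0 //.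
  exact: enorm_monotone.
have : 0 < integral_RN (fun x => cut R N x0 d1 (dens R N g u psi) x -
    cut R N x0 d1 (fun x => \sum_i T i x) x).
  have sI := ccsum (index_enum 'I_N).
  apply: (integral_RN_gt0 R N L _ x0 (ltW L0)).
  - split=> [x|x xL]; last by rewrite ccd.2 // sI.2 // subrr.
    exact: (continuousB (ccd.1 x) (sI.1 x)).
  - move=> x; rewrite /cut; case: ifP => xd; last by rewrite subrr.
    apply: le_trans (D0 x xd); have [_ _ h] := ball x xd.
    by rewrite mulr_ge0 ?(ltW h) // /pos2 sqr_ge0.
  - have xd : `|x0 - x0| < d1 by rewrite subrr normr0.
    rewrite /cut xd; apply: lt_le_trans (D0 x0 xd).
    have q0 : q x0 = eta.
      by rewrite /q /quadw subrr dotR0r /qf mul0mx dotR0l mulr0 !addr0 subrr add0r.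
    rewrite mulr_gt0 // /pos2 q0; have -> : Num.max eta 0 = eta.
      by apply/max_idPl; exact: ltW.
    by rewrite exprn_gt0.
by rewrite I4 ltxx.
Unshelve. all: by end_near. Qed.

End Touch.

(** The strict version is applied with a slightly larger Hessian; the resulting error is [s * C] and
    [s] is arbitrary. *)
Lemma touch (R : realType) (N : nat) (O : set 'rV[R]_N) (g : R -> R)
    (u : 'rV[R]_N -> R) (x0 p : 'rV[R]_N) (X : 'M[R]_N) :
  open O -> weak_solution O g u -> (forall x, O x -> differentiable u x) ->
  (forall x i, O x -> {for x, continuous (partial i u)}) -> continuous g ->
  X^T = X -> O x0 -> p != 0 ->
  (forall e : R, 0 < e -> exists2 d : R, 0 < d & forall h, `|h| < d ->
     u (x0 + h) <= u x0 + dotR p h + 2^-1 * qf R N X h + e * dotR h h) ->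
  dotR p p * g (u x0) <=
  enorm p ^+ (N - 2) * (dotR p p * \tr X + (N - 2)%:R * qf R N X p).
Proof.
move=> openO weak_u du cdu cg symX Ox0 p0 hu.
pose C := enorm p ^+ (N - 2) * dotR p p * (N%:R + (N - 2)%:R) * 4.
have C0 : 0 <= C.
  by rewrite !mulr_ge0 ?exprn_ge0 ?enorm_ge0 ?dotR_ge0 // addr_ge0.
apply/ler_addgt0Pr => e e0.
pose s := e / (C + 1).
have s0 : 0 < s by apply: divr_gt0; lra.
have [d d0 hd] := hu s s0.
(* Half of the added form is [2 * s * dotR h h]: one [s] absorbs the permitted error and the other
   is the strict margin. *)
have sX : (X + (4 * s)%:M)^T = X + (4 * s)%:M by rewrite linearD /= tr_scalar_mx symX.
have hd' h : `|h| < d -> u (x0 + h) <= u x0 + dotR p h +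
    2^-1 * qf R N (X + (4 * s)%:M) h - s * dotR h h.
  move=> /hd hh; apply: le_trans hh _; rewrite qf_addM qf_scalar.
  by rewrite le_eqVlt; apply/orP; left; apply/eqP; field.
have := touch_strict R N O g u openO weak_u du cdu cg x0 p _ sX s d Ox0 p0 s0 d0 hd'.
move=> /le_trans; apply.
rewrite mxtraceD mxtrace_scalar qf_addM qf_scalar -[_ *+ N]mulr_natr.
have -> : enorm p ^+ (N - 2) * (dotR p p * (\tr X + 4 * s * N%:R) +
   (N - 2)%:R * (qf R N X p + 4 * s * dotR p p)) =
   enorm p ^+ (N - 2) * (dotR p p * \tr X + (N - 2)%:R * qf R N X p) + s * C.
  by rewrite /C; ring.
rewrite lerD2l /s mulrAC ler_pdivrMr; [nra|lra].
Qed.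

(** * Second-order jets *)

Section Jets.
Variables (R : realType) (N : nat).
Notation V := 'rV[R]_N.
Implicit Types (w : V -> R) (x P h : V) (Y : 'M[R]_N).

(** A Peano expansion at one point with gradient [P] and Hessian [Y]. This is all that touching
    requires, and it is stable under the operations that build the barriers. *)
Definition jet w x P Y := forall e : R, 0 < e -> exists2 d : R, 0 < d &
  forall h, enorm h < d ->
  `|w (x + h) - w x - dotR P h - 2^-1 * qf R N Y h| <= e * dotR h h.

Definition mnorm (m n : nat) (Y : 'M[R]_(m, n)) : R := \sum_i \sum_j `|Y i j|.

Lemma mnorm_ge0 (m n : nat) (Y : 'M[R]_(m, n)) : 0 <= mnorm m n Y.
Proof. by apply: sumr_ge0 => i _; exact: sumr_ge0. Qed.

Lemma coord_le_enorm (v : V) i : `|v ord0 i| <= enorm v.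
Proof. exact: le_trans (coord_le_norm _ _ _ _) (norm_le_enorm _ _ _). Qed.

Lemma bilin_bound Y (v w : V) :
  `|dotR (v *m Y) w| <= mnorm N N Y * enorm v * enorm w.
Proof.
have -> : dotR (v *m Y) w = \sum_j \sum_i v ord0 i * Y i j * w ord0 j.
  by apply: eq_bigr => j _; rewrite mxE mulr_suml.
rewrite exchange_big /= -mulrA /mnorm mulr_suml.
apply: le_trans (ler_norm_sum _ _ _) _; apply: ler_sum => i _.
rewrite mulr_suml; apply: le_trans (ler_norm_sum _ _ _) _; apply: ler_sum => j _.
rewrite !normrM mulrC mulrCA [leRHS]mulrA [leRHS]mulrC.
have -> : enorm w * (`|Y i j| * enorm v) = `|Y i j| * (enorm v * enorm w) by ring.
rewrite [X in X <= _](_ : _ = `|Y i j| * (`|v ord0 i| * `|w ord0 j|)); last by ring.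
by rewrite ler_wpM2l // ler_pM // coord_le_enorm.
Qed.

Lemma qf_bound Y (v : V) : `|qf R N Y v| <= mnorm N N Y * dotR v v.
Proof. by rewrite -enorm_sqr expr2 mulrA; exact: bilin_bound. Qed.

Lemma enorm_le_sum (v : V) : enorm v <= \sum_i `|v ord0 i|.
Proof.
have S0 : 0 <= \sum_i `|v ord0 i| by exact: sumr_ge0.
rewrite -(@ler_pXn2r _ 2) ?nnegrE ?enorm_ge0 // enorm_sqr expr2 mulr_suml.
apply: ler_sum => i _; rewrite -expr2 -[_ ^+ 2]ger0_norm ?sqr_ge0 // normrX expr2.
by rewrite ler_wpM2l // (bigD1 i) //= lerDl sumr_ge0.
Qed.

Lemma jet_exact w x P Y : (forall h, w (x + h) = w x + dotR P h + 2^-1 * qf R N Y h) ->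
  jet w x P Y.
Proof.
move=> wE e e0; exists 1 => // h _; rewrite wE.
have -> : w x + dotR P h + 2^-1 * qf R N Y h - w x - dotR P h - 2^-1 * qf R N Y h = 0.
  by ring.
by rewrite normr0 mulr_ge0 ?(ltW e0) // dotR_ge0.
Qed.

Lemma jet_eq w x P Y P' Y' : jet w x P Y -> P = P' -> Y = Y' -> jet w x P' Y'.
Proof. by move=> j <- <-. Qed.

Lemma jet_ext w w' x P Y : w =1 w' -> jet w x P Y -> jet w' x P Y.
Proof. by move=> /funext ->. Qed.

Lemma jet_cst (c : R) x : jet (fun=> c) x 0 0.
Proof.
by apply: jet_exact => h; rewrite dotR0l /qf mulmx0 dotR0l mulr0 !addr0.
Qed.

Lemma jet_lin (a : V) x : jet (fun y => dotR a y) x a 0.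
Proof.
by apply: jet_exact => h; rewrite dotRDr /qf mulmx0 dotR0l mulr0 addr0.
Qed.

Lemma jet_sqn x : jet (fun y => dotR y y) x (2 *: x) 2%:M.
Proof.
by apply: jet_exact => h; rewrite !dotE qf_scalar (dotRC R N h x); field.
Qed.

Lemma jet_add w1 w2 x P1 P2 Y1 Y2 : jet w1 x P1 Y1 -> jet w2 x P2 Y2 ->
  jet (fun y => w1 y + w2 y) x (P1 + P2) (Y1 + Y2).
Proof.
move=> j1 j2 e e0.
have [d1 d10 h1] := j1 (e / 2) ltac:(lra).
have [d2 d20 h2] := j2 (e / 2) ltac:(lra).
exists (Num.min d1 d2); first by rewrite lt_min d10.
move=> h; rewrite lt_min => /andP[/h1 b1 /h2 b2].
rewrite dotRDl qf_addM.
have -> : w1 (x + h) + w2 (x + h) - (w1 x + w2 x) - (dotR P1 h + dotR P2 h) -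
   2^-1 * (qf R N Y1 h + qf R N Y2 h) =
   (w1 (x + h) - w1 x - dotR P1 h - 2^-1 * qf R N Y1 h) +
   (w2 (x + h) - w2 x - dotR P2 h - 2^-1 * qf R N Y2 h) by ring.
by apply: le_trans (ler_normD _ _) _; lra.
Qed.

Lemma jet_scale (c : R) w x P Y : jet w x P Y ->
  jet (fun y => c * w y) x (c *: P) (c *: Y).
Proof.
move=> j e e0; have c0 := normr_ge0 c.
have [d d0 hd] := j (e / (`|c| + 1)) ltac:(by apply: divr_gt0; lra).
exists d => // h /hd b; rewrite dotRZl qf_scaleM.
have -> : c * w (x + h) - c * w x - c * dotR P h - 2^-1 * (c * qf R N Y h) =
   c * (w (x + h) - w x - dotR P h - 2^-1 * qf R N Y h) by ring.
rewrite normrM; apply: le_trans (ler_wpM2l c0 b) _.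
rewrite mulrA ler_wpM2r ?dotR_ge0 // mulrA ler_pdivrMr; last lra.
nra.
Qed.

Lemma jet_first w x P Y : jet w x P Y -> exists (C d : R), [/\ 0 <= C, 0 < d &
  forall h, enorm h < d -> `|w (x + h) - w x - dotR P h| <= C * dotR h h].
Proof.
move=> j; have [d d0 hd] := j 1 ltr01.
exists (1 + mnorm N N Y), d; split => //.
  by have := mnorm_ge0 N N Y; lra.
move=> h /hd b; have qb := qf_bound Y h.
have -> : w (x + h) - w x - dotR P h = (w (x + h) - w x - dotR P h -
  2^-1 * qf R N Y h) + 2^-1 * qf R N Y h by ring.
apply: le_trans (ler_normD _ _) _.
rewrite normrM (ger0_norm (_ : 0 <= 2^-1)); last lra.
have := dotR_ge0 R N h; have := mnorm_ge0 N N Y; have := normr_ge0 (qf R N Y h).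
nra.
Qed.

Definition jet1 (f : R -> R) (s f1 f2 : R) := forall e : R, 0 < e ->
  exists2 d : R, 0 < d & forall t, `|t| < d ->
  `|f (s + t) - f s - f1 * t - 2^-1 * f2 * t ^+ 2| <= e * t ^+ 2.

Lemma jet_comp (f : R -> R) (f1 f2 : R) w x P Y : jet w x P Y -> jet1 f (w x) f1 f2 ->
  jet (fun y => f (w y)) x (f1 *: P) (f1 *: Y + f2 *: (P^T *m P)).
Proof.
move=> jw jf e e0.
have [C [d1 [C0 d10 h1]]] := jet_first _ _ _ _ jw.
pose A := enorm P + C.
have A0 : 0 <= A by rewrite addr_ge0 ?enorm_ge0.
(* [A] bounds the increment of [w] by [A * |h|]. [B] bounds the cubic error of replacing the squared
   increment by [dotR P h ^+ 2], factored as a difference of squares. *)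
pose B := `|f2| * C * (2 * A).
have B0 : 0 <= B by rewrite /B !mulr_ge0.
have [d2 d20 h2] := jw (e / 3 / (`|f1| + 1)) ltac:(by
  apply: divr_gt0; have := normr_ge0 f1; lra).
have [d3 d30 h3] := jf (e / 3 / (A ^+ 2 + 1)) ltac:(by
  apply: divr_gt0; have := sqr_ge0 A; lra).
pose d := Num.min (Num.min d1 d2) (Num.min (d3 / (A + 1)) (Num.min 1 (e / 3 / (B + 1)))).
have [k1 k2 k3 k4] : [/\ 0 < d3 / (A + 1), 0 < e / 3 / (B + 1), 0 < (1 : R) &
   0 < Num.min d1 d2].
  by split; rewrite ?lt_min ?d10 ?divr_gt0 //; lra.
exists d; first by rewrite /d !lt_min d10 d20 k1 k2 ltr01.
move=> h; rewrite /d !lt_min => /andP[/andP[hd1 hd2] /andP[hd3 /andP[hd4 hd5]]].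
have hh := dotR_ge0 R N h; have h0 := enorm_ge0 R N h.
have hhE := enorm_sqr R N h.
set t := w (x + h) - w x.
have b1 : `|t - dotR P h| <= C * dotR h h by exact: h1.
have bP := cauchy_schwarz_abs R N P h.
have tA : `|t| <= A * enorm h.
  have -> : t = dotR P h + (t - dotR P h) by ring.
  apply: le_trans (ler_normD _ _) _; rewrite /A mulrDl; apply: lerD => //.
  apply: le_trans b1 _; rewrite -hhE expr2 mulrA ler_piMr ?mulr_ge0 //.
  exact: ltW.
have b3 : `|f (w x + t) - f (w x) - f1 * t - 2^-1 * f2 * t ^+ 2| <=
    e / 3 / (A ^+ 2 + 1) * t ^+ 2.
  apply: h3; apply: le_lt_trans tA _.
  by move: hd3; rewrite ltr_pdivlMr; [nra|lra].
have tE : w (x + h) = w x + t by rewrite /t; ring.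
have -> : qf R N (f1 *: Y + f2 *: (P^T *m P)) h =
   f1 * qf R N Y h + f2 * (dotR P h) ^+ 2.
  rewrite qf_addM !qf_scaleM; congr (_ + _ * _).
  rewrite /qf mulmxA.
  have -> : h *m P^T = (dotR P h)%:M.
    by apply/rowP => i; rewrite ord1 dotRC dotRE [RHS]mxE eqxx mulr1n.
  by rewrite mul_scalar_mx dotRZl expr2.
rewrite dotRZl tE.
have -> : f (w x + t) - f (w x) - f1 * dotR P h -
    2^-1 * (f1 * qf R N Y h + f2 * dotR P h ^+ 2) =
  (f (w x + t) - f (w x) - f1 * t - 2^-1 * f2 * t ^+ 2) +
  f1 * (t - dotR P h - 2^-1 * qf R N Y h) +
  2^-1 * f2 * ((t - dotR P h) * (t + dotR P h)) by ring.
have t2 : t ^+ 2 <= A ^+ 2 * dotR h h.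
  rewrite -hhE -exprMn -[t ^+ 2]ger0_norm ?sqr_ge0 // normrX.
  by rewrite lerXn2r ?nnegrE ?mulr_ge0.
have e3 : e / 3 / (A ^+ 2 + 1) * t ^+ 2 <= e / 3 * dotR h h.
  have A2 := sqr_ge0 A.
  rewrite mulrAC ler_pdivrMr; last lra.
  have : e / 3 * t ^+ 2 <= e / 3 * (A ^+ 2 * dotR h h) by rewrite ler_wpM2l //; lra.
  nra.
have e4 : `|f1 * (t - dotR P h - 2^-1 * qf R N Y h)| <= e / 3 * dotR h h.
  rewrite normrM; apply: le_trans (ler_wpM2l (normr_ge0 f1) (h2 h hd2)) _.
  have f10 := normr_ge0 f1.
  rewrite mulrA ler_wpM2r // mulrA ler_pdivrMr; [nra|lra].
have e5 : `|2^-1 * f2 * ((t - dotR P h) * (t + dotR P h))| <= e / 3 * dotR h h.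
  rewrite !normrM (ger0_norm (_ : 0 <= 2^-1)); last lra.
  have tp : `|t + dotR P h| <= 2 * A * enorm h.
    apply: le_trans (ler_normD _ _) _.
    have : enorm P * enorm h <= A * enorm h by rewrite ler_wpM2r // lerDl.
    lra.
  have m1 : `|t - dotR P h| * `|t + dotR P h| <= (C * dotR h h) * (2 * A * enorm h).
    by rewrite ler_pM.
  have m2 : 2^-1 * `|f2| * (`|t - dotR P h| * `|t + dotR P h|) <=
      2^-1 * `|f2| * ((C * dotR h h) * (2 * A * enorm h)).
    by rewrite ler_wpM2l // mulr_ge0 //; lra.
  apply: le_trans m2 _.
  have -> : 2^-1 * `|f2| * (C * dotR h h * (2 * A * enorm h)) =
     (2^-1 * B * enorm h) * dotR h h by rewrite /B; ring.
  rewrite ler_wpM2r //.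
  move: hd5; rewrite ltr_pdivlMr; last lra.
  nra.
apply: le_trans (ler_normD _ _) _.
apply: le_trans (lerD (ler_normD _ _) (lexx _)) _.
lra.
Qed.

Lemma jet1_sq (s : R) : jet1 (fun t => t ^+ 2) s (2 * s) 2.
Proof.
move=> e e0; exists 1 => // t _.
have -> : (s + t) ^+ 2 - s ^+ 2 - 2 * s * t - 2^-1 * 2 * t ^+ 2 = 0 by field.
by rewrite normr0 mulr_ge0 ?sqr_ge0 // ltW.
Qed.

Lemma jet1_inv (s : R) : s != 0 -> jet1 (fun t => t^-1) s (- s ^- 2) (2 * s ^- 3).
Proof.
move=> s0 e e0; have s0' : 0 < `|s| by rewrite normr_gt0.
(* The first bound gives [|s + t| >= |s| / 2], the second makes the cubic remainder
   [t^3 / ((s + t) s^3)] at most [e * t^2]. *)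
pose d := Num.min (`|s| / 2) (e * `|s| ^+ 4 / 2).
exists d; first by rewrite lt_min; apply/andP; split; rewrite ?divr_gt0 ?mulr_gt0 ?exprn_gt0.
move=> t; rewrite lt_min => /andP[t1 t2].
have st : s + t != 0.
  apply/eqP => h; have : s = - t by lra.
  by move=> hs; move: t1; rewrite hs normrN; have := normr_ge0 t; lra.
have -> : (s + t)^-1 - s^-1 - - s ^- 2 * t - 2^-1 * (2 * s ^- 3) * t ^+ 2 =
   - (t / ((s + t) * s ^+ 3)) * t ^+ 2.
  by field; rewrite s0 st.
rewrite normrM normrN [`|t ^+ 2|]ger0_norm ?sqr_ge0 // ler_wpM2r ?sqr_ge0 //.
rewrite normrM normfV normrM normrX ler_pdivrMr; last first.
  by rewrite mulr_gt0 ?normr_gt0 ?exprn_gt0.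
have h1 : `|s| / 2 <= `|s + t|.
  have := ler_normB (s + t) t; rewrite addrK; lra.
apply: (@le_trans _ _ (e * (`|s| / 2 * `|s| ^+ 3))).
  move: t2; rewrite [`|s| ^+ 4]exprS; lra.
by rewrite ler_wpM2l ?(ltW e0) // ler_wpM2r ?exprn_ge0.
Qed.

(** The derivative of the second-order remainder is the first-order remainder, already [o(t)]; the
    mean value theorem gives [o(t^2)]. *)
Lemma jet1_exp (s : R) : jet1 expR s (expR s) (expR s).
Proof.
move=> e e0.
have [d d0 hd] := (is_derive_eps.1 (is_derive_expR s)) e e0.
exists d => // t td.
pose p (t : R) : R := expR (s + t) - expR s - expR s * t - 2^-1 * expR s * t ^+ 2.
pose dp (t : R) : R := expR (s + t) - expR s - expR s * t.
have hp r : is_derive r (1 : R) p (dp r).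
  have h1 : is_derive r (1 : R) (fun t : R => s + t) 1.
    have := is_deriveD (is_derive_cst s r (1 : R)) (is_derive_id r (1 : R)).
    by rewrite add0r.
  have h2 := @is_derive1_comp R expR (fun t => s + t) r _ _ (is_derive_expR _) h1.
  have h3 := is_deriveZ (expR s) (is_derive_id r (1 : R)).
  have h4 := is_deriveZ (2^-1 * expR s) (is_deriveX 2 (is_derive_id r (1 : R))).
  have h5 := is_deriveB (is_deriveB (is_deriveB h2 (is_derive_cst (expR s) r 1)) h3) h4.
  by apply: is_derive_eq h5 _; rewrite /dp /GRing.scale /=; field.
have cp a b : {within `[a, b], continuous p}.
  by apply: continuous_subspaceT => r; exact: is_derive1_continuous (hp r).
have p0 : p 0 = 0 by rewrite /p addr0 subrr mulr0 expr2 !mul0r mulr0 !subr0.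
have bd c : `|c| <= `|t| -> `|dp c| <= e * `|t|.
  move=> ct; have := hd c (le_lt_trans ct td).
  rewrite -[c *: 1]/(c * 1) mulr1 => /le_trans; apply.
  by rewrite ler_wpM2l // ltW.
rewrite -/(p t) -[t ^+ 2]ger0_norm ?sqr_ge0 // normrX expr2 mulrA.
have [t0|t0|t0] := ltgtP t 0.
- have [c c01 hc] := MVT t0 (fun r _ => hp r) (cp _ _).
  move: hc; rewrite p0 sub0r => /eqP; rewrite eqr_oppLR => /eqP ->.
  rewrite normrN normrM; have -> : `|0 - t| = `|t| by rewrite sub0r normrN.
  rewrite ler_wpM2r //; apply: bd.
  by move: c01; rewrite in_itv /= => /andP[c1 c2]; rewrite !ltr0_norm //; lra.
- have [c c01 hc] := MVT t0 (fun r _ => hp r) (cp _ _).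
  move: hc; rewrite p0 !subr0 => ->.
  rewrite normrM ler_wpM2r //; apply: bd.
  by move: c01; rewrite in_itv /= => /andP[c1 c2]; rewrite !gtr0_norm //; lra.
- by rewrite t0 p0 normr0 mulr_ge0 // mulr_ge0 // ltW.
Qed.

(** Polarisation: a quarter of [(w1 + w2)^2 - (w1 - w2)^2], so sums and composition with the square
    suffice. *)
Lemma jet_mul w1 w2 x P1 P2 Y1 Y2 : jet w1 x P1 Y1 -> jet w2 x P2 Y2 ->
  jet (fun y => w1 y * w2 y) x (w1 x *: P2 + w2 x *: P1)
    (w1 x *: Y2 + w2 x *: Y1 + (P1^T *m P2 + P2^T *m P1)).
Proof.
move=> j1 j2.
have js := jet_comp _ _ _ _ _ _ _ (jet_add _ _ _ _ _ _ _ j1 j2) (jet1_sq _).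
have jm := jet_comp _ _ _ _ _ _ _
  (jet_add _ _ _ _ _ _ _ j1 (jet_scale (- 1) _ _ _ _ j2)) (jet1_sq _).
have j := jet_add _ _ _ _ _ _ _ (jet_scale 4^-1 _ _ _ _ js)
  (jet_scale (- 4^-1) _ _ _ _ jm).
apply: (jet_ext _ _ _ _ _ _ (jet_eq _ _ _ _ _ _ j _ _)) => [y||].
- by field.
- by apply/rowP => i; rewrite !mxE; field.
- by apply/matrixP => i k; rewrite !mxE !big_ord1 !mxE; field.
Qed.

Lemma jet_transl w (a : V) x P Y : jet w (x - a) P Y ->
  jet (fun y => w (y - a)) x P Y.
Proof.
move=> j e e0; have [d d0 hd] := j e e0; exists d => // h /hd.
by have -> : x + h - a = x - a + h by rewrite addrAC.
Qed.

Lemma enorm_mul_bound (v : V) Y : enorm (v *m Y) <= mnorm N N Y * enorm v.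
Proof.
have [->|m0] := eqVneq (v *m Y) 0.
  by rewrite /enorm dotR0l sqrtr0 mulr_ge0 ?mnorm_ge0 // sqrtr_ge0.
have h0 := enorm_gt0 R N _ m0.
rewrite -(ler_pM2r h0) -expr2 enorm_sqr.
exact: le_trans (ler_norm _) (bilin_bound _ _ _).
Qed.

(** The inner map is described by the jets of its linear functionals; the second-order part of [Z]
    enters the Hessian only through the functional [P]. The increment of [Z] is compared with its
    linear part coordinate by coordinate. *)
Lemma jet_map (Z : V -> V) (L : 'M[R]_N) (H : V -> 'M[R]_N) w x P Y :
  (forall b, jet (fun y => dotR b (Z y)) x (b *m L) (H b)) ->
  jet w (Z x) P Y ->
  jet (fun y => w (Z y)) x (P *m L) (L^T *m Y *m L + H P) .
Proof.
move=> jZ jw e e0.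
have jk i : exists (C d : R), [/\ 0 <= C, 0 < d & forall h, enorm h < d ->
    `|(Z (x + h) - Z x - h *m L^T) ord0 i| <= C * dotR h h].
  have [C [d [C0 d0 hd]]] := jet_first _ _ _ _ (jZ (evec R i)).
  exists C, d; split => // h /hd.
  rewrite !(dotRC R N (evec R i)) !dotR_evec.
  by rewrite (dotRC R N (evec R i *m L)) -{1}[L]trmxK -dotR_mulmx dotR_evec !mxE.
pose C i := projT1 (cid (jk i)).
have [d1 d10 h1] : exists2 d : R, 0 < d & forall h, enorm h < d ->
    enorm (Z (x + h) - Z x - h *m L^T) <= (\sum_i C i) * dotR h h.
  pose dd i := projT1 (cid (projT2 (cid (jk i)))).
  have hC i : [/\ 0 <= C i, 0 < dd i & forall h, enorm h < dd i ->
    `|(Z (x + h) - Z x - h *m L^T) ord0 i| <= C i * dotR h h].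
    by rewrite /C /dd; case: cid => c hc /=; case: cid.
  exists (\big[Num.min/1]_i dd i).
    elim/big_ind: _ => // [a b|i _]; last by have [] := hC i.
    by rewrite lt_min => -> ->.
  move=> h hd; apply: le_trans (enorm_le_sum _) _; rewrite mulr_suml.
  apply: ler_sum => i _; have [_ _ hh] := hC i; apply: hh.
  by apply: lt_le_trans hd _; exact: bigmin_le_cond.
have C0 : 0 <= \sum_i C i.
  apply: sumr_ge0 => i _; rewrite /C; case: cid => c /= [d [c0 _ _]].
  exact: c0.
set C1 := \sum_i C i in h1 C0.
pose CL := mnorm N N L^T; pose CY := mnorm N N Y.
have CL0 : 0 <= CL by exact: mnorm_ge0.
have CY0 : 0 <= CY by exact: mnorm_ge0.
pose A := CL + C1.
have A0 : 0 <= A by exact: addr_ge0.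
pose B := CY * (C1 * (CL + A)).
have B0 : 0 <= B by rewrite /B !mulr_ge0 ?addr_ge0.
have [d2 d20 h2] := jZ P (e / 3) ltac:(lra).
have [d3 d30 h3] := jw (e / 3 / (A ^+ 2 + 1)) ltac:(by
  apply: divr_gt0; have := sqr_ge0 A; lra).
pose d := Num.min (Num.min d1 d2) (Num.min (d3 / (A + 1)) (Num.min 1 (e / 3 / (B + 1)))).
have [k1 k2] : 0 < d3 / (A + 1) /\ 0 < e / 3 / (B + 1).
  by split; rewrite ?divr_gt0 //; lra.
exists d; first by rewrite /d !lt_min d10 d20 k1 k2 ltr01.
move=> h; rewrite /d !lt_min => /andP[/andP[hd1 hd2] /andP[hd3 /andP[hd4 hd5]]].
have hh := dotR_ge0 R N h; have h0 := enorm_ge0 R N h.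
have hhE := enorm_sqr R N h.
set k := Z (x + h) - Z x; set m := h *m L^T.
have kE : Z (x + h) = Z x + k by rewrite /k (addrC (Z x)) subrK.
have b1 : enorm (k - m) <= C1 * dotR h h by exact: h1.
have bm : enorm m <= CL * enorm h by exact: enorm_mul_bound.
have bk : enorm k <= A * enorm h.
  have -> : k = m + (k - m) by rewrite addrC subrK.
  apply: le_trans (enorm_triangle _ _ _ _) _; rewrite /A mulrDl; apply: lerD => //.
  apply: le_trans b1 _; rewrite -hhE expr2 mulrA ler_piMr ?mulr_ge0 //.
  exact: ltW.
have b3 := h3 k; rewrite -kE in b3.
have {}b3 : `|w (Z (x + h)) - w (Z x) - dotR P k - 2^-1 * qf R N Y k| <=
    e / 3 * dotR h h.
  apply: le_trans (b3 _) _.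
    apply: le_lt_trans bk _.
    by move: hd3; rewrite ltr_pdivlMr; [nra|lra].
  have A2 := sqr_ge0 A.
  have kk : dotR k k <= A ^+ 2 * dotR h h.
    by rewrite -hhE -exprMn -enorm_sqr lerXn2r ?nnegrE ?mulr_ge0 ?enorm_ge0.
  rewrite mulrAC ler_pdivrMr; last lra.
  have : e / 3 * dotR k k <= e / 3 * (A ^+ 2 * dotR h h) by rewrite ler_wpM2l //; lra.
  nra.
have b2 : `|dotR P k - dotR (P *m L) h - 2^-1 * qf R N (H P) h| <= e / 3 * dotR h h.
  by rewrite /k dotRBr; exact: h2.
have b4 : `|2^-1 * (qf R N Y k - qf R N Y m)| <= e / 3 * dotR h h.
  have -> : qf R N Y k - qf R N Y m = dotR (m *m Y) (k - m) + dotR ((k - m) *m Y) k.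
    rewrite /qf [(k - m) *m Y]mulmxBl (dotRBl R N (k *m Y)) (dotRBr R N k m).
    by ring.
  rewrite normrM (ger0_norm (_ : 0 <= 2^-1)); last lra.
  have q1 : `|dotR (m *m Y) (k - m)| <= CY * (CL * enorm h) * (C1 * dotR h h).
    apply: le_trans (bilin_bound _ _ _) _.
    rewrite ler_pM ?mulr_ge0 ?enorm_ge0 ?mnorm_ge0 //.
    by rewrite ler_wpM2l // mnorm_ge0.
  have q2 : `|dotR ((k - m) *m Y) k| <= CY * (C1 * dotR h h) * (A * enorm h).
    apply: le_trans (bilin_bound _ _ _) _.
    rewrite ler_pM ?mulr_ge0 ?enorm_ge0 ?mnorm_ge0 //.
    by rewrite ler_wpM2l // mnorm_ge0.
  have q3 : `|dotR (m *m Y) (k - m) + dotR ((k - m) *m Y) k| <=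
      B * enorm h * dotR h h.
    apply: le_trans (ler_normD _ _) _; rewrite /B.
    by apply: le_trans (lerD q1 q2) _; rewrite le_eqVlt; apply/orP; left; apply/eqP; ring.
  have q4 : B * enorm h <= e / 3.
    move: hd5; rewrite ltr_pdivlMr; last lra.
    nra.
  have := ler_wpM2r hh q4.
  have : 0 <= B * enorm h * dotR h h by apply: mulr_ge0 => //; exact: mulr_ge0.
  lra.
have -> : qf R N (L^T *m Y *m L + H P) h = qf R N Y m + qf R N (H P) h.
  rewrite qf_addM; congr (_ + _).
  by rewrite /qf /m !mulmxA dotR_mulmx.
have -> : w (Z (x + h)) - w (Z x) - dotR (P *m L) h -
   2^-1 * (qf R N Y m + qf R N (H P) h) =
   (w (Z (x + h)) - w (Z x) - dotR P k - 2^-1 * qf R N Y k) +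
   (dotR P k - dotR (P *m L) h - 2^-1 * qf R N (H P) h) +
   2^-1 * (qf R N Y k - qf R N Y m) by ring.
apply: le_trans (ler_normD _ _) _.
apply: le_trans (lerD (ler_normD _ _) (lexx _)) _.
lra.
Qed.

End Jets.

(** * Inversion and comparison *)

Section Inversion.
Variables (R : realType) (N : nat).
Notation V := 'rV[R]_N.
Variables (a e : V) (kappa rho : R).
Hypothesis rho0 : 0 < rho.

(* the shift by [kappa *: e] absorbs the curvature of the boundary, see
   [inner_normal] *)
Definition zmap (x : V) : V :=
  rho^-1 *: ((dotR (x - a) (x - a))^-1 *: (x - a) + kappa *: e).

(** Differential of [zmap] at [a + y]: the scalar [1 / (rho |y|^2)] times the reflection across the
    hyperplane orthogonal to [y]. [zmapH y b] is the Hessian of [b . zmap]. *)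
Definition zmapL (y : V) : 'M[R]_N :=
  rho^-1 *: ((dotR y y)^-1%:M - (2 * (dotR y y) ^- 2) *: (y^T *m y)).

Definition zmapH (y b : V) : 'M[R]_N :=
  rho^-1 *: ((dotR b y * 8 * (dotR y y) ^- 3) *: (y^T *m y) -
             (dotR b y * 2 * (dotR y y) ^- 2)%:M -
             (2 * (dotR y y) ^- 2) *: (b^T *m y + y^T *m b)).

Lemma mul_outer (b y z : V) : b *m (y^T *m z) = dotR b y *: z.
Proof.
rewrite mulmxA (_ : b *m y^T = (dotR b y)%:M) ?mul_scalar_mx //.
by apply/rowP => i; rewrite ord1 [RHS]mxE eqxx mulr1n dotRE.
Qed.

Lemma tr_outer (y z : V) : \tr (y^T *m z) = dotR y z.
Proof.
rewrite mxtrace_mulC (_ : z *m y^T = (dotR y z)%:M).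
  by rewrite mxtrace_scalar mulr1n.
by apply/rowP => i; rewrite ord1 [RHS]mxE eqxx mulr1n dotRC dotRE.
Qed.

Lemma zmapL_tr y : (zmapL y)^T = zmapL y.
Proof.
by apply/matrixP => i j; rewrite !mxE !big_ord1 !mxE [i == j]eq_sym; ring.
Qed.

Lemma zmapL_mul y b : b *m zmapL y =
  rho^-1 *: ((dotR y y)^-1 *: b - (2 * (dotR y y) ^- 2 * dotR b y) *: y).
Proof.
rewrite /zmapL -scalemxAr mulmxBr mul_mx_scalar -scalemxAr mul_outer.
by rewrite scalerA.
Qed.

Lemma zmap_jet x b : x != a ->
  jet R N (fun y => dotR b (zmap y)) x (b *m zmapL (x - a)) (zmapH (x - a) b).
Proof.
move=> xa; have y0 : x - a != 0 by rewrite subr_eq0.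
set y := x - a in y0 *.
have s0 : dotR y y != 0 by rewrite gt_eqF // dotR_gt0.
have r0 : rho != 0 by rewrite gt_eqF.
have j1 := jet_lin R N b y.
have j2 := jet_comp R N _ _ _ _ _ _ _ (jet_sqn R N y) (jet1_inv R _ s0).
have j3 := jet_mul R N _ _ _ _ _ _ _ j1 j2.
have j4 := jet_add R N _ _ _ _ _ _ _ j3 (jet_cst R N (kappa * dotR b e) y).
have j5 := jet_transl R N _ _ _ _ _ (jet_scale R N rho^-1 _ _ _ _ j4).
apply: (jet_ext R N _ _ _ _ _ _ (jet_eq R N _ _ _ _ _ _ j5 _ _)) => [z||].
- by rewrite /zmap !dotE; ring.
- by rewrite zmapL_mul; apply/rowP => i; rewrite !mxE; field; rewrite ?s0 ?r0.
- apply/matrixP => i j; rewrite /zmapH !mxE !big_ord1 !mxE.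
  by case: (i == j); rewrite ?mulr1n ?mulr0n; field; rewrite ?s0 ?r0.
Qed.

(** A reflection squares to the identity, so only the squared conformal factor remains. *)
Lemma zmapL_self (y P : V) : y != 0 ->
  P *m zmapL y *m zmapL y = (rho * dotR y y) ^- 2 *: P.
Proof.
move=> y0; have s0 : dotR y y != 0 by rewrite gt_eqF // dotR_gt0.
have r0 : rho != 0 by rewrite gt_eqF.
rewrite !zmapL_mul !dotE; apply/rowP => i; rewrite !mxE; field.
by rewrite s0 r0.
Qed.

(* The N-Laplacian is conformally invariant: the second-order part of the
   inversion does not contribute. *)
Lemma conformal_trace (y P : V) (Y : 'M[R]_N) : (2 <= N)%N -> y != 0 ->
  let p := P *m zmapL y in
  let X := (zmapL y)^T *m Y *m zmapL y + zmapH y P in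
  let c := (rho * dotR y y) ^- 2 in
  dotR p p = c * dotR P P /\
  dotR p p * \tr X + (N - 2)%:R * qf R N X p =
    c ^+ 2 * (dotR P P * \tr Y + (N - 2)%:R * qf R N Y P).
Proof.
move=> N2 y0; have s0 : dotR y y != 0 by rewrite gt_eqF // dotR_gt0.
have r0 : rho != 0 by rewrite gt_eqF.
move=> p X c.
have pp : dotR p p = c * dotR P P.
  by rewrite /p dotR_mulmx zmapL_tr zmapL_self // dotRZr.
split => //.
have trX : \tr X = c * \tr Y + \tr (zmapH y P).
  rewrite /X mxtraceD; congr (_ + _).
  rewrite mxtrace_mulC mulmxA zmapL_tr.
  have -> : zmapL y *m zmapL y = c%:M.
    by apply/row_matrixP => i; rewrite !rowE mulmxA zmapL_self // mul_mx_scalar.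
  by rewrite mul_scalar_mx mxtraceZ.
have qX : qf R N X p = c ^+ 2 * qf R N Y P + qf R N (zmapH y P) p.
  rewrite /X qf_addM; congr (_ + _).
  rewrite /qf /p !mulmxA zmapL_tr zmapL_self // dotR_mulmx zmapL_tr zmapL_self //.
  by rewrite -/c -scalemxAl !dotE; ring.
have NE : N%:R = (N - 2)%:R + 2 :> R by rewrite natrB // subrK.
(* After weighting by [dotR p p] and by [N - 2] respectively, this trace and the quadratic form [qH]
   below cancel; the exponent [N] is what makes them match. *)
have trH : \tr (zmapH y P) = - (2 * (N - 2)%:R) * rho^-1 * dotR P y * dotR y y ^- 2.
  rewrite /zmapH mxtraceZ !raddfB /= !mxtraceZ mxtraceD !tr_outer mxtrace_scalar.
  rewrite (dotRC R N y P) -[_ *+ N]mulr_natr NE; field.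
  by rewrite s0 r0.
have qH : qf R N (zmapH y P) p = 2 * dotR p p * rho^-1 * dotR P y * dotR y y ^- 2.
  have qo (b z : V) : qf R N (b^T *m z) p = dotR b p * dotR z p.
    by rewrite /qf mul_outer dotRZl (dotRC R N p).
  have yp : dotR y p = - rho^-1 * dotR P y / dotR y y.
    by rewrite /p zmapL_mul !dotE (dotRC R N y P); field; rewrite s0 r0.
  have Pp : dotR P p = rho^-1 * (dotR P P / dotR y y -
      2 * dotR P y ^+ 2 * dotR y y ^- 2).
    by rewrite /p zmapL_mul !dotE; field; rewrite s0 r0.
  rewrite /zmapH qf_scaleM !qf_addM !qf_oppM !qf_scaleM qf_scalar qf_addM !qo.
  rewrite pp /c yp Pp; field; by rewrite s0 r0.
rewrite trX qX trH qH pp; ring.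
Qed.

End Inversion.

(** The touching inequality in the inverted variable. The conformal factor at [x0] is the inverse of
    [rho |x0 - a|^2]; collecting its powers from both sides leaves the [N]-th power in front of the
    absorption. *)
Lemma touch_zmap (R : realType) (N : nat) (O : set 'rV[R]_N) (g : R -> R)
    (u : 'rV[R]_N -> R) (a e x0 P : 'rV[R]_N) (Y : 'M[R]_N) (kappa rho : R)
    (w : 'rV[R]_N -> R) :
  (2 <= N)%N ->
  open O -> weak_solution O g u -> (forall x, O x -> differentiable u x) ->
  (forall x i, O x -> {for x, continuous (partial i u)}) -> continuous g ->
  0 < rho -> Y^T = Y -> O x0 -> x0 != a -> P != 0 ->
  jet R N w (zmap R N a e kappa rho x0) P Y ->
  (exists2 d : R, 0 < d & forall x, `|x - x0| < d ->
     u x - w (zmap R N a e kappa rho x) <= u x0 - w (zmap R N a e kappa rho x0)) ->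
  dotR P P * ((rho * dotR (x0 - a) (x0 - a)) ^+ N * g (u x0)) <=
  enorm P ^+ (N - 2) * (dotR P P * \tr Y + (N - 2)%:R * qf R N Y P).
Proof.
move=> N2 openO weak_u du cdu cg rho0 symY Ox0 x0a P0 jw [d d0 hd].
have y0 : x0 - a != 0 by rewrite subr_eq0.
set y := x0 - a in y0 *.
set Z := zmap R N a e kappa rho in jw hd *.
pose L := zmapL R N rho y.
have jZ b : jet R N (fun z => dotR b (Z z)) x0 (b *m L) (zmapH R N rho y b).
  exact: zmap_jet.
have jc := jet_map R N Z L _ w x0 P Y jZ jw.
have [pp hX] := conformal_trace R N rho rho0 y P Y N2 y0.
move: pp hX; rewrite -/L => pp hX.
set p := P *m L in pp hX jc.
set X := L^T *m Y *m L + zmapH R N rho y P in jc hX.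
set c := (rho * dotR y y) ^- 2 in pp hX.
have s0 : 0 < rho * dotR y y by rewrite mulr_gt0 // dotR_gt0.
have c0 : 0 < c by rewrite invr_gt0 exprn_gt0.
have p0 : p != 0.
  apply: contraL (dotR_gt0 R N _ P0) => /eqP pe.
  rewrite -(pmulr_rgt0 _ c0) -pp pe dotR0l ltxx //.
have symX : X^T = X.
  rewrite /X linearD /= !trmx_mul symY trmxK mulmxA; congr (_ + _).
  by apply/matrixP => i j; rewrite !mxE !big_ord1 !mxE [i == j]eq_sym; ring.
have := touch R N O g u x0 p X openO weak_u du cdu cg symX Ox0 p0.
have hyp : forall e0 : R, 0 < e0 -> exists2 d : R, 0 < d & forall h, `|h| < d ->
     u (x0 + h) <= u x0 + dotR p h + 2^-1 * qf R N X h + e0 * dotR h h.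
  move=> e0 e00; have [d2 d20 h2] := jc e0 e00.
  (* A crude constant comparing the Euclidean norm with the sup norm. *)
  pose M : R := N%:R + 1.
  have M1 : 1 <= M by rewrite /M lerDr.
  exists (Num.min d (d2 / M)); first by rewrite lt_min d0 divr_gt0 //; lra.
  move=> h; rewrite lt_min => /andP[hd1 hd2].
  have eh : enorm h < d2.
    apply: (@le_lt_trans _ _ (M * `|h|)); last first.
      by move: hd2; rewrite ltr_pdivlMr; [rewrite mulrC|lra].
    rewrite -(@ler_pXn2r _ 2) ?nnegrE ?mulr_ge0 ?enorm_ge0 //; last lra.
    rewrite enorm_sqr; apply: le_trans (enorm_sqr_le_norm R N h) _.
    rewrite exprMn ler_wpM2r ?exprn_ge0 // /M.
    have : 0 <= (N%:R : R) by []; nra.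
  have /ler_normlP [_ k2] := h2 h eh.
  have hx : `|x0 + h - x0| < d by rewrite (addrC x0) addrK.
  have := hd _ hx; lra.
move=> /(_ hyp).
have enp : enorm p = (rho * dotR y y)^-1 * enorm P.
  apply/eqP; rewrite -(@eqrXn2 _ 2) ?mulr_ge0 ?enorm_ge0 ?invr_ge0 ?(ltW s0) //.
  by rewrite exprMn !enorm_sqr pp exprVn.
rewrite hX pp enp exprMn => main.
rewrite /c in main; move: s0 main; set S := rho * dotR y y => s0 main.
have S0 : S != 0 by rewrite gt_eqF.
have -> : S ^+ N = S ^+ (N - 2) * S ^+ 2 by rewrite -exprD subnK.
have Sn : 0 < S ^+ (N - 2) * S ^+ 4 by rewrite mulr_gt0 ?exprn_gt0.
move: main; rewrite -(ler_pM2l Sn) [S^-1 ^+ (N - 2)]exprVn => main.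
have Sn0 : S ^+ (N - 2) != 0 by rewrite expf_neq0.
apply: le_trans (le_trans _ main) _; rewrite le_eqVlt; apply/orP; left; apply/eqP.
  by field; rewrite S0.
set T := _ + _; set Pn := enorm P ^+ _.
have -> : S ^+ (N - 2) * S ^+ 4 * (S ^- (N - 2) * Pn * (S ^- 2 ^+ 2 * T)) =
    (S ^+ (N - 2) * S ^- (N - 2)) * (Pn * T) * (S ^+ 4 * (S ^- 2) ^+ 2) by ring.
by rewrite divff // mul1r exprVn -exprM divff ?expf_neq0 // mulr1.
Qed.

Lemma jet_cont (R : realType) (N : nat) (w : 'rV[R]_N -> R) x P Y :
  jet R N w x P Y -> {for x, continuous w}.
Proof.
move=> /(jet_first R N) [C [d [C0 d0 hd]]].
have FF : Filter (nbhs x) by exact: nbhs_filter.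
apply/cvgrPdist_le => eps eps0.
apply: (iffRL (@nbhs_ballP R 'rV[R]_N x _)).
pose A := enorm P + C * d.
have A0 : 0 <= A by rewrite addr_ge0 ?enorm_ge0 // mulr_ge0 // ltW.
pose n : R := N%:R + 1.
have n1 : 1 <= n by rewrite /n lerDr.
pose r := Num.min d (eps / (A + 1)).
have r0 : 0 < r by rewrite lt_min d0 divr_gt0 //; lra.
have rd : r <= d by rewrite ge_min lexx.
have rA : r * (A + 1) <= eps.
  by rewrite -ler_pdivlMr; [rewrite ge_min lexx orbT|lra].
exists (r / n); first by rewrite /= divr_gt0 //; lra.
move=> y; rewrite /= -ball_normE /= distrC => xy.
have yE : y = x + (y - x) by rewrite addrC subrK.
have eh : enorm (y - x) < r.
  apply: (@le_lt_trans _ _ (n * `|y - x|)); last first.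
    by move: xy; rewrite ltr_pdivlMr; [rewrite mulrC|lra].
  rewrite -(@ler_pXn2r _ 2) ?nnegrE ?mulr_ge0 ?enorm_ge0 //; last lra.
  rewrite enorm_sqr; apply: le_trans (enorm_sqr_le_norm R N _) _.
  rewrite exprMn ler_wpM2r ?exprn_ge0 // /n.
  have : 0 <= (N%:R : R) by []; nra.
have := hd (y - x) (lt_le_trans eh rd); rewrite -yE => b.
have cs := cauchy_schwarz_abs R N P (y - x).
have h0 := enorm_ge0 R N (y - x).
rewrite distrC; apply: le_trans rA.
have -> : w y - w x = (w y - w x - dotR P (y - x)) + dotR P (y - x) by rewrite subrK.
apply: le_trans (ler_normD _ _) _.
move: b; rewrite -enorm_sqr => b.
apply: le_trans (lerD b cs) _.
set q := enorm (y - x) in eh cs h0 *.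
have p0 := enorm_ge0 R N P.
have h1 : C * q ^+ 2 <= C * d * q by rewrite expr2 mulrA -!mulrA ler_wpM2l // ler_wpM2r // ltW // (lt_le_trans eh).
have h2 : (C * d + enorm P) * q <= A * r.
  by rewrite addrC ler_wpM2l // ltW.
move: h2; rewrite mulrDl; nra.
Qed.

(** * Comparison on shells *)

Section Comparison.
Variables (R : realType) (N : nat) (O : set 'rV[R]_N) (g : R -> R).
Notation V := 'rV[R]_N.
Variables (u : V -> R) (a e : V) (kappa : R).
Hypotheses (N2 : (2 <= N)%N) (openO : open O) (weak_u : weak_solution O g u).
Hypothesis du : forall x, O x -> differentiable u x.
Hypothesis cdu : forall x i, O x -> {for x, continuous (partial i u)}.
Hypothesis cg : continuous g.
Hypothesis cu : {within closure O `\ a, continuous u}.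
Hypothesis ee : dotR e e = 1.
Hypothesis kappa0 : 0 <= kappa.
Local Notation Z := (zmap R N a e kappa).
Local Notation dist2 x := (dotR (x - a) (x - a)).

Lemma dist2_gt0 (x : V) : x != a -> 0 < dist2 x.
Proof. by move=> xa; rewrite dotR_gt0 // subr_eq0. Qed.

Lemma zmap_scale (rho : R) (x : V) : Z rho x = rho^-1 *: Z 1 x.
Proof. by rewrite /zmap invr1 scale1r. Qed.

Lemma zmap_sqn (rho : R) (x : V) : 0 < rho -> x != a ->
  dotR (Z rho x) (Z rho x) * (rho ^+ 2 * dist2 x) =
  1 + 2 * kappa * dotR e (x - a) + kappa ^+ 2 * dist2 x.
Proof.
move=> rho0 xa; have s0 : dist2 x != 0 by rewrite gt_eqF // dist2_gt0.
have r0 : rho != 0 by rewrite gt_eqF.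
rewrite /zmap; move: s0; generalize (x - a) => y s0.
rewrite !(dotRZl, dotRZr, dotRDl, dotRDr) ee (dotRC R N y e); field.
by rewrite s0 r0.
Qed.

(** The condition [1 <= |Z rho x|^2 <= r2] with denominators cleared by [zmap_sqn]: it is polynomial
    in [x], hence closed, and at [x = a] it reads [1 <= 0]. *)
Definition shell (rho r2 : R) : set V := [set x | closure O x /\
  (rho ^+ 2 * dist2 x <= 1 + 2 * kappa * dotR e (x - a) + kappa ^+ 2 * dist2 x <=
   r2 * (rho ^+ 2 * dist2 x))].

Lemma shell_neq rho r2 x : shell rho r2 x -> x != a.
Proof.
move=> [_ /andP[_ h]]; apply/negP => /eqP xa; move: h.
by rewrite xa subrr !dotR0r !mulr0 !addr0 ler10.
Qed.

Lemma shellP (rho r2 : R) (x : V) : 0 < rho -> closure O x -> x != a ->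
  shell rho r2 x <-> 1 <= dotR (Z rho x) (Z rho x) <= r2.
Proof.
move=> rho0 Ox xa; have s0 := dist2_gt0 _ xa.
have q0 : 0 < rho ^+ 2 * dist2 x by rewrite mulr_gt0 ?exprn_gt0.
rewrite /shell /= -(zmap_sqn rho x) // ler_pM2r // -{1}[rho ^+ 2 * _]mul1r ler_pM2r //.
by split => [[]|].
Qed.

(** Expansion of [|e - kappa (x - a)|^2 >= 0]. This and its companion below turn shell membership
    into two-sided bounds on the distance to [a]. *)
Lemma coord_dist2 (x : V) : 2 * kappa * dotR e (x - a) <= 1 + kappa ^+ 2 * dist2 x.
Proof.
generalize (x - a) => y; have := dotR_ge0 R N (e - kappa *: y).
by rewrite dotRBl !dotRBr !dotRZl !dotRZr ee (dotRC R N y e); lra.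
Qed.

Lemma coord_dist2_2 (x : V) : - (2 * kappa * dotR e (x - a)) <= 2^-1 + 2 * kappa ^+ 2 * dist2 x.
Proof.
generalize (x - a) => y; have := dotR_ge0 R N (e + (2 * kappa) *: y).
by rewrite dotRDl !dotRDr !dotRZl !dotRZr ee (dotRC R N y e); lra.
Qed.

Lemma shell_small rho r2 x : shell rho r2 x ->
  (rho ^+ 2 - 2 * kappa ^+ 2) * dist2 x <= 2.
Proof.
by move=> [_ /andP[h _]]; have := coord_dist2 x; lra.
Qed.

Lemma shell_large rho r2 x : shell rho r2 x ->
  1 <= 2 * (r2 * rho ^+ 2 + kappa ^+ 2) * dist2 x.
Proof.
by move=> [_ /andP[_ h]]; have := coord_dist2_2 x; lra.
Qed.

Lemma jet_quad (c b d : R) x : exists P Y,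
  jet R N (fun x => c + b * dotR e (x - a) + d * dist2 x) x P Y.
Proof.
have j1 := jet_scale R N b _ _ _ _ (jet_lin R N e (x - a)).
have j2 := jet_scale R N d _ _ _ _ (jet_sqn R N (x - a)).
have j3 := jet_transl R N _ _ _ _ _
  (jet_add R N _ _ _ _ _ _ _ (jet_add R N _ _ _ _ _ _ _ (jet_cst R N c (x - a)) j1) j2).
by eexists; eexists; exact: j3.
Qed.

Lemma closed_quad (c b d : R) :
  closed [set x : V | 0 <= c + b * dotR e (x - a) + d * dist2 x].
Proof.
have clA : closed [set y : R | 0 <= y] by exact: closed_ge.
apply: (@closed_comp _ _ (fun x : V => c + b * dotR e (x - a) + d * dist2 x)) clA => x _.
by have [P [Y j]] := jet_quad c b d x; exact: (jet_cont R N _ _ _ _ j).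
Qed.

Lemma shell_compact rho r2 : 2 * kappa ^+ 2 < rho ^+ 2 -> compact (shell rho r2).
Proof.
move=> kr; pose q := rho ^+ 2 - 2 * kappa ^+ 2.
have q0 : 0 < q by rewrite subr_gt0.
apply: bounded_closed_compact.
  exists (2 / q + 1 + `|a|); split; first by rewrite num_real.
  move=> B KB x /= xK; have hs := shell_small _ _ _ xK.
  have := ler_normD (x - a) a; rewrite subrK.
  have n1 := norm_le_enorm R N (x - a).
  have : enorm (x - a) <= 2 / q + 1.
    have : dist2 x <= 2 / q by rewrite ler_pdivlMr // mulrC.
    rewrite -enorm_sqr; have := enorm_ge0 R N (x - a); nra.
  lra.
have -> : shell rho r2 = closure O `&`
  [set x | 0 <= 1 + 2 * kappa * dotR e (x - a) + (kappa ^+ 2 - rho ^+ 2) * dist2 x] `&`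
  [set x | 0 <= - 1 + (- (2 * kappa)) * dotR e (x - a) +
     (r2 * rho ^+ 2 - kappa ^+ 2) * dist2 x].
  apply/seteqP; split=> x /=.
    by move=> [Ox /andP[h1 h2]]; split; first split => //; lra.
  by move=> [[Ox h1] h2]; split => //; apply/andP; split; lra.
apply: closedI; first by apply: closedI; [exact: closed_closure|exact: closed_quad].
exact: closed_quad.
Qed.

Lemma zmap_cont rho (w : V -> R) x P Y : 0 < rho -> x != a ->
  jet R N w (Z rho x) P Y -> {for x, continuous (fun y => w (Z rho y))}.
Proof.
move=> rho0 xa jw.
have jZ b : jet R N (fun z => dotR b (Z rho z)) x (b *m zmapL R N rho (x - a))
    (zmapH R N rho (x - a) b) by exact: zmap_jet.
exact: (jet_cont R N _ _ _ _ (jet_map R N _ _ _ w x P Y jZ jw)).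
Qed.

Lemma within_max (K : set V) (w : V -> R) (x1 : V) : compact K -> K `<=` closure O `\ a ->
  (forall x, K x -> {for x, continuous w}) -> K x1 ->
  exists2 x0, K x0 & forall x, K x -> u x - w x <= u x0 - w x0.
Proof.
move=> cK KO cw Kx1.
have K0 : K !=set0 by exists x1.
have c1 : {within K, continuous u} by exact: continuous_subspaceW cu.
have c2 : {within K, continuous w}.
  by apply: continuous_in_subspaceT => x /set_mem /cw.
have c3 : {within K, continuous (fun x => u x - w x)}.
  by move=> x; exact: (continuousB (c1 x) (c2 x)).
have [c cK1 hc] := EVT_max_rV K0 cK c3.
by exists c; [exact: set_mem|move=> x Kx; apply: hc; exact: mem_set].
Qed.

Variables (r0 M : R).
Hypothesis r00 : 0 < r0.
Hypothesis geo : forall x, closure O x -> x != a -> dist2 x < r0 -> 1 <= dotR e (Z 1 x).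
Hypothesis bd : forall x, bdry O x -> x != a -> dist2 x < r0 -> u x <= M.

(** At such scales the shift [kappa *: e] is dominated and the whole shell lies within the range
    [dist2 x < r0] where [geo] and [bd] hold. *)
Definition large_scale (rho : R) := 0 < rho /\ 4 * kappa ^+ 2 + 4 / r0 <= rho ^+ 2.

Lemma large_scale_compact rho r2 : large_scale rho -> compact (shell rho r2).
Proof.
move=> [rho0 h]; apply: shell_compact.
have : 0 < 4 / r0 by rewrite divr_gt0.
have := sqr_ge0 kappa; lra.
Qed.

Lemma shell_near rho r2 x : large_scale rho -> shell rho r2 x ->
  dist2 x < r0 /\ dist2 x <= 4 / rho ^+ 2.
Proof.
move=> [rho0 h] sx; have hs := shell_small _ _ _ sx.
have xa := shell_neq _ _ _ sx; have s0 := dist2_gt0 _ xa.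
have q0 : 0 < rho ^+ 2 by rewrite exprn_gt0.
have i0 : 0 < 4 / r0 by rewrite divr_gt0.
have h2 : rho ^+ 2 * dist2 x <= 4.
  have : 2 * (2 * kappa ^+ 2) <= rho ^+ 2 by lra.
  move/(ler_wpM2r (ltW s0)); lra.
split; last by rewrite ler_pdivlMr // mulrC.
rewrite ltNge; apply/negP => rs.
have h3 : 4 / r0 * dist2 x >= 4.
  by rewrite mulrAC ler_pdivlMr // ler_pM2l.
have : (2 * kappa ^+ 2 + 4 / r0) * dist2 x <= (rho ^+ 2 - 2 * kappa ^+ 2) * dist2 x.
  by rewrite ler_wpM2r ?(ltW s0) //; lra.
rewrite mulrDl; have : 0 <= 2 * kappa ^+ 2 * dist2 x.
  by rewrite !mulr_ge0 ?sqr_ge0 ?(ltW s0).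
lra.
Qed.

Lemma shell_height rho r2 x : large_scale rho -> shell rho r2 x ->
  rho^-1 <= dotR e (Z rho x).
Proof.
move=> lr sx; have [h _] := shell_near _ _ _ lr sx.
rewrite zmap_scale dotRZr -[leLHS]mulr1 ler_pM2l ?invr_gt0 ?lr.1 //.
by apply: geo => //; [exact: sx.1|exact: shell_neq sx].
Qed.

(** If the maximum of [u - w] over the compact shell exceeds [M], it is attained neither on the two
    spheres nor on the boundary of [O], where [u <= M] and [w >= 0]; touching there contradicts
    strictness. Strictness is asked only where [w < u - M], so lower bounds on [w] become lower
    bounds on the absorption. *)
Lemma comparison (r2 rho : R) (w : V -> R) (P : V -> V) (Y : V -> 'M[R]_N) :
  large_scale rho ->
  (forall z, 0 < dotR e z -> 1 <= dotR z z <= r2 ->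
     [/\ 0 <= w z, jet R N w z (P z) (Y z) & (Y z)^T = Y z]) ->
  (forall x, closure O x -> x != a ->
     dotR (Z rho x) (Z rho x) = 1 \/ dotR (Z rho x) (Z rho x) = r2 ->
     shell rho r2 x -> u x - M <= w (Z rho x)) ->
  (forall x, O x -> x != a -> shell rho r2 x -> 0 < dotR e (Z rho x) ->
     1 <= dotR (Z rho x) (Z rho x) <= r2 -> w (Z rho x) < u x - M ->
     P (Z rho x) != 0 /\
     enorm (P (Z rho x)) ^+ (N - 2) *
       (dotR (P (Z rho x)) (P (Z rho x)) * \tr (Y (Z rho x)) +
        (N - 2)%:R * qf R N (Y (Z rho x)) (P (Z rho x))) <
     dotR (P (Z rho x)) (P (Z rho x)) * ((rho * dist2 x) ^+ N * g (u x))) ->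
  forall x, shell rho r2 x -> u x - M <= w (Z rho x).
Proof.
move=> lr hw hsph hin x1 Kx1.
have rho0 := lr.1; have ir0 : 0 < rho^-1 by rewrite invr_gt0.
have prop x : shell rho r2 x -> [/\ x != a, 0 < dotR e (Z rho x) &
    1 <= dotR (Z rho x) (Z rho x) <= r2].
  move=> sx; have xa := shell_neq _ _ _ sx; split => //.
    exact: lt_le_trans (shell_height _ _ _ lr sx).
  by apply/(shellP _ _ _ rho0 sx.1 xa).
have [x0 Kx0 hmax] : exists2 x0, shell rho r2 x0 &
    forall x, shell rho r2 x -> u x - w (Z rho x) <= u x0 - w (Z rho x0).
  apply: (within_max (shell rho r2) (fun x => w (Z rho x)) x1) => //.
  - exact: large_scale_compact.
  - by move=> x sx; split; [exact: sx.1|apply/eqP; exact: shell_neq sx].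
  - move=> x sx; have [xa z0 zz] := prop x sx.
    by have [_ jw _] := hw _ z0 zz; exact: (zmap_cont _ _ _ _ _ rho0 xa jw).
have [xa z0 zz] := prop x0 Kx0.
have [w0 jw symY] := hw _ z0 zz.
rewrite leNgt; apply/negP => contra.
have pos : w (Z rho x0) < u x0 - M by have := hmax x1 Kx1; lra.
have Ox0 : O x0.
  apply: contrapT => nO.
  have : u x0 <= M.
    apply: bd => //; last exact: (shell_near _ _ _ lr Kx0).1.
    split; first exact: Kx0.1.
    by move=> /interior_subset.
  lra.
have [P0 strict] := hin x0 Ox0 xa Kx0 z0 zz pos.
have [zz1 zz2] : 1 < dotR (Z rho x0) (Z rho x0) /\ dotR (Z rho x0) (Z rho x0) < r2.
  move/andP: (zz) => [a1 a2]; rewrite !lt_neqAle a1 a2 !andbT; split.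
    apply/negP => /eqP h.
    by have := hsph x0 Kx0.1 xa (or_introl (esym h)) Kx0; lra.
  apply/negP => /eqP h.
  by have := hsph x0 Kx0.1 xa (or_intror h) Kx0; lra.
(* The maximum point is interior to the shell, so the maximum over the shell is a local one. *)
have nearK : \near x0, shell rho r2 x0.
  have [P' [Y' jq]] : exists P' Y', jet R N (fun z => dotR z z) (Z rho x0) P' Y'.
    by eexists; eexists; exact: jet_sqn.
  have cq := zmap_cont rho _ _ _ _ rho0 xa jq.
  have n1 : \forall y \near x0, 1 < dotR (Z rho y) (Z rho y).
    by apply: (cq [set t | 1 < t]); exact: lt_nbhsr.
  have n2 : \forall y \near x0, dotR (Z rho y) (Z rho y) < r2.
    by apply: (cq [set t | t < r2]); exact: lt_nbhsl.
  have n3 : \forall y \near x0, O y by exact: open_nbhs_nbhs.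
  have n4 : \forall y \near x0, y != a.
      have : 0 < `|x0 - a| by rewrite normr_gt0 subr_eq0.
    move/(near_norm_gt R N a x0 0); apply: filterS => y.
    by rewrite normr_gt0 subr_eq0.
  near=> y; have Oy : closure O y by apply: subset_closure; near: y.
  have ya : y != a by near: y.
  apply/(shellP _ _ _ rho0 Oy ya); apply/andP; split; apply: ltW; near: y => //.
have /nbhs_ballP [d /= d0 hd] := nearK.
have := touch_zmap R N O g u a e x0 (P (Z rho x0)) (Y (Z rho x0)) kappa rho w N2
  openO weak_u du cdu cg rho0 symY Ox0 xa P0 jw.
suff hyp : exists2 d : R, 0 < d & forall x, `|x - x0| < d ->
    u x - w (Z rho x) <= u x0 - w (Z rho x0) by move=> /(_ hyp); lra.
exists d => // x xd; apply: hmax; apply: hd.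
by rewrite -ball_normE /= distrC.
Unshelve. all: by end_near.
Qed.

End Comparison.

(** * Barriers *)

Section Barriers.
Variables (R : realType) (N : nat).
Notation V := 'rV[R]_N.
Hypothesis N2 : (2 <= N)%N.

(* [|P|^(4-N)] times the N-Laplacian of a function with gradient [P] and
   Hessian [Y] *)
Definition nlap (P : V) (Y : 'M[R]_N) : R :=
  dotR P P * \tr Y + (N - 2)%:R * qf R N Y P.

Lemma natN : N%:R = (N - 2)%:R + 2 :> R.
Proof. by rewrite natrB // subrK. Qed.

Lemma natN_ge2 : 2 <= N%:R :> R.
Proof. by rewrite ler_nat. Qed.

Lemma qf_outer (b z p : V) : qf R N (b^T *m z) p = dotR b p * dotR z p.
Proof. by rewrite /qf mul_outer dotRZl (dotRC R N p). Qed.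

(** Splits each barrier check into a bound of [nlap] relative to [|P|^2] and a bound on the size of
    the gradient. *)
Lemma nlap_lt (P : V) Y (B F : R) : P != 0 -> nlap P Y <= B * dotR P P ->
  enorm P ^+ (N - 2) * B < F -> enorm P ^+ (N - 2) * nlap P Y < dotR P P * F.
Proof.
move=> P0 h1 h2; have q0 := dotR_gt0 R N _ P0.
have e0 : 0 <= enorm P ^+ (N - 2) by rewrite exprn_ge0 ?enorm_ge0.
apply: le_lt_trans (ler_wpM2l e0 h1) _.
by rewrite mulrA mulrC ltr_pM2l.
Qed.

Lemma nlap_comp (h1 h2 : R) (p : V) Y :
  nlap (h1 *: p) (h1 *: Y + h2 *: (p^T *m p)) =
  h1 ^+ 3 * nlap p Y + h1 ^+ 2 * h2 * (N%:R - 1) * dotR p p ^+ 2.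
Proof.
rewrite /nlap natN mxtraceD !mxtraceZ tr_outer qf_addM !qf_scaleM qf_outer !qfZ.
rewrite !dotE; ring.
Qed.

Lemma nlap_scale (h1 : R) (p : V) Y : nlap (h1 *: p) (h1 *: Y) = h1 ^+ 3 * nlap p Y.
Proof. by have := nlap_comp h1 0 p Y; rewrite scale0r addr0 mulr0 !mul0r addr0. Qed.

Lemma enorm_bound (z : V) (r : R) : 0 <= r -> dotR z z <= r ^+ 2 -> enorm z <= r.
Proof.
by move=> r0; rewrite -enorm_sqr ler_pXn2r ?nnegrE ?enorm_ge0.
Qed.

Lemma coord_bound (b z : V) (r : R) : dotR b b = 1 -> 0 <= r -> dotR z z <= r ^+ 2 ->
  - r <= dotR b z <= r.
Proof.
move=> bb r0 zr; have := cauchy_schwarz_abs R N b z.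
have -> : enorm b = 1 by rewrite /enorm bb sqrtr1.
rewrite mul1r => h; rewrite -ler_norml; apply: le_trans h _; exact: enorm_bound.
Qed.

(* the first term vanishes on the spheres [|z| = 1] and [|z| = 4] bounding the
   shell and equals [36] on [|z| = 2] *)
Definition bump (f : V) (eta c : R) (z : V) : R :=
  (dotR z z - 1) * (16 - dotR z z) + eta * dotR f z + c.
Definition bumpP (f : V) (eta : R) (z : V) : V :=
  (2 * (17 - 2 * dotR z z)) *: z + eta *: f.
Definition bumpY (z : V) : 'M[R]_N :=
  (2 * (17 - 2 * dotR z z))%:M - 8 *: (z^T *m z).

Lemma bump_jet f (eta c : R) z : jet R N (bump f eta c) z (bumpP f eta z) (bumpY z).
Proof.
have j1 := jet_sqn R N z.
have j2 := jet_comp R N _ _ _ _ _ _ _ j1 (jet1_sq R (dotR z z)).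
have j3 := jet_scale R N eta _ _ _ _ (jet_lin R N f z).
have j4 := jet_add R N _ _ _ _ _ _ _ (jet_scale R N 17 _ _ _ _ j1)
  (jet_scale R N (-1) _ _ _ _ j2).
have j5 := jet_add R N _ _ _ _ _ _ _ (jet_add R N _ _ _ _ _ _ _ j4 j3)
  (jet_cst R N (c - 16) z).
apply: (jet_ext R N _ _ _ _ _ _ (jet_eq R N _ _ _ _ _ _ j5 _ _)) => [y||].
- by rewrite /bump; ring.
- by rewrite /bumpP; apply/rowP => i; rewrite !mxE; ring.
- apply/matrixP => i j; rewrite /bumpY !mxE !big_ord1 !mxE.
  by case: (i == j); rewrite ?mulr1n ?mulr0n; ring.
Qed.

Lemma bump_trace z : \tr (bumpY z) = 2 * (17 - 2 * dotR z z) * N%:R - 8 * dotR z z.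
Proof. by rewrite /bumpY raddfB /= mxtraceZ tr_outer mxtrace_scalar -[_ *+ N]mulr_natr. Qed.

Lemma bump_qf z p : qf R N (bumpY z) p =
  2 * (17 - 2 * dotR z z) * dotR p p - 8 * dotR z p ^+ 2.
Proof. by rewrite /bumpY qf_addM qf_oppM qf_scaleM qf_scalar qf_outer expr2. Qed.

Lemma dotR_sqr_le (z p : V) : dotR z p ^+ 2 <= dotR z z * dotR p p.
Proof.
rewrite -!enorm_sqr -exprMn -[_ ^+ 2]ger0_norm ?sqr_ge0 // normrX.
by rewrite ler_pXn2r ?nnegrE ?mulr_ge0 ?enorm_ge0 // cauchy_schwarz_abs.
Qed.

Lemma bump_nlap_ge z p : 1 <= dotR z z <= 16 ->
  - nlap p (bumpY z) <= 188 * N%:R * dotR p p.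
Proof.
move=> /andP[z1 z16]; rewrite /nlap bump_trace bump_qf.
have cs := dotR_sqr_le z p; have p0 := dotR_ge0 R N p.
have n0 : 0 <= ((N - 2)%:R : R) by [].
rewrite natN; move: cs p0 n0 z1 z16.
set s := dotR z z; set q := dotR p p; set x := dotR z p ^+ 2; set n := (N - 2)%:R.
move=> cs q0 n0 s1 s16.
have hs : x <= 16 * q by apply: le_trans cs _; rewrite ler_wpM2r.
have a1 : n * x <= n * (16 * q) by rewrite ler_wpM2l.
have nq : 0 <= n * q by rewrite mulr_ge0.
have sq : s * q <= 16 * q by rewrite ler_wpM2r.
have sn : s * (n * q) <= 16 * (n * q) by rewrite ler_wpM2r.
(* With [s <= 16] and [x <= 16 * q] the coefficients add up to [188 * (n + 1)]: -68 + 128 + 128 for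
   [n * q], and -68 + 256 for [q]. *)
have -> : - (q * (2 * (17 - 2 * s) * (n + 2) - 8 * s) +
   n * (2 * (17 - 2 * s) * q - 8 * x)) =
  - 68 * (n * q) - 68 * q + 8 * (s * (n * q)) + 16 * (s * q) + 8 * (n * x) by ring.
nra.
Qed.

Variables (e f : V).
Hypotheses (ee : dotR e e = 1) (ff : dotR f f = 1) (ef : dotR e f = 0).

(** The role of the tilt along [f]: the radial part of the gradient vanishes on an intermediate
    sphere, where the component [eta] along [f], orthogonal to [e], remains. *)
Lemma bumpP_neq0 (eta : R) z : eta != 0 -> 0 < dotR e z -> bumpP f eta z != 0.
Proof.
move=> eta0 z0; apply/negP => /eqP h.
have h1 : dotR e (bumpP f eta z) = 0 by rewrite h dotR0r.
have h2 : dotR f (bumpP f eta z) = 0 by rewrite h dotR0r.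
move: h1 h2; rewrite /bumpP !dotE ef ff mulr0 addr0 mulr1.
move=> /eqP; rewrite mulf_eq0 (gt_eqF z0) orbF => /eqP ->.
by rewrite mul0r add0r => /eqP; rewrite (negbTE eta0).
Qed.

Lemma bumpP_le (eta : R) z : `|eta| <= 1 -> 1 <= dotR z z <= 16 ->
  enorm (bumpP f eta z) <= 121.
Proof.
move=> eta1 /andP[z1 z16]; apply: le_trans (enorm_triangle _ _ _ _) _.
rewrite !enormZ; have -> : enorm f = 1 by rewrite /enorm ff sqrtr1.
have h4 : enorm z <= 4 by apply: enorm_bound => //; lra.
have h30 : `|2 * (17 - 2 * dotR z z)| <= 30 by rewrite ler_norml; apply/andP; split; lra.
have := ler_pM (normr_ge0 _) (enorm_ge0 R N z) h30 h4; lra.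
Qed.

(** The required forcing is of order [A^(N-1) psi^-(2N-1)], while absorption at the height [A / psi]
    is of order [A^(2N-1) psi^-(2N-1)]. The powers of [psi] agree, so a large [A] suffices for every
    [eta], although the barrier is of size [A / eta] on the bounding spheres. *)
Lemma inv_bump_super (A eta F : R) z :
  0 < A -> 0 < eta <= 1 -> 1 <= dotR z z <= 16 -> 0 < dotR e z ->
  let psi := bump f eta (5 * eta) z in
  let P := (A * - psi ^- 2) *: bumpP f eta z in
  let Y := A *: ((- psi ^- 2) *: bumpY z +
      (2 * psi ^- 3) *: ((bumpP f eta z)^T *m bumpP f eta z)) in
  300 * 300 * N%:R * 121 ^+ (N - 2) * (A ^+ (N - 1) * psi^-1 ^+ (2 * N - 1)) < F ->
  [/\ jet R N (fun z => A * (bump f eta (5 * eta) z)^-1) z P Y, Y^T = Y,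
   P != 0 & enorm P ^+ (N - 2) * nlap P Y < dotR P P * F].
Proof.
move=> A0 /andP[eta0 eta1] zz z0 psi P Y hF.
have zz' := zz; move/andP: zz' => [z1 z16].
have zb : - 4 <= dotR f z <= 4 by apply: coord_bound => //; lra.
have psi0 : 0 < psi.
  rewrite /psi /bump; move/andP: zb => [zb1 zb2].
  have : 0 <= (dotR z z - 1) * (16 - dotR z z) by rewrite mulr_ge0 // subr_ge0.
  have : eta * (-4) <= eta * dotR f z by rewrite ler_wpM2l // ltW.
  lra.
(* The product [(s - 1) (16 - s)] is at most 56.25, at [s = 17 / 2], and the remaining terms are at
   most [9 * eta <= 9]. *)
have psi66 : psi <= 66.
  rewrite /psi /bump; move/andP: zb => [zb1 zb2].
  have := sqr_ge0 (dotR z z - 17 / 2).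
  nra.
have p0 : bumpP f eta z != 0 by apply: bumpP_neq0; rewrite ?gt_eqF.
have P0 : P != 0.
  by rewrite scaler_eq0 negb_or p0 andbT mulf_neq0 ?oppr_eq0 ?invr_eq0 ?expf_neq0 // gt_eqF.
have j : jet R N (fun z => A * (bump f eta (5 * eta) z)^-1) z P Y.
  have j1 := jet_comp R N _ _ _ _ _ _ _ (bump_jet f eta (5 * eta) z)
    (jet1_inv R _ (lt0r_neq0 psi0)).
  apply: (jet_eq R N _ _ _ _ _ _ (jet_scale R N A _ _ _ _ j1)) => //.
  by rewrite scalerA.
split => //.
  by rewrite /Y; apply/matrixP => m n; rewrite /bumpY !mxE !big_ord1 !mxE [n == m]eq_sym; ring.
set p := bumpP f eta z in P Y P0 p0 j *.
set i := psi^-1 in hF *.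
have i0 : 0 < i by rewrite invr_gt0.
have pe : enorm p <= 121 by apply: bumpP_le => //; rewrite ger0_norm // ltW.
have q0 := dotR_gt0 R N _ p0.
have PP : dotR P P = A ^+ 2 * i ^+ 4 * dotR p p.
  by rewrite /P !dotE -exprVn -/i; ring.
have eP : enorm P = A * i ^+ 2 * enorm p.
  rewrite /P enormZ normrM normrN -exprVn -/i (gtr0_norm A0).
  by rewrite ger0_norm // sqr_ge0.
have nl : nlap P Y = A ^+ 3 * i ^+ 7 * (psi * - nlap p (bumpY z) +
    2 * (N%:R - 1) * dotR p p ^+ 2).
  have -> : P = (- (A * i ^+ 2)) *: p by rewrite /P -exprVn -/i mulrN.
  have -> : Y = (- (A * i ^+ 2)) *: bumpY z + (2 * A * i ^+ 3) *: (p^T *m p).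
    rewrite /Y -!exprVn -/i scalerDr !scalerA; congr (_ *: _ + _ *: _); ring.
  rewrite nlap_comp.
  have -> : i ^+ 7 = i ^+ 6 * i by rewrite -exprSr.
  have := divff (lt0r_neq0 psi0); rewrite -/i => ip.
  have -> : A ^+ 3 * (i ^+ 6 * i) * (psi * - nlap p (bumpY z) +
    2 * (N%:R - 1) * dotR p p ^+ 2) = A ^+ 3 * i ^+ 6 * ((psi * i) * - nlap p (bumpY z) +
    i * 2 * (N%:R - 1) * dotR p p ^+ 2) by ring.
  by rewrite ip; ring.
(* The constant dominates [66 * 188 + 2 * 121 ^+ 2], from the bounds on [psi], on [nlap] of the bump
   and on its gradient. *)
apply: (nlap_lt _ _ (A * i ^+ 3 * (300 * 300 * N%:R))) => //.
  rewrite nl PP.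
  have -> : A * i ^+ 3 * (300 * 300 * N%:R) * (A ^+ 2 * i ^+ 4 * dotR p p) =
    A ^+ 3 * i ^+ 7 * (300 * 300 * N%:R * dotR p p) by ring.
  rewrite ler_wpM2l ?mulr_ge0 ?exprn_ge0 ?(ltW A0) ?(ltW i0) //.
  have b1 : psi * - nlap p (bumpY z) <= 66 * (188 * N%:R * dotR p p).
    apply: (@le_trans _ _ (psi * (188 * N%:R * dotR p p))).
      by rewrite ler_wpM2l ?(ltW psi0) // bump_nlap_ge.
    have c0 : 0 <= 188 * N%:R :> R by exact: mulr_ge0 (ler0n _ _) (ler0n _ _).
    by rewrite ler_wpM2r // mulr_ge0 ?(ltW q0).
  have b2 : dotR p p <= 121 ^+ 2.
    by rewrite -enorm_sqr; have := enorm_ge0 R N p; nra.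
  have N2' := natN_ge2.
  have b3 : dotR p p ^+ 2 <= 121 ^+ 2 * dotR p p.
    by rewrite expr2 ler_wpM2r // ltW.
  have b4 : (N%:R - 1) * dotR p p ^+ 2 <= N%:R * (121 ^+ 2 * dotR p p).
    by apply: ler_pM => //; [lra|exact: sqr_ge0|lra].
  have : 0 <= N%:R * dotR p p by rewrite mulr_ge0 // ltW.
  lra.
apply: le_lt_trans hF; rewrite eP [(A * i ^+ 2 * _) ^+ _]exprMn [(A * i ^+ 2) ^+ _]exprMn.
have -> : (N - 1 = (N - 2).+1)%N by rewrite -subSn.
have -> : (2 * N - 1 = 2 * (N - 2) + 3)%N.
  by rewrite -[in LHS](subnK N2) mulnDr -addnBA.
rewrite [A ^+ _.+1]exprS exprD [i ^+ (2 * _)]exprM.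
have -> : A ^+ (N - 2) * i ^+ 2 ^+ (N - 2) * enorm p ^+ (N - 2) *
    (A * i ^+ 3 * (300 * 300 * N%:R)) = (300 * 300 * N%:R * enorm p ^+ (N - 2)) *
   (A * A ^+ (N - 2) * (i ^+ 2 ^+ (N - 2) * i ^+ 3)) by ring.
rewrite ler_wpM2r ?mulr_ge0 ?exprn_ge0 ?(ltW A0) ?(ltW i0) //.
have c0 : 0 <= 300 * 300 * N%:R :> R.
  exact: mulr_ge0 (mulr_ge0 (ler0n _ _) (ler0n _ _)) (ler0n _ _).
apply: (ler_wpM2l c0); apply: lerXn2r pe; rewrite nnegrE ?enorm_ge0 //.
Qed.

(* [linD] makes [linW] a strict supersolution; [linB >= 8 linD] keeps it
   increasing in the direction [e] *)
Definition linB : R := 896 * N%:R + 64.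
Definition linD : R := 112 * N%:R.
(** The square keeps the function at least 1 on the bounding spheres and vanishes on [|z| = 2],
    where only terms vanishing with [e . z] are left. *)
Definition linW (z : V) : R :=
  (dotR z z - 4) ^+ 2 + linB * dotR e z - linD * dotR e z ^+ 2.
Definition linP (z : V) : V :=
  (4 * (dotR z z - 4)) *: z + (linB - 2 * linD * dotR e z) *: e.
Definition linY (z : V) : 'M[R]_N :=
  (4 * (dotR z z - 4))%:M + 8 *: (z^T *m z) - (2 * linD) *: (e^T *m e).

Lemma lin_jet z : jet R N linW z (linP z) (linY z).
Proof.
have j1 := jet_sqn R N z.
have j2 := jet_comp R N _ _ _ _ _ _ _
  (jet_add R N _ _ _ _ _ _ _ j1 (jet_cst R N (-4) z)) (jet1_sq R _).
have j3 := jet_lin R N e z.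
have j4 := jet_comp R N _ _ _ _ _ _ _ j3 (jet1_sq R _).
have j5 := jet_add R N _ _ _ _ _ _ _ (jet_add R N _ _ _ _ _ _ _ j2
  (jet_scale R N linB _ _ _ _ j3)) (jet_scale R N (- linD) _ _ _ _ j4).
apply: (jet_ext R N _ _ _ _ _ _ (jet_eq R N _ _ _ _ _ _ j5 _ _)) => [y||].
- by rewrite /linW; ring.
- by rewrite /linP; apply/rowP => i; rewrite !mxE; ring.
- apply/matrixP => i j; rewrite /linY !mxE !big_ord1 !mxE.
  by case: (i == j); rewrite ?mulr1n ?mulr0n; ring.
Qed.

(** Supersolution with a margin: the N-Laplacian is negative enough to tolerate a negative forcing
    above [- L ^+ (N - 1)], which serves when the sign of [g] is unknown. *)
Lemma lin_super (L F : R) z : 0 < L -> 1 <= dotR z z <= 16 -> 0 < dotR e z ->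
  - L ^+ (N - 1) < F ->
  [/\ jet R N (fun z => L * linW z) z (L *: linP z) (L *: linY z),
   (L *: linY z)^T = L *: linY z, L *: linP z != 0 &
   enorm (L *: linP z) ^+ (N - 2) * nlap (L *: linP z) (L *: linY z) <
   dotR (L *: linP z) (L *: linP z) * F].
Proof.
move=> L0 zz z0 hF; have zz' := zz; move/andP: zz' => [z1 z16].
have N2' := natN_ge2.
have zb : - 4 <= dotR e z <= 4 by apply: coord_bound => //; lra.
move/andP: zb => [zb1 zb2].
have zsq : dotR e z ^+ 2 <= dotR z z by have := dotR_sqr_le e z; rewrite ee mul1r.
have eP : 1 <= dotR e (linP z).
  rewrite /linP !dotE ee mulr1 /linB /linD.
  (* The radial part contributes at least -48 to the [e]-component, against
     [linB - 8 * linD = 64]. *)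
  have : - 12 <= (dotR z z - 4) * dotR e z by nra.
  have : N%:R * dotR e z <= N%:R * 4 by rewrite ler_wpM2l //; lra.
  lra.
have P1 : 1 <= enorm (linP z).
  apply: le_trans eP _; apply: le_trans (cauchy_schwarz _ _ _ _) _.
  by rewrite {1}/enorm ee sqrtr1 mul1r.
have P0 : linP z != 0.
  by apply/negP => /eqP h; move: eP; rewrite h dotR0r ler10.
have LP0 : L *: linP z != 0 by rewrite scaler_eq0 negb_or P0 gt_eqF.
split => //.
- exact: jet_scale (lin_jet z).
- by apply/matrixP => i j; rewrite !mxE !big_ord1 !mxE [j == i]eq_sym; ring.
apply: (nlap_lt _ _ (- L)) => //.
  rewrite nlap_scale dotRZl dotRZr.
  have -> : - L * (L * (L * dotR (linP z) (linP z))) =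
     L ^+ 3 * - dotR (linP z) (linP z) by ring.
  rewrite ler_wpM2l ?exprn_ge0 ?(ltW L0) //.
  rewrite /nlap /linY mxtraceD raddfN /= mxtraceD !mxtraceZ !tr_outer mxtrace_scalar.
  rewrite -[_ *+ N]mulr_natr ee qf_addM qf_oppM qf_addM !qf_scaleM qf_scalar !qf_outer.
  have cs := dotR_sqr_le z (linP z).
  move: (dotR_gt0 R N _ P0) cs; set q := dotR _ _; set x := dotR z (linP z).
  set y := dotR e (linP z); move=> q0 cs.
  have hs : x ^+ 2 <= 16 * q by apply: le_trans cs _; rewrite ler_wpM2r // ltW.
  rewrite /linD natN -!expr2; have n0 : 0 <= ((N - 2)%:R : R) by [].
  move: n0 hs; set n := (N - 2)%:R; set s := dotR z z in z1 z16 *; move=> n0 hs.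
  have a1 : n * x ^+ 2 <= n * (16 * q) by rewrite ler_wpM2l.
  have nq : 0 <= n * q by rewrite mulr_ge0 // ltW.
  have a2 : s * q <= 16 * q by rewrite ler_wpM2r // ltW.
  have a3 : s * (n * q) <= 16 * (n * q) by rewrite ler_wpM2r.
  have a4 : 0 <= n * (2 * (112 * (n + 2)) * y ^+ 2).
    by rewrite mulr_ge0 // mulr_ge0 ?sqr_ge0 //; lra.
  (* At the extreme values 16 the [n * q] terms are 128 - 32 + 128 - 224 = 0, which fixes the
     constant 112; the coefficient of [q] is then 256 - 32 - 448 = -224. *)
  have -> : q * (4 * (s - 4) * (n + 2) + 8 * s - 2 * (112 * (n + 2)) * 1) +
    n * (4 * (s - 4) * q + 8 * x ^+ 2 - 2 * (112 * (n + 2)) * y ^+ 2) =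
    8 * (s * (n * q)) - 32 * (n * q) + 16 * (s * q) - 32 * q - 224 * (n * q) - 448 * q
    + 8 * (n * x ^+ 2) - n * (2 * (112 * (n + 2)) * y ^+ 2) by ring.
  lra.
apply: le_lt_trans hF; rewrite mulrN lerN2 enormZ (gtr0_norm L0) exprMn.
have -> : (N - 1 = (N - 2).+1)%N by rewrite -subSn.
rewrite exprSr ler_pM2r // -[leLHS]mulr1.
by rewrite ler_wpM2l ?exprn_ge0 ?(ltW L0) // exprn_ege1.
Qed.

Lemma linW_ge0 z : dotR z z <= 16 -> 0 <= dotR e z -> 0 <= linW z.
Proof.
move=> z16 z0; have := coord_bound e z 4 ee ltac:(lra) ltac:(lra) => /andP[_ z4].
have N2' := natN_ge2; rewrite /linW /linB /linD.
have : N%:R * dotR e z * dotR e z <= N%:R * dotR e z * 4 by rewrite ler_wpM2l ?mulr_ge0.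
have : 0 <= N%:R * dotR e z by rewrite mulr_ge0.
have := sqr_ge0 (dotR z z - 4); lra.
Qed.

Lemma linW_sphere z : 0 <= dotR e z -> dotR z z = 1 \/ dotR z z = 16 -> 1 <= linW z.
Proof.
move=> z0 zz.
have z16 : dotR z z <= 16 by case: zz => ->; lra.
have := coord_bound e z 4 ee ltac:(lra) ltac:(lra) => /andP[_ z4].
have N2' := natN_ge2; rewrite /linW /linB /linD.
have : N%:R * dotR e z * dotR e z <= N%:R * dotR e z * 4 by rewrite ler_wpM2l ?mulr_ge0.
have : 0 <= N%:R * dotR e z by rewrite mulr_ge0.
have : 1 <= (dotR z z - 4) ^+ 2 by case: zz => ->; lra.
lra.
Qed.

Lemma linW_mid z : dotR z z = 4 -> linW z <= linB * dotR e z.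
Proof.
move=> zz; rewrite /linW zz subrr expr0n /= add0r lerBlDr lerDl.
by rewrite mulr_ge0 ?sqr_ge0 // /linD mulr_ge0.
Qed.

(* [critW] is above [K (e . z)] on the spheres [|z| = 1] and [|z| = 4] but below
   [(K - 32 tau) (e . z)] on [|z| = 2]; the concave term [- tau (e . z)^2] makes
   it a supersolution near the boundary, where the absorption is too weak *)
Definition critW (K tau : R) (z : V) : R := K * dotR e z - tau * (dotR e z * bump e 1 (-4) z).
Definition critP (K tau : R) (z : V) : V :=
  K *: e - tau *: (dotR e z *: bumpP e 1 z + bump e 1 (-4) z *: e).
Definition critY (tau : R) (z : V) : 'M[R]_N :=
  - (tau *: (dotR e z *: bumpY z + (e^T *m bumpP e 1 z + (bumpP e 1 z)^T *m e))).

Lemma crit_jet K tau z : jet R N (critW K tau) z (critP K tau z) (critY tau z).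
Proof.
have j1 := jet_lin R N e z.
have j2 := jet_mul R N _ _ _ _ _ _ _ j1 (bump_jet e 1 (-4) z).
have j3 := jet_add R N _ _ _ _ _ _ _ (jet_scale R N K _ _ _ _ j1)
  (jet_scale R N (- tau) _ _ _ _ j2).
apply: (jet_ext R N _ _ _ _ _ _ (jet_eq R N _ _ _ _ _ _ j3 _ _)) => [y||].
- by rewrite /critW mulNr.
- by rewrite /critP scaleNr.
- by rewrite /critY scaler0 add0r scaler0 addr0 scaleNr.
Qed.

Lemma bump_e_bound z : 1 <= dotR z z <= 16 -> 0 <= dotR e z -> -4 <= bump e 1 (-4) z <= 57.
Proof.
move=> /andP[z1 z16] z0.
have := coord_bound e z 4 ee ltac:(lra) ltac:(lra) => /andP[_ z4].
rewrite /bump; set s := dotR z z in z1 z16 *.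
have : 0 <= (s - 1) * (16 - s) by rewrite mulr_ge0 // subr_ge0.
have := sqr_ge0 (s - 17 / 2).
by move=> *; apply/andP; split; lra.
Qed.

(** Here [t = e . z], [E = |P|], [x = z . P] and [y = e . P]. The constant 2 comes from
    differentiating both factors of [(e . z) * bump]; every other term of indefinite sign carries a
    factor [t], so the bound is negative near the boundary. *)
Lemma crit_arith (k s t n E x y : R) : -30 <= k <= 30 -> 1 <= s <= 16 -> 0 <= t ->
  0 <= n -> 0 <= E -> `|x| <= 8 * t * E -> x ^+ 2 <= 16 * E ^+ 2 -> `|y| <= E ->
  - (E ^+ 2 * (t * (k * (n + 2) - 8 * s) + 2 * k * t + 2) +
     n * (t * (k * E ^+ 2 - 8 * x ^+ 2) + 2 * y * (k * x + y))) <=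
  (20 * 35 * (n + 2) * t - 2) * E ^+ 2.
Proof.
move=> /andP[k1 k2] /andP[s1 s16] t0 n0 E0 hx hx2 hy.
have m0 : 0 <= t * E ^+ 2 by rewrite mulr_ge0 ?sqr_ge0.
have nm0 : 0 <= n * (t * E ^+ 2) by rewrite mulr_ge0.
have a1 : -30 * (t * E ^+ 2) <= k * (t * E ^+ 2) by rewrite ler_wpM2r.
have a2 : -30 * (n * (t * E ^+ 2)) <= k * (n * (t * E ^+ 2)) by rewrite ler_wpM2r.
have a3 : s * (t * E ^+ 2) <= 16 * (t * E ^+ 2) by rewrite ler_wpM2r.
have a4 : n * (t * x ^+ 2) <= n * (t * (16 * E ^+ 2)) by rewrite !ler_wpM2l.
have a5 : `|k * y * x| <= 30 * (E * (8 * t * E)).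
  rewrite -mulrA !normrM; apply: ler_pM; rewrite ?mulr_ge0 //.
    by rewrite ler_norml; apply/andP.
  exact: ler_pM.
have a6 : - (k * y * x) <= 30 * (E * (8 * t * E)).
  by apply: le_trans a5; rewrite -normrN ler_norm.
have a7 : n * - (k * y * x) <= n * (30 * (E * (8 * t * E))) by rewrite ler_wpM2l.
have a8 : 0 <= n * y ^+ 2 by rewrite mulr_ge0 ?sqr_ge0.
move: a1 a2 a3 a4 a7 a8 m0 nm0; clear; lra.
Qed.

(** * The barrier for the critical exponent *)

Section Critical.
Variables (r K tau : R) (z : V).
Hypotheses (r0 : 0 < r) (tau0 : 0 < tau) (tK : 30 * 30 * tau <= K).
Hypotheses (zz : 1 <= dotR z z <= 16) (z0 : 0 < dotR e z).
Let P := critP K tau z.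
Let p := bumpP e 1 z.
Let b := bump e 1 (-4) z.
Let s := dotR z z.
Let t := dotR e z.
Let k : R := 2 * (17 - 2 * s).

Let e1 : enorm e = 1. Proof. by rewrite /enorm ee sqrtr1. Qed.

Lemma crit_ep : dotR e p = k * t + 1.
Proof. by rewrite /p /bumpP !dotE ee /k /s /t; ring. Qed.

Lemma crit_zp : dotR z p = k * s + t.
Proof. by rewrite /p /bumpP !dotE (dotRC R N z e) /k /s /t; ring. Qed.

Lemma crit_eP : dotR e P = K - tau * (t * dotR e p + b).
Proof. by rewrite /P /critP -/p -/b !dotE ee /t; ring. Qed.

Lemma crit_zP : dotR z P = t * (K - tau * (dotR z p + b)).
Proof. by rewrite /P /critP -/p -/b !dotE (dotRC R N z e) /t; ring. Qed.

Lemma crit_pP : dotR p P = k * dotR z P + dotR e P.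
Proof. by rewrite {1}/p /bumpP dotRDl !dotRZl mul1r. Qed.

Lemma crit_k : -30 <= k <= 30.
Proof. by move/andP: zz => [z1 z16]; rewrite /k /s; apply/andP; split; lra. Qed.

Lemma crit_t : t <= 4.
Proof. by move/andP: zz => [z1 z16]; have := coord_bound e z 4 ee ltac:(lra) ltac:(lra) => /andP[_]. Qed.

Lemma crit_kle (x y : R) : 0 <= x -> x <= y -> - (30 * y) <= k * x <= 30 * y.
Proof. by move=> x0 xy; have /andP[k1 k2] := crit_k; move: x0 xy k1 k2; nra. Qed.

Lemma crit_b : -4 <= b <= 57.
Proof. exact: bump_e_bound (ltW z0). Qed.

Lemma crit_tep : - (20 * 26) <= t * dotR e p <= 20 * 26.
Proof.
have t4 := crit_t; have /andP[h1 h2] := crit_kle t 4 (ltW z0) t4.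
rewrite crit_ep; move: h1 h2 t4 z0; rewrite -/t; set x := k * t; nra.
Qed.

Lemma crit_zpb : - (20 * 26) <= dotR z p <= 20 * 26.
Proof.
have t4 := crit_t; move/andP: zz => [z1 z16].
have /andP[h1 h2] := crit_kle s 16 ltac:(rewrite /s; lra) z16.
rewrite crit_zp; move: h1 h2 t4 z0; rewrite -/t; set x := k * s; move=> *.
by apply/andP; split; lra.
Qed.

(** Since [520 + 57 <= 600] and [900 * tau <= K], the perturbation changes the slope [K] by at most
    two thirds; this keeps the gradient comparable to [K]. *)
Lemma crit_tau_bound (x : R) : - (20 * 26) <= x <= 20 * 26 ->
  - (K * (2 / 3)) <= tau * (x + b) <= K * (2 / 3).
Proof.
move=> /andP[x1 x2]; have /andP[b1 b2] := crit_b.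
have tK' := tK.
have h1 : tau * (x + b) <= tau * (20 * 30) by rewrite ler_wpM2l ?(ltW tau0) //; lra.
have h2 : tau * - (20 * 30) <= tau * (x + b) by rewrite ler_wpM2l ?(ltW tau0) //; lra.
by apply/andP; split; lra.
Qed.

Lemma crit_K0 : 0 < K.
Proof. by move: tau0 tK; lra. Qed.

Lemma crit_eP_ge : K / 3 <= dotR e P.
Proof.
by rewrite crit_eP; have /andP[_] := crit_tau_bound _ crit_tep; lra.
Qed.

Lemma crit_P_ge : K / 3 <= enorm P.
Proof.
apply: le_trans crit_eP_ge _; apply: le_trans (cauchy_schwarz _ _ _ _) _.
by rewrite e1 mul1r.
Qed.

Lemma crit_P0 : P != 0.
Proof.
apply/negP => /eqP h; have := crit_eP_ge; rewrite h dotR0r; have := crit_K0; lra.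
Qed.

Lemma crit_P_le : enorm P <= 2 * K.
Proof.
have t4 := crit_t; have /andP[b1 b2] := crit_b.
rewrite /P /critP -/p -/b -/t -scaleN1r; apply: le_trans (enorm_triangle _ _ _ _) _.
rewrite !enormZ e1 normrN1 mul1r mulr1 (gtr0_norm crit_K0) (gtr0_norm tau0).
have h1 : enorm (t *: p + b *: e) <= 20 * 30.
  apply: le_trans (enorm_triangle _ _ _ _) _.
  rewrite !enormZ e1 mulr1 (gtr0_norm z0).
  have hp : enorm p <= 121.
    apply: le_trans (enorm_triangle _ _ _ _) _; rewrite !enormZ e1 normr1.
    have h4 : enorm z <= 4 by apply: enorm_bound => //; move/andP: zz => [_]; lra.
    have h30 : `|k| <= 30 by rewrite ler_norml crit_k.
    by have := ler_pM (normr_ge0 _) (enorm_ge0 R N z) h30 h4; rewrite -/k; lra.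
  have hb : `|b| <= 57 by rewrite ler_norml; apply/andP; split; lra.
  have := ler_pM (ltW z0) (enorm_ge0 R N p) t4 hp; rewrite -/t.
  by move: hb; lra.
have : tau * enorm (t *: p + b *: e) <= tau * (20 * 30) by rewrite ler_wpM2l ?(ltW tau0).
by move: tK tau0; lra.
Qed.

(** [critW] is a multiple of [e . z], and so is its radial derivative. The factor [t] is needed for
    the mixed term in [crit_arith]. *)
Lemma crit_zP_le : `|dotR z P| <= 8 * t * enorm P.
Proof.
rewrite crit_zP normrM (gtr0_norm z0) -/t (mulrC 8) -mulrA ler_wpM2l ?(ltW z0) //.
have /andP[h1 h2] := crit_tau_bound _ crit_zpb.
have h3 := crit_P_ge; have h4 := crit_K0.
by rewrite ler_norml; move: h1 h2 h3 h4 => *; apply/andP; split; lra.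
Qed.

Lemma crit_nlap : nlap P (critY tau z) <= tau * (20 * 35 * N%:R * t - 2) * dotR P P.
Proof.
have -> : nlap P (critY tau z) = tau * - (enorm P ^+ 2 *
   (t * (k * ((N - 2)%:R + 2) - 8 * s) + 2 * k * t + 2) +
   (N - 2)%:R * (t * (k * enorm P ^+ 2 - 8 * dotR z P ^+ 2) +
     2 * dotR e P * (k * dotR z P + dotR e P))).
  rewrite enorm_sqr /nlap /critY -/p -/b -/t raddfN /= mxtraceZ !mxtraceD mxtraceZ.
  rewrite !tr_outer (dotRC R N p e) crit_ep bump_trace natN.
  rewrite qf_oppM qf_scaleM !qf_addM qf_scaleM !qf_outer bump_qf crit_pP.
  rewrite -/s -/k; ring.
rewrite -[leRHS]mulrA ler_wpM2l ?(ltW tau0) // -[X in _ <= _ * X]enorm_sqr natN.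
apply: crit_arith => //.
- exact: crit_k.
- exact: ltW.
- exact: enorm_ge0.
- exact: crit_zP_le.
- rewrite enorm_sqr; apply: le_trans (dotR_sqr_le _ _) _.
  by rewrite ler_wpM2r ?dotR_ge0 //; move/andP: zz => [].
- by have := cauchy_schwarz_abs R N e P; rewrite e1 mul1r.
Qed.

(** For small [e . z] the N-Laplacian is nonpositive and any positive forcing is enough; a
    quantitative forcing is asked only where [e . z] is bounded below. *)
Lemma crit_super (F : R) : 0 < F ->
  (2 <= 20 * 35 * N%:R * dotR e z ->
     r ^+ (N - 1) * ((2 * K) ^+ (N - 2) * (tau * (20 * 35 * N%:R * 4))) < F) ->
  [/\ jet R N (fun z => r * critW K tau z) z (r *: critP K tau z) (r *: critY tau z),
   (r *: critY tau z)^T = r *: critY tau z, r *: critP K tau z != 0 &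
   enorm (r *: critP K tau z) ^+ (N - 2) * nlap (r *: critP K tau z) (r *: critY tau z) <
   dotR (r *: critP K tau z) (r *: critP K tau z) * F].
Proof.
move=> F0 hF.
have P0 := crit_P0.
have rP0 : r *: P != 0 by rewrite scaler_eq0 negb_or P0 gt_eqF.
split => //.
- exact: jet_scale (crit_jet K tau z).
- apply/matrixP => i j; rewrite !mxE !big_ord1 !mxE ?big_ord1 [j == i]eq_sym; ring.
set D := 20 * 35 * N%:R * t - 2.
apply: (nlap_lt _ _ (r * (tau * D))) => //.
  rewrite nlap_scale dotRZl dotRZr.
  have -> : r * (tau * D) * (r * (r * dotR P P)) =
     r ^+ 3 * (tau * D * dotR P P) by ring.
  by rewrite ler_wpM2l ?exprn_ge0 ?(ltW r0) //; exact: crit_nlap.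
rewrite enormZ (gtr0_norm r0) exprMn.
have En0 : 0 <= r ^+ (N - 2) * enorm P ^+ (N - 2).
  by rewrite mulr_ge0 ?exprn_ge0 ?enorm_ge0 ?(ltW r0).
have [D0|D0] := leP D 0.
  by apply: le_lt_trans F0; rewrite mulr_ge0_le0 // mulr_ge0_le0 ?(ltW r0) // mulr_ge0_le0 ?(ltW tau0).
have D1 : 2 <= 20 * 35 * N%:R * dotR e z by move: D0; rewrite /D -/t; lra.
apply: le_lt_trans (hF D1).
have -> : (N - 1 = (N - 2).+1)%N by rewrite -subSn.
rewrite exprS.
have -> : r ^+ (N - 2) * enorm P ^+ (N - 2) * (r * (tau * D)) =
  r * r ^+ (N - 2) * (enorm P ^+ (N - 2) * (tau * D)) by ring.
rewrite ler_wpM2l ?mulr_ge0 ?exprn_ge0 ?(ltW r0) //.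
apply: ler_pM; rewrite ?exprn_ge0 ?enorm_ge0 ?mulr_ge0 ?(ltW tau0) ?(ltW D0) //.
  by rewrite lerXn2r ?nnegrE ?enorm_ge0 ?crit_P_le // mulr_ge0 // ltW // crit_K0.
rewrite ler_wpM2l ?(ltW tau0) // /D.
have : 20 * 35 * N%:R * t <= 20 * 35 * N%:R * 4 by rewrite ler_wpM2l ?crit_t // !mulr_ge0.
lra.
Qed.

Lemma critW_ge : K / 2 * dotR e z <= critW K tau z.
Proof.
have /andP[_ b2] := crit_b; rewrite /critW -/b -/t.
have : tau * b <= K / 2.
  have : tau * b <= tau * 57 by rewrite ler_wpM2l // ltW.
  by move: tK tau0; lra.
by move: (z0); rewrite -/t; set x := tau * b; rewrite mulrCA -/x; nra.
Qed.

End Critical.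

Lemma critW_sphere z K tau : 0 <= tau -> 0 <= dotR e z ->
  dotR z z = 1 \/ dotR z z = 16 -> K * dotR e z <= critW K tau z.
Proof.
move=> tau0 z0 zz; rewrite /critW /bump.
have z16 : dotR z z <= 4 ^+ 2 by case: zz => ->; lra.
have := coord_bound e z 4 ee ltac:(lra) z16 => /andP[_ z4].
have -> : (dotR z z - 1) * (16 - dotR z z) = 0 by case: zz => ->; ring.
have : 0 <= tau * (dotR e z * (4 - dotR e z)) by rewrite !mulr_ge0 // subr_ge0.
lra.
Qed.

Lemma critW_mid z K tau : 0 <= tau -> 0 <= dotR e z -> dotR z z = 4 ->
  critW K tau z <= (K - 32 * tau) * dotR e z.
Proof.
move=> tau0 z0 zz; rewrite /critW /bump zz.
have := mulr_ge0 tau0 (sqr_ge0 (dotR e z)); nra.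
Qed.

(* a gradient bound from below for the bump needs [e . z] bounded from below;
   the remaining slab is covered by the linear barrier, see [slab_estimate] *)
Definition expW (c tau lam : R) (z : V) : R := c - tau * expR (lam * bump f (-1) (-4) z).

Lemma xi_bound z : 1 <= dotR z z <= 16 -> -8 <= bump f (-1) (-4) z <= 57.
Proof.
move=> /andP[z1 z16].
have := coord_bound f z 4 ff ltac:(lra) ltac:(lra) => /andP[z2 z4].
rewrite /bump; set s := dotR z z in z1 z16 *.
have : 0 <= (s - 1) * (16 - s) by rewrite mulr_ge0 // subr_ge0.
have := sqr_ge0 (s - 17 / 2).
by move=> *; apply/andP; split; lra.
Qed.

(** If the radial coefficient is at least 1/8 in absolute value, the [e]-component gives [h / 8];
    otherwise the radial part has norm at most 1/2 and the unit vector [f] dominates. *)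
Lemma bumpP_ge (h : R) z : 0 < h <= 4 -> 1 <= dotR z z <= 16 -> h <= dotR e z ->
  h / 8 <= enorm (bumpP f (-1) z).
Proof.
move=> /andP[h0 h4] /andP[z1 z16] hz.
have f1 : enorm f = 1 by rewrite /enorm ff sqrtr1.
have e1 : enorm e = 1 by rewrite /enorm ee sqrtr1.
have z4 : enorm z <= 4 by apply: enorm_bound => //; lra.
rewrite /bumpP; set k := 2 * _.
have [k1|k1] := leP (8^-1) `|k|.
  have : `|dotR e (k *: z + -1 *: f)| <= enorm (k *: z + -1 *: f).
    by apply: le_trans (cauchy_schwarz_abs _ _ _ _) _; rewrite e1 mul1r.
  apply: le_trans; rewrite dotRDr !dotRZr ef mulr0 addr0 normrM mulrC.
  by apply: ler_pM => //; [exact: ltW|rewrite (le_trans hz) // ler_norm].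
have := enorm_triangle R N (k *: z + -1 *: f) (- (k *: z)).
rewrite addrAC subrr add0r -[- (k *: z)]scaleN1r !enormZ f1 !normrN1 !mul1r.
have : `|k| * enorm z <= 8^-1 * 4 by apply: ler_pM => //; [exact: enorm_ge0|exact: ltW].
lra.
Qed.

Lemma exp_jet (c tau lam : R) z :
  let T := tau * lam * expR (lam * bump f (-1) (-4) z) in
  let P := (- T) *: bumpP f (-1) z in
  let Y := (- T) *: bumpY z +
    (- (T * lam)) *: ((bumpP f (-1) z)^T *m bumpP f (-1) z) in
  jet R N (expW c tau lam) z P Y /\ Y^T = Y.
Proof.
move=> T P Y; split.
  have j1 := jet_comp R N _ _ _ _ _ _ _ (jet_scale R N lam _ _ _ _ (bump_jet f (-1) (-4) z))
    (jet1_exp R _).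
  have j2 := jet_add R N _ _ _ _ _ _ _ (jet_cst R N c z) (jet_scale R N (- tau) _ _ _ _ j1).
  apply: (jet_ext R N _ _ _ _ _ _ (jet_eq R N _ _ _ _ _ _ j2 _ _)) => [y||].
  - by rewrite /expW mulNr.
  - by rewrite /P /T add0r !scalerA; congr (_ *: _); ring.
  - rewrite /Y /T; move: (expR _) => E; apply/matrixP => m n.
    by rewrite /bumpY !mxE !big_ord1 !mxE; ring.
by rewrite /Y; apply/matrixP => m n; rewrite /bumpY !mxE !big_ord1 !mxE [n == m]eq_sym; ring.
Qed.

(** The second derivative of the exponential contributes [lam * (N - 1) * |p|^4]; with
    [|p| >= h / 8] and [lam] large it beats the N-Laplacian of the bump, and the surplus tolerates a
    slightly negative [F]. The 8 in the exponent is the lower bound -8 of the bump. *)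
Lemma exp_super (tau lam h F : R) z :
  0 < tau -> 0 < lam -> 0 < h <= 4 -> 188 * N%:R + 1 <= lam * (h / 8) ^+ 2 ->
  1 <= dotR z z <= 16 -> h <= dotR e z ->
  let T := tau * lam * expR (lam * bump f (-1) (-4) z) in
  let P := (- T) *: bumpP f (-1) z in
  let Y := (- T) *: bumpY z +
    (- (T * lam)) *: ((bumpP f (-1) z)^T *m bumpP f (-1) z) in
  - ((tau * lam * expR (- (8 * lam))) ^+ (N - 1) * (h / 8) ^+ (N - 2)) < F ->
  P != 0 /\ enorm P ^+ (N - 2) * nlap P Y < dotR P P * F.
Proof.
move=> tau0 lam0 hh hlam zz hz T P Y hF.
have [h0 h4] := andP hh.
have pe := bumpP_ge h z hh zz hz.
have z0 : 0 < dotR e z by lra.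
have T0 : 0 < T by rewrite !mulr_gt0 ?expR_gt0.
have p0 : bumpP f (-1) z != 0 by apply: bumpP_neq0; rewrite ?oppr_eq0 ?oner_eq0.
have P0 : P != 0 by rewrite scaler_eq0 negb_or p0 oppr_eq0 gt_eqF.
split => //.
set p := bumpP f (-1) z in pe p0 P Y P0 *.
have q0 := dotR_gt0 R N _ p0.
have T1 : tau * lam * expR (- (8 * lam)) <= T.
  rewrite /T ler_wpM2l ?mulr_ge0 ?(ltW tau0) ?(ltW lam0) // ler_expR.
  by have /andP[b1 _] := xi_bound z zz; nra.
have N2' := natN_ge2.
apply: (nlap_lt _ _ (- T)) => //.
  rewrite nlap_comp /P dotRZl dotRZr.
  have bn := bump_nlap_ge z p zz.
  have hq : 188 * N%:R + 1 <= lam * dotR p p.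
    apply: le_trans hlam _; rewrite ler_wpM2l ?(ltW lam0) // -enorm_sqr.
    by rewrite lerXn2r // nnegrE ?enorm_ge0 // divr_ge0 // ltW.
  have hq2 : (188 * N%:R + 1) * dotR p p <= lam * (N%:R - 1) * dotR p p ^+ 2.
    apply: (@le_trans _ _ (lam * dotR p p * dotR p p)); first by rewrite ler_wpM2r // ltW.
    have : 0 <= lam * dotR p p * dotR p p * (N%:R - 2).
      by rewrite !mulr_ge0 ?(ltW lam0) ?(ltW q0) //; lra.
    lra.
  have -> : (- T) ^+ 3 * nlap p (bumpY z) + (- T) ^+ 2 * - (T * lam) * (N%:R - 1) *
    dotR p p ^+ 2 = - (T ^+ 3 * (nlap p (bumpY z) + lam * (N%:R - 1) * dotR p p ^+ 2)) by ring.
  have -> : - T * (- T * (- T * dotR p p)) = - (T ^+ 3 * dotR p p) by ring.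
  by rewrite lerN2 ler_wpM2l ?exprn_ge0 ?(ltW T0) //; lra.
apply: le_lt_trans hF; rewrite mulrN lerN2 /P enormZ normrN (gtr0_norm T0) [(T * _) ^+ _]exprMn.
have -> : (N - 1 = (N - 2).+1)%N by rewrite -subSn.
have -> : T ^+ (N - 2) * enorm p ^+ (N - 2) * T = T ^+ (N - 2).+1 * enorm p ^+ (N - 2).
  by rewrite exprSr mulrAC.
have c0 : 0 <= tau * lam * expR (- (8 * lam)).
  by rewrite !mulr_ge0 ?expR_ge0 ?(ltW tau0) ?(ltW lam0).
have h80 : 0 <= h / 8 by rewrite divr_ge0 // ltW.
apply: ler_pM; rewrite ?exprn_ge0 //.
  by apply: lerXn2r => //; rewrite nnegrE ?(ltW T0).
by apply: lerXn2r => //; rewrite nnegrE ?enorm_ge0.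
Qed.

Lemma expW_ge (c tau lam : R) z : 0 <= tau -> 0 <= lam -> 1 <= dotR z z <= 16 ->
  c - tau * expR (57 * lam) <= expW c tau lam z.
Proof.
move=> tau0 lam0 /xi_bound /andP[_ b2]; rewrite /expW lerD2l lerN2 ler_wpM2l //.
by rewrite ler_expR mulrC ler_wpM2r.
Qed.

Lemma expW_sphere (c tau lam : R) z : 0 <= tau -> 0 <= lam ->
  dotR z z = 1 \/ dotR z z = 16 -> c - tau <= expW c tau lam z.
Proof.
move=> tau0 lam0 zz.
have z16 : dotR z z <= 4 ^+ 2 by case: zz => ->; lra.
have := coord_bound f z 4 ff ltac:(lra) z16 => /andP[z4 _].
rewrite /expW lerD2l lerN2 -[leRHS]mulr1 ler_wpM2l // -[leRHS]expR0 ler_expR.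
rewrite mulr_ge0_le0 // /bump.
have -> : (dotR z z - 1) * (16 - dotR z z) = 0 by case: zz => ->; ring.
lra.
Qed.

Lemma expW_mid (c tau lam : R) z : 0 <= tau -> 0 <= lam -> dotR z z = 4 ->
  expW c tau lam z <= c - tau * expR lam.
Proof.
move=> tau0 lam0 zz.
have := coord_bound f z 4 ff ltac:(lra) ltac:(lra) => /andP[_ z4].
rewrite /expW lerD2l lerN2 ler_wpM2l // ler_expR -[leLHS]mulr1 ler_wpM2l //.
by rewrite /bump zz; lra.
Qed.

Lemma inv_bump_sphere (eta : R) z : 0 < eta -> dotR z z = 1 \/ dotR z z = 16 ->
  (9 * eta)^-1 <= (bump f eta (5 * eta) z)^-1.
Proof.
move=> eta0 zz.
have z16 : dotR z z <= 4 ^+ 2 by case: zz => ->; lra.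
have := coord_bound f z 4 ff ltac:(lra) z16 => /andP[z3 z4].
have bE : bump f eta (5 * eta) z = eta * (dotR f z + 5).
  rewrite /bump; have -> : (dotR z z - 1) * (16 - dotR z z) = 0 by case: zz => ->; ring.
  by ring.
have h1 : 0 < eta * (dotR f z + 5) by rewrite mulr_gt0 //; lra.
rewrite bE lef_pV2 ?posrE // ?mulr_gt0 // mulrC ler_wpM2r ?(ltW eta0) //; lra.
Qed.

Lemma inv_bump_gt0 (eta : R) z : 0 < eta -> 1 <= dotR z z <= 16 ->
  0 < (bump f eta (5 * eta) z)^-1.
Proof.
move=> eta0 /andP[z1 z16].
have := coord_bound f z 4 ff ltac:(lra) ltac:(lra) => /andP[z3 z4].
rewrite invr_gt0 /bump.
have : 0 <= (dotR z z - 1) * (16 - dotR z z) by rewrite mulr_ge0 // subr_ge0.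
have : 0 <= eta * (dotR f z + 4) by rewrite mulr_ge0 ?(ltW eta0) //; lra.
lra.
Qed.

Lemma inv_bump_mid (eta : R) z : 0 < eta -> dotR z z = 4 ->
  (bump f eta (5 * eta) z)^-1 <= 36^-1.
Proof.
move=> eta0 zz.
have := coord_bound f z 4 ff ltac:(lra) ltac:(lra) => /andP[z3 z4].
have h : 0 <= eta * (dotR f z + 4) by rewrite mulr_ge0 ?(ltW eta0) //; lra.
by rewrite lef_pV2 ?posrE // /bump zz; lra.
Qed.

End Barriers.

(** * Estimates near the singular point *)

(* an upward closed set of bounds whose positive infimum could always be lowered *)
Lemma improve_descent (R : realType) (S : R -> Prop) : (exists t, S t) ->
  (forall t t', t <= t' -> S t -> S t') ->
  (forall k, 0 < k -> (forall t, k < t -> S t) -> exists2 t, t < k & S t) ->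
  forall t, 0 < t -> S t.
Proof.
move=> [t1 St1] up imp t t0; apply: contrapT => nS.
have lb s : S s -> t <= s.
  by move=> Ss; rewrite leNgt; apply/negP => st; apply: nS; exact: up (ltW st) Ss.
have hinf : has_inf [set s | S s] by split; [exists t1|exists t].
pose k := inf [set s | S s].
have tk : t <= k by apply: lb_le_inf; [exists t1|].
have h s : k < s -> S s.
  move=> ks; have [s' Ss' s's] := inf_lt hinf.1 ks.
  exact: up (ltW s's) Ss'.
have [s sk Ss] := imp k (lt_le_trans t0 tk) h.
have : k <= s by apply: ge_inf => //; exists t.
by rewrite leNgt sk.
Qed.

Lemma linB_gt0 (R : realType) (N : nat) : 0 < linB R N.
Proof. by apply: ltr_wpDl; [exact: mulr_ge0 (ler0n _ _) (ler0n _ _)|rewrite ltr0n]. Qed.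

Section Estimates.
Variables (R : realType) (N : nat) (O : set 'rV[R]_N) (g : R -> R).
Notation V := 'rV[R]_N.
Variables (u : V -> R) (a e f : V) (kappa : R).
Hypotheses (N2 : (2 <= N)%N) (openO : open O) (weak_u : weak_solution O g u).
Hypothesis du : forall x, O x -> differentiable u x.
Hypothesis cdu : forall x i, O x -> {for x, continuous (partial i u)}.
Hypothesis cg : continuous g.
Hypothesis cu : {within closure O `\ a, continuous u}.
Hypotheses (ee : dotR e e = 1) (ff : dotR f f = 1) (ef : dotR e f = 0).
Hypothesis kappa0 : 0 <= kappa.
Variables (r0 M : R).
Hypothesis r00 : 0 < r0.
Local Notation Z := (zmap R N a e kappa).
Local Notation dist2 x := (dotR (x - a) (x - a)).
Local Notation shell := (shell R N O a e kappa).
Local Notation scale := (large_scale R kappa r0).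
Hypothesis geo : forall x, closure O x -> x != a -> dist2 x < r0 -> 1 <= dotR e (Z 1 x).
Hypothesis bd : forall x, bdry O x -> x != a -> dist2 x < r0 -> u x <= M.

(* inversion sends [a] to infinity, so large [Z 1 x] means [x] near [a] *)
Definition eventually (p : V -> Prop) := exists2 rho : R, scale rho &
  forall x, closure O x -> x != a -> rho <= enorm (Z 1 x) -> p x.

Lemma lt_add1 (x : R) : x < x + 1.
Proof. by rewrite ltrDl. Qed.

Lemma scale_le (rho rho' : R) : scale rho -> rho <= rho' -> scale rho'.
Proof.
move=> [h1 h2] h; split; first exact: lt_le_trans h.
by apply: le_trans h2 _; rewrite lerXn2r // nnegrE ltW // (lt_le_trans h1).
Qed.

Lemma scale_ex : exists rho : R, scale rho.
Proof.
pose q := 4 * kappa ^+ 2 + 4 / r0.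
have q0 : 0 < q.
  have : 0 < 4 / r0 by rewrite divr_gt0.
  have := sqr_ge0 kappa; rewrite /q; lra.
exists (1 + q); split; first lra.
rewrite -/q; nra.
Qed.

Lemma eventually_sub (p q : V -> Prop) : (forall x, closure O x -> x != a -> p x -> q x) ->
  eventually p -> eventually q.
Proof. by move=> pq [r s h]; exists r => // x Ox xa /(h _ Ox xa); exact: pq. Qed.

Lemma zmap_enorm (rho : R) (x : V) : 0 < rho -> enorm (Z 1 x) = rho * enorm (Z rho x).
Proof.
move=> rho0; rewrite (zmap_scale R N a e kappa rho) [enorm (rho^-1 *: _)]enormZ gtr0_norm ?invr_gt0 //.
by rewrite mulrA divff ?mul1r // gt_eqF.
Qed.

Lemma zmap_dot (rho : R) (x b : V) : 0 < rho -> dotR b (Z 1 x) = rho * dotR b (Z rho x).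
Proof.
move=> rho0; rewrite (zmap_scale R N a e kappa rho) [dotR b (rho^-1 *: _)]dotRZr mulrA divff ?mul1r //.
by rewrite gt_eqF.
Qed.

Lemma shell_sqn (rho r2 : R) (x : V) : scale rho -> shell rho r2 x ->
  1 <= dotR (Z rho x) (Z rho x) <= r2.
Proof.
move=> s sx; have xa := shell_neq R N O a e kappa _ _ _ sx.
by apply/(shellP R N O a e kappa ee rho r2 x s.1 sx.1 xa).
Qed.

Lemma shell_far (rho r2 : R) (x : V) : scale rho -> shell rho r2 x -> rho <= enorm (Z 1 x).
Proof.
move=> s sx; have /andP[h _] := shell_sqn _ _ _ s sx.
rewrite (zmap_enorm rho) ?s.1 // -[leLHS]mulr1 ler_pM2l ?s.1 //.
by rewrite -(@ler_pXn2r _ 2) ?nnegrE ?enorm_ge0 // expr1n enorm_sqr.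
Qed.

(** A point is on the middle sphere of the shell at its own scale [rho = |Z 1 x| / 2], so an
    estimate on [|z| = 2] for all large scales covers a neighbourhood of [a]. *)
Lemma eventually_mid (q : V -> Prop) : (exists2 rho0 : R, scale rho0 &
    forall rho x, scale rho -> rho0 <= rho -> shell rho 16 x ->
      dotR (Z rho x) (Z rho x) = 4 -> q x) -> eventually q.
Proof.
move=> [rho0 s0 h]; exists (2 * rho0).
  by apply: (scale_le _ _ s0); have := s0.1; lra.
move=> x Ox xa hx; pose rho := enorm (Z 1 x) / 2.
have hr : rho0 <= rho by rewrite /rho ler_pdivlMr // mulrC.
have sr := scale_le _ _ s0 hr.
have e4 : dotR (Z rho x) (Z rho x) = 4.
  have r1 : enorm (Z rho x) = 2.
    have := zmap_enorm rho x sr.1; rewrite /rho => h1.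
    have r0' : enorm (Z 1 x) != 0 by have := sr.1; rewrite /rho; lra.
    have : enorm (Z 1 x) * enorm (Z (enorm (Z 1 x) / 2) x) = enorm (Z 1 x) * 2 by lra.
    by move/(mulfI r0').
  by rewrite -enorm_sqr r1; ring.
apply: (h rho x) => //.
apply/(shellP R N O a e kappa ee rho 16 x sr.1 Ox xa).
by rewrite e4; apply/andP; split; lra.
Qed.

Lemma shell_scale_ge (rho : R) (x : V) : scale rho -> shell rho 16 x ->
  1 <= 34 * (rho ^+ 2 * dist2 x).
Proof.
move=> [rho0 s] sx; have h := shell_large R N O a e kappa ee _ _ _ sx.
apply: le_trans h _; have d0 := dist2_gt0 R N a x (shell_neq _ _ _ _ _ _ _ _ _ sx).
have i0 : 0 < 4 / r0 by rewrite divr_gt0.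
have : 2 * (16 * rho ^+ 2 + kappa ^+ 2) <= 34 * rho ^+ 2 by have := sqr_ge0 kappa; lra.
by move/(ler_wpM2r (ltW d0)); rewrite mulrA.
Qed.

Lemma shell_bound (rho r2 : R) : scale rho ->
  exists2 B : R, 0 < B & forall x, shell rho r2 x -> u x - M <= B.
Proof.
move=> s; have [[x1 Kx1]|K0] := pselect (exists x, shell rho r2 x); last first.
  by exists 1 => // x sx; case: K0; exists x.
have [x0 _ h] : exists2 x0, shell rho r2 x0 & forall x, shell rho r2 x -> u x - 0 <= u x0 - 0.
  apply: (within_max R N O u a cu (shell rho r2) (fun=> 0) x1) => //.
  - exact: (large_scale_compact R N O a e kappa ee r0 r00).
  - by move=> x sx; split; [exact: sx.1|apply/eqP; exact: (shell_neq _ _ _ _ _ _ _ _ _ sx)].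
  - by move=> x _; exact: cst_continuous.
exists (`|u x0 - M| + 1); first by have := normr_ge0 (u x0 - M); lra.
by move=> x /h; have := ler_norm (u x0 - M); lra.
Qed.

Lemma height_gt0 (rho r2 : R) (x : V) : scale rho -> shell rho r2 x -> 0 < dotR e (Z rho x).
Proof.
move=> s sx; apply: lt_le_trans (shell_height R N O a e kappa ee kappa0 r0 r00 geo _ _ _ s sx).
by rewrite invr_gt0 s.1.
Qed.

(** Only the weak lower bound on the absorption is assumed, so that this serves both under the
    growth condition and for bounded [u]. *)
Lemma linear_estimate (rho L : R) : scale rho -> 0 < L ->
  (forall x, shell rho 16 x -> u x - M <= L) ->
  (forall x, O x -> shell rho 16 x -> M < u x ->
     - L ^+ (N - 1) < (rho * dist2 x) ^+ N * g (u x)) ->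
  forall x, shell rho 16 x -> u x - M <= L * linW R N e (Z rho x).
Proof.
move=> s L0 hL hF.
apply: (comparison R N O g u a e kappa N2 openO weak_u du cdu cg cu ee kappa0 r0 M r00
  geo bd 16 rho (fun z => L * linW R N e z) (fun z => L *: linP R N e z)
  (fun z => L *: linY R N e z) s).
- move=> z z0 zz; have [h1 h2 _ _] := lin_super R N N2 e ee L (- L ^+ (N - 1) + 1) z L0 zz z0
    (lt_add1 _).
  split => //; rewrite mulr_ge0 ?(ltW L0) // linW_ge0 ?(ltW z0) //.
  by move/andP: zz => [].
- move=> x Ox xa zz sx; apply: le_trans (hL x sx) _; rewrite -[leLHS]mulr1 ler_pM2l //.
  by apply: linW_sphere => //; exact: ltW (height_gt0 _ _ _ s sx).
- move=> x Ox xa sx z0 zz hw; have pos : M < u x.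
    have : 0 <= L * linW R N e (Z rho x).
      rewrite mulr_ge0 ?(ltW L0) // linW_ge0 ?(ltW z0) //.
      by move/andP: zz => [].
    lra.
  by have [_ _ h3 h4] := lin_super R N N2 e ee L _ _ L0 zz z0 (hF x Ox sx pos).
Qed.

(** * Boundedness from the growth of the absorption *)

Section Growth.
Variable c : R.
Hypothesis c0 : 0 < c.
Hypothesis growth : forall x, O x -> M < u x -> c * (u x - M) ^+ (2 * N - 1) <= g (u x).

Lemma growth_gt0 x : O x -> M < u x -> 0 < g (u x).
Proof.
by move=> Ox ux; apply: lt_le_trans (growth x Ox ux); rewrite mulr_gt0 ?exprn_gt0 ?subr_gt0.
Qed.

Lemma forcing_gt0 (rho r2 : R) x : scale rho -> O x -> shell rho r2 x -> M < u x ->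
  0 < (rho * dist2 x) ^+ N * g (u x).
Proof.
move=> s Ox sx ux; rewrite mulr_gt0 ?growth_gt0 // exprn_gt0 // mulr_gt0 ?s.1 //.
exact: dist2_gt0 (shell_neq _ _ _ _ _ _ _ _ _ sx).
Qed.

Lemma forcing_ge (rho m : R) x : scale rho -> O x -> shell rho 16 x -> 0 < m -> m <= u x - M ->
  c * (34 * rho) ^- N * m ^+ (2 * N - 1) <= (rho * dist2 x) ^+ N * g (u x).
Proof.
move=> s Ox sx m0 mu; have ux : M < u x by lra.
have d0 := dist2_gt0 R N a x (shell_neq _ _ _ _ _ _ _ _ _ sx).
have rr := s.1.
rewrite -exprVn mulrAC mulrC.
apply: ler_pM.
- by rewrite exprn_ge0 // invr_ge0 mulr_ge0 // ltW.
- by rewrite mulr_ge0 ?(ltW c0) // exprn_ge0 // ltW.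
- apply: lerXn2r; rewrite ?nnegrE ?invr_ge0 ?mulr_ge0 ?(ltW rr) ?(ltW d0) //.
  rewrite invf_ple ?posrE ?mulr_gt0 //.
  have h := shell_scale_ge _ _ s sx.
  rewrite -[leLHS]mul1r ler_pdivrMr ?mulr_gt0 //.
  by apply: le_trans h _; rewrite le_eqVlt; apply/orP; left; apply/eqP; ring.
- apply: le_trans (growth x Ox ux); rewrite ler_pM2l // lerXn2r // nnegrE.
    exact: ltW.
  lra.
Qed.

(* Keller--Osserman: the barrier [A / bump] does not depend on the size of [u] *)
Lemma linear_growth : exists2 C : R, 0 < C & eventually (fun x => u x - M <= C * enorm (Z 1 x)).
Proof.
pose C1 : R := 300 * 300 * N%:R * 121 ^+ (N - 2).
have C10 : 0 <= C1.
  apply: mulr_ge0; last by rewrite exprn_ge0.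
  exact: mulr_ge0 (mulr_ge0 (ler0n _ _) (ler0n _ _)) (ler0n _ _).
(* The factor 34 cancels the loss in [forcing_ge]; then [c * (1 + C1 / c) ^+ N > C1], which is the
   strict inequality needed. *)
pose K := 34 * (1 + C1 / c).
have K1 : 1 <= 1 + C1 / c by rewrite lerDl divr_ge0 // ltW.
have K0 : 0 < K by rewrite /K; lra.
exists K => //; apply: eventually_mid.
have [rho0 s0] := scale_ex; exists rho0 => // rho x s _ sx x4.
have rr := s.1; pose A := K * rho; have A0 : 0 < A by rewrite mulr_gt0.
have [B B0 hB] := shell_bound rho 16 s.
(* The bump is at most [9 * eta] on the bounding spheres, so the barrier is at least [B] there.
   Neither [B] nor [eta] survives on the middle sphere, where the bump is at least 36. *)
pose eta := Num.min 1 (A / (9 * B)).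
have eta0 : 0 < eta by rewrite lt_min ltr01 divr_gt0 // mulr_gt0.
have eta1 : 0 < eta <= 1 by rewrite eta0 ge_min lexx.
have etaA : B * (9 * eta) <= A.
  have : eta <= A / (9 * B) by rewrite ge_min lexx orbT.
  by rewrite ler_pdivlMr ?mulr_gt0 //; lra.
pose w (z : V) := A * (bump R N f eta (5 * eta) z)^-1.
pose i (z : V) := (bump R N f eta (5 * eta) z)^-1.
pose P (z : V) := (A * - (bump R N f eta (5 * eta) z) ^- 2) *: bumpP R N f eta z.
pose Y (z : V) := A *: ((- (bump R N f eta (5 * eta) z) ^- 2) *: bumpY R N z +
      (2 * (bump R N f eta (5 * eta) z) ^- 3) *: ((bumpP R N f eta z)^T *m bumpP R N f eta z)).
have i0 z : 1 <= dotR z z <= 16 -> 0 < i z by exact: inv_bump_gt0.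
have main : forall x, shell rho 16 x -> u x - M <= w (Z rho x).
  apply: (comparison R N O g u a e kappa N2 openO weak_u du cdu cg cu ee kappa0 r0 M r00
    geo bd 16 rho w P Y s).
  - move=> z z0 zz.
    have [h1 h2 _ _] := inv_bump_super R N N2 e f ff ef A eta _ z A0 eta1 zz z0 (lt_add1 _).
    by split => //; rewrite /w mulr_ge0 ?(ltW A0) // ltW // i0.
  - move=> y Oy ya zz sy; apply: le_trans (hB y sy) _.
    apply: (@le_trans _ _ (A * (9 * eta)^-1)).
      by rewrite ler_pdivlMr ?mulr_gt0.
    by rewrite /w ler_pM2l // inv_bump_sphere.
  - move=> y Oy ya sy z0 zz hw.
    have wi : w (Z rho y) = A * i (Z rho y) by [].
    have ii := i0 _ zz.
    have w0 : 0 < w (Z rho y) by rewrite wi mulr_gt0.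
    have hF := forcing_ge rho _ y s Oy sy w0 (ltW hw).
    suff hF' : C1 * (A ^+ (N - 1) * i (Z rho y) ^+ (2 * N - 1)) <
        (rho * dist2 y) ^+ N * g (u y).
      by have [_ _ h3 h4] := inv_bump_super R N N2 e f ff ef A eta _ _ A0 eta1 zz z0 hF'.
    apply: lt_le_trans hF; rewrite wi [(A * i _) ^+ _]exprMn.
    set j := i _ ^+ _; have j0 : 0 < j by rewrite exprn_gt0.
    have -> : A ^+ (2 * N - 1) = A ^+ N * A ^+ (N - 1).
      by rewrite -exprD mul2n -addnn addnBA // ltnW.
    set D := (34 * rho) ^+ N; set X := (1 + C1 / c) ^+ N.
    have D0 : D != 0 by rewrite expf_neq0 // gt_eqF // mulr_gt0.
    have AN : A ^+ N = D * X by rewrite -exprMn /A /K; congr (_ ^+ _); ring.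
    have -> : c * D^-1 * (A ^+ N * A ^+ (N - 1) * j) = c * X * (A ^+ (N - 1) * j).
      rewrite AN; have -> : c * D^-1 * (D * X * A ^+ (N - 1) * j) =
        (D * D^-1) * (c * X * (A ^+ (N - 1) * j)) by ring.
      by rewrite divff // mul1r.
    rewrite ltr_pM2r; last by rewrite mulr_gt0 ?exprn_gt0.
    apply: (@lt_le_trans _ _ (c * (1 + C1 / c))).
      by rewrite mulrDr mulr1 mulrCA divff ?gt_eqF // mulr1 ltrDr.
    rewrite ler_pM2l // -[leLHS]expr1 ler_weXn2l //.
    exact: ltnW.
have := main x sx; move/le_trans; apply.
have sz := shell_sqn _ _ _ s sx.
rewrite (zmap_enorm rho x rr) /w /A -mulrA ler_pM2l // ler_pM2l //.
apply: le_trans (inv_bump_mid R N f ff eta _ eta0 x4) _.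
apply: (@le_trans _ _ 1); first by lra.
by rewrite -(@ler_pXn2r _ 2) ?nnegrE ?enorm_ge0 // expr1n enorm_sqr; move/andP: sz => [].
Qed.

(** On the shell of scale [rho] linear growth bounds [u - M] by [4 * C * rho], the outer radius
    being 4; [linW] turns this into a bound by [e . z] on the middle sphere. *)
Lemma normal_growth : exists2 C : R, 0 < C &
  eventually (fun x => u x - M <= C * dotR e (Z 1 x)).
Proof.
have [C C0 [r1 s1 h1]] := linear_growth.
exists (4 * C * linB R N); first exact: mulr_gt0 (mulr_gt0 _ C0) (linB_gt0 R N).
apply: eventually_mid; exists r1 => // rho x s r1s sx x4.
have rr := s.1.
have L0 : 0 < 4 * C * rho by rewrite !mulr_gt0.
have hL y : shell rho 16 y -> u y - M <= 4 * C * rho.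
  move=> sy; have ya := shell_neq _ _ _ _ _ _ _ _ _ sy.
  apply: le_trans (h1 y sy.1 ya (le_trans r1s (shell_far _ _ _ s sy))) _.
  rewrite (zmap_enorm rho) // mulrCA mulrC (mulrC 4) ler_pM2r // ler_pM2l //.
  apply: enorm_bound => //; have /andP[_] := shell_sqn _ _ _ s sy; lra.
have hF y : O y -> shell rho 16 y -> M < u y ->
    - (4 * C * rho) ^+ (N - 1) < (rho * dist2 y) ^+ N * g (u y).
  move=> Oy sy uy; apply: lt_trans (forcing_gt0 _ _ _ s Oy sy uy).
  by rewrite oppr_lt0 exprn_gt0.
apply: le_trans (linear_estimate rho _ s L0 hL hF x sx) _.
rewrite (zmap_dot rho) //.
have -> : 4 * C * linB R N * (rho * dotR e (Z rho x)) =
  4 * C * rho * (linB R N * dotR e (Z rho x)) by ring.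
by rewrite ler_pM2l //; exact: linW_mid.
Qed.

Lemma far_shell (rho r2 : R) (x : V) : scale rho -> closure O x -> x != a ->
  rho <= enorm (Z 1 x) -> dotR (Z rho x) (Z rho x) <= r2 -> shell rho r2 x.
Proof.
move=> s Ox xa h h2; apply/(shellP R N O a e kappa ee rho r2 x s.1 Ox xa).
rewrite h2 andbT -enorm_sqr exprn_ege1 //.
by move: h; rewrite (zmap_enorm rho) ?s.1 // -[leLHS]mulr1 ler_pM2l ?s.1.
Qed.

Lemma far_height (rho : R) (x : V) : scale rho -> closure O x -> x != a ->
  rho <= enorm (Z 1 x) -> 0 <= dotR e (Z 1 x).
Proof.
move=> s Ox xa h; rewrite (zmap_dot rho) ?s.1 // mulr_ge0 ?(ltW s.1) // ltW //.
exact: (height_gt0 _ _ _ s (far_shell _ _ _ s Ox xa h (lexx _))).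
Qed.

(** If all slopes above [k] are admissible, so is [K = k + tau], and [critW] lowers it to
    [K - 32 * tau < k]. By criticality both sides of the supersolution condition carry the factor
    [rho ^+ (N - 1)], so [tau] is independent of [rho]. *)
Lemma sublinear_growth (t : R) : 0 < t ->
  eventually (fun x => u x - M <= t * dotR e (Z 1 x)).
Proof.
apply: (improve_descent R (fun t => eventually (fun x => u x - M <= t * dotR e (Z 1 x)))).
- by have [C _ h] := normal_growth; exists C.
- move=> t1 t2 t12 [r1 s1 h1]; exists r1 => // x Ox xa xr.
  by apply: le_trans (h1 x Ox xa xr) _; rewrite ler_wpM2r // (far_height r1).
move=> k k0 hk.
have n0 : 0 < N%:R :> R by rewrite ltr0n (leq_trans _ N2).
pose c1 : R := 20 * 35 * N%:R.
have c10 : 0 < c1 by exact: mulr_gt0 (mulr_gt0 _ _) _.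
(* Threshold of [crit_super]: absorption is needed only for [e . z >= z0]. There [G] bounds it below
   and [H * tau] bounds the N-Laplacian above, both divided by [rho ^+ (N - 1)]. *)
pose z0 := 2 / c1; have z00 : 0 < z0 by rewrite divr_gt0.
pose G := c * 34 ^- N * (k / 2 * z0) ^+ (2 * N - 1).
have kz0 : 0 < k / 2 * z0 by rewrite mulr_gt0 // divr_gt0.
have G0 : 0 < G by rewrite !mulr_gt0 ?exprn_gt0 ?invr_gt0.
pose H := (4 * k) ^+ (N - 2) * (c1 * 4).
have H0 : 0 < H by rewrite !mulr_gt0 ?exprn_gt0 ?mulr_gt0.
pose tau := Num.min (k / (30 * 30)) (G / (2 * H)).
have tau0 : 0 < tau.
  rewrite lt_min; apply/andP; split; apply: divr_gt0 => //; exact: mulr_gt0.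
have tauk : 30 * 30 * tau <= k.
  have : tau <= k / (30 * 30) by rewrite ge_min lexx.
  by rewrite ler_pdivlMr ?mulr_gt0 // mulrC.
have tauH : tau * H < G.
  have : tau <= G / (2 * H) by rewrite ge_min lexx orbT.
  have H2 : 0 < 2 * H by exact: mulr_gt0.
  rewrite ler_pdivlMr // => h; lra.
pose K := k + tau.
have K0 : 0 < K by rewrite /K; lra.
have tK : 30 * 30 * tau <= K by rewrite /K; lra.
have K2 : K <= 2 * k by rewrite /K; lra.
have [r1 s1 h1] := hk K ltac:(rewrite /K; lra).
exists (K - 32 * tau); first by rewrite /K; lra.
apply: eventually_mid; exists r1 => // rho x s r1s sx x4.
have rr := s.1.
have main : forall x, shell rho 16 x -> u x - M <= rho * critW R N e K tau (Z rho x).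
  apply: (comparison R N O g u a e kappa N2 openO weak_u du cdu cg cu ee kappa0 r0 M r00
    geo bd 16 rho (fun z => rho * critW R N e K tau z) (fun z => rho *: critP R N e K tau z)
    (fun z => rho *: critY R N e tau z) s).
  - move=> z zz0 zz.
    (* Any admissible forcing does here: only the jet and the symmetry are extracted. *)
    pose F := Num.max 1 (rho ^+ (N - 1) * ((2 * K) ^+ (N - 2) * (tau * (c1 * 4))) + 1).
    have F0 : 0 < F by rewrite lt_max ltr01.
    have hFm : rho ^+ (N - 1) * ((2 * K) ^+ (N - 2) * (tau * (c1 * 4))) < F.
      by rewrite lt_max lt_add1 orbT.
    have [h2 h3 _ _] := crit_super R N N2 e ee rho K tau z rr tau0 tK zz zz0 F F0
      (fun _ => hFm).
    split => //; rewrite mulr_ge0 ?(ltW rr) //.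
    apply: le_trans (critW_ge R N e ee K tau z tau0 tK zz zz0).
    by rewrite mulr_ge0 ?(ltW zz0) // divr_ge0 // ltW.
  - move=> y Oy ya zz sy.
    apply: le_trans (h1 y Oy ya (le_trans r1s (shell_far _ _ _ s sy))) _.
    rewrite (zmap_dot rho) // mulrCA ler_pM2l //.
    by apply: critW_sphere; rewrite ?(ltW tau0) // ltW // (height_gt0 _ _ _ s sy).
  - move=> y Oy ya sy zz0 zz hw.
    have wm := critW_ge R N e ee K tau _ tau0 tK zz zz0.
    have pos : 0 < K / 2 * dotR e (Z rho y) by rewrite mulr_gt0 // divr_gt0.
    have mu : rho * (K / 2 * dotR e (Z rho y)) <= u y - M.
      by apply: le_trans (ltW hw); rewrite ler_pM2l.
    have ru : 0 < rho * (K / 2 * dotR e (Z rho y)) by rewrite mulr_gt0.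
    have F0 := forcing_gt0 _ _ y s Oy sy ltac:(lra).
    suff hF : 2 <= 20 * 35 * N%:R * dotR e (Z rho y) ->
        rho ^+ (N - 1) * ((2 * K) ^+ (N - 2) * (tau * (20 * 35 * N%:R * 4))) <
        (rho * dist2 y) ^+ N * g (u y).
      by have [_ _ h3 h4] := crit_super R N N2 e ee rho K tau _ rr tau0 tK zz zz0 _ F0 hF.
    rewrite -/c1 => hz.
    have zge : z0 <= dotR e (Z rho y) by rewrite /z0 ler_pdivrMr // mulrC.
    have mm : 0 < rho * (k / 2 * z0) by rewrite mulr_gt0.
    have mm2 : rho * (k / 2 * z0) <= u y - M.
      apply: le_trans mu; rewrite ler_pM2l //; apply: ler_pM => //; rewrite ?(ltW z00) //.
        by rewrite divr_ge0 // ltW.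
      by rewrite ler_pM2r // /K lerDl ltW.
    apply: lt_le_trans (forcing_ge rho _ y s Oy sy mm mm2).
    have -> : c * (34 * rho) ^- N * (rho * (k / 2 * z0)) ^+ (2 * N - 1) =
        rho ^+ (N - 1) * G.
      rewrite [(rho * _) ^+ _]exprMn [in LHS](_ : rho ^+ (2 * N - 1) = rho ^+ N * rho ^+ (N - 1)).
        rewrite /G; set q := (k / 2 * z0) ^+ _; set b := rho ^+ (N - 1).
        have rN : rho ^+ N != 0 by rewrite expf_neq0 // gt_eqF.
        rewrite exprMn invfM; move: rN; set d := rho ^+ N; set d' := (34 ^+ N)^-1 => rN.
        have -> : c * (d' / d) * (d * b * q) = (d * d^-1) * (b * (c * d' * q)) by ring.
        by rewrite divff // mul1r.
      by rewrite -exprD mul2n -addnn addnBA // ltnW.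
    rewrite ltr_pM2l ?exprn_gt0 //; apply: le_lt_trans tauH.
    rewrite mulrCA ler_pM2l // /H ler_wpM2r ?mulr_ge0 ?(ltW c10) //.
    by rewrite lerXn2r ?nnegrE ?mulr_ge0 ?(ltW K0) ?(ltW k0) //; lra.
apply: le_trans (main x sx) _; rewrite (zmap_dot rho) // mulrCA ler_pM2l //.
by apply: critW_mid => //; rewrite ltW // (height_gt0 _ _ _ s sx).
Qed.

Lemma linear_jet (A t : R) z : jet R N (fun z => A + t * dotR e z) z (t *: e) 0.
Proof.
have := jet_add R N _ _ _ _ _ _ _ (jet_cst R N A z)
  (jet_scale R N t _ _ _ _ (jet_lin R N e z)).
by rewrite scaler0 !add0r.
Qed.

(** Phragmen-Lindelof argument: an affine function of [e . z] has zero N-Laplacian and the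
    absorption is positive, so [B] plus a small slope dominates between a fixed inner sphere and a
    remote outer one; the slope then tends to 0 at fixed [x]. *)
Lemma bounded_above : exists2 B : R, 0 < B & eventually (fun x => u x - M <= B).
Proof.
have [rho s] := scale_ex; have rr := s.1.
have [B B0 hB] := shell_bound rho 16 s.
exists B => //; exists rho => // x Ox xa xr.
apply/ler_addgt0Pr => eps eps0.
pose h := dotR e (Z 1 x).
have h0 : 0 <= h by exact: far_height s Ox xa xr.
pose t := eps / (h + 1); have t0 : 0 < t by rewrite divr_gt0 //; lra.
have [r1 s1 h1] := sublinear_growth t t0.
(* The outer radius is large enough for the shell to contain [x] and for the sublinear bound of
   slope [t] to hold on the outer sphere. *)
pose r2 := dotR (Z rho x) (Z rho x) + 16 + r1 ^+ 2 / rho ^+ 2.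
have q0 : 0 <= r1 ^+ 2 / rho ^+ 2 by rewrite divr_ge0 ?sqr_ge0.
have r2x : dotR (Z rho x) (Z rho x) <= r2 by rewrite /r2; lra.
have sx := far_shell _ _ _ s Ox xa xr r2x.
have main : forall x, shell rho r2 x -> u x - M <= B + t * rho * dotR e (Z rho x).
  apply: (comparison R N O g u a e kappa N2 openO weak_u du cdu cg cu ee kappa0 r0 M r00
    geo bd r2 rho (fun z => B + t * rho * dotR e z) (fun z => (t * rho) *: e)
    (fun z => 0) s).
  - move=> z z0 _; split; last exact: trmx0.
      apply: addr_ge0; first exact: ltW.
      by apply: mulr_ge0 (ltW z0); apply: mulr_ge0; exact: ltW.
    exact: linear_jet.
  - move=> y Oy ya zz sy; have hy := ltW (height_gt0 _ _ _ s sy).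
    have [y1|y2] := zz.
      have sy' : shell rho 16 y.
        by apply/(shellP R N O a e kappa ee rho 16 y rr Oy ya); rewrite y1; apply/andP; split; lra.
      apply: le_trans (hB y sy') _; rewrite lerDl.
      by apply: mulr_ge0 hy; apply: mulr_ge0; exact: ltW.
    have far : r1 <= enorm (Z 1 y).
      rewrite (zmap_enorm rho) // -(@ler_pXn2r _ 2) ?nnegrE ?mulr_ge0 ?enorm_ge0 ?(ltW rr) ?(ltW s1.1) //.
      rewrite exprMn enorm_sqr y2 mulrC -ler_pdivrMr ?exprn_gt0 // /r2.
      have := dotR_ge0 R N (Z rho x); lra.
    apply: le_trans (h1 y Oy ya far) _; rewrite (zmap_dot rho) // mulrA lerDr.
    exact: ltW.
  - move=> y Oy ya sy z0 zz hw.
    have tr0 : 0 < t * rho by rewrite mulr_gt0.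
    have w0 : 0 < t * rho * dotR e (Z rho y) by rewrite mulr_gt0.
    have F0 := forcing_gt0 _ _ y s Oy sy ltac:(lra).
    have e0 : (t * rho) *: e != 0.
      rewrite scaler_eq0 negb_or gt_eqF //=.
      by apply/negP => /eqP he; move: ee; rewrite he dotR0l => /eqP; rewrite eq_sym oner_eq0.
    split => //; rewrite mxtrace0 /qf mulmx0 dotR0l !mulr0 addr0 mulr0.
    by rewrite mulr_gt0 // dotR_gt0.
apply: le_trans (main x sx) _; rewrite lerD2l -mulrA -(zmap_dot rho) // -/h.
by rewrite /t mulrAC ler_pdivrMr ?ler_pM2l //; lra.
Qed.

End Growth.

(** * Vanishing of the excess over the boundary level *)

Section Bounded.
Variables (B G0 : R).
Hypothesis uB : eventually (fun x => u x - M <= B).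
Hypothesis G00 : 0 <= G0.
Hypothesis gB : forall r, M <= r <= M + B -> - G0 <= g r.

(** On a shell [rho * dist2 x <= 4 / rho], which tends to 0, while [g (u x) >= - G0]. Taking
    [rho >= 4] lets the [N]-th power be replaced by the first. *)
Lemma forcing_small (theta : R) : 0 < theta -> exists2 rho1 : R, scale rho1 &
  forall rho x, scale rho -> rho1 <= rho -> O x -> shell rho 16 x -> M < u x ->
    - theta < (rho * dist2 x) ^+ N * g (u x).
Proof.
move=> th0; have [r1 s1 h1] := uB.
pose q := 4 * G0 / theta + 4.
have q4 : 4 <= q by rewrite /q lerDr divr_ge0 ?(ltW th0) // mulr_ge0.
exists (Num.max r1 q); first by apply: (scale_le _ _ s1); rewrite le_max lexx.
move=> rho x s; rewrite ge_max => /andP[hr1 hq] Ox sx ux.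
have rr := s.1; have xa := shell_neq _ _ _ _ _ _ _ _ _ sx.
have ub := h1 x sx.1 xa (le_trans hr1 (shell_far _ _ _ s sx)).
have g0 : - G0 <= g (u x) by apply: gB; apply/andP; split; lra.
have [gp|gn] := leP 0 (g (u x)).
  apply: (@lt_le_trans _ _ 0); first by rewrite oppr_lt0.
  by rewrite mulr_ge0 // exprn_ge0 // mulr_ge0 ?dotR_ge0 // ltW.
have [_ hs] := shell_near R N O a e kappa ee kappa0 r0 r00 _ _ _ s sx.
have rs : rho * dist2 x <= 4 / rho.
  have -> : 4 / rho = rho * (4 / rho ^+ 2) by field; rewrite gt_eqF.
  by rewrite ler_pM2l.
have rs0 : 0 <= rho * dist2 x by rewrite mulr_ge0 ?dotR_ge0 // ltW.
have r41 : 4 / rho <= 1 by rewrite ler_pdivrMr // mul1r; lra.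
have hN : (rho * dist2 x) ^+ N <= 4 / rho.
  apply: le_trans (rs); rewrite -[leRHS]expr1 ler_wiXn2l //; first exact: le_trans (rs) r41.
  exact: ltnW.
have hN0 : 0 <= (rho * dist2 x) ^+ N by rewrite exprn_ge0.
have t1 : 4 / rho * G0 < theta.
  have : 4 * G0 / theta < rho by move: hq; rewrite /q; lra.
  rewrite ltr_pdivrMr // => t2; rewrite mulrAC ltr_pdivrMr //; lra.
have t2 : (rho * dist2 x) ^+ N * - g (u x) <= 4 / rho * G0.
  by apply: ler_pM => //; rewrite ?oppr_ge0 ?(ltW gn) // lerNl.
lra.
Qed.

(** The linear barrier of height [2 * m], read on the middle sphere and written without [rho]. It
    makes [u - M] small compared with [m] in directions nearly tangent to the boundary, where the
    exponential barrier has no gradient bound. *)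
Lemma slab_estimate (m : R) : 0 < m -> (forall t, m < t -> eventually (fun x => u x - M <= t)) ->
  eventually (fun x => (u x - M) * enorm (Z 1 x) <= 4 * m * linB R N * dotR e (Z 1 x)).
Proof.
move=> m0 hm; have m2 : 0 < 2 * m by lra.
have [r1 s1 h1] := hm (2 * m) ltac:(lra).
have [r2 s2 h2] := forcing_small ((2 * m) ^+ (N - 1)) (exprn_gt0 _ m2).
apply: eventually_mid; exists (Num.max r1 r2).
  by apply: (scale_le _ _ s1); rewrite le_max lexx.
move=> rho x s; rewrite ge_max => /andP[r1s r2s] sx x4.
have rr := s.1.
have hL y : shell rho 16 y -> u y - M <= 2 * m.
  move=> sy; have ya := shell_neq _ _ _ _ _ _ _ _ _ sy.
  exact: h1 y sy.1 ya (le_trans r1s (shell_far _ _ _ s sy)).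
have hF y : O y -> shell rho 16 y -> M < u y ->
    - (2 * m) ^+ (N - 1) < (rho * dist2 y) ^+ N * g (u y).
  exact: h2.
have main : u x - M <= 2 * m * (linB R N * dotR e (Z rho x)).
  apply: le_trans (linear_estimate rho _ s m2 hL hF x sx) _.
  by rewrite ler_pM2l //; exact: linW_mid.
have e2 : enorm (Z rho x) = 2.
  by rewrite /enorm x4 (_ : 4 = 2 ^+ 2) ?sqrtr_sqr ?ger0_norm //; ring.
rewrite (zmap_dot rho) // (zmap_enorm rho) // e2.
have -> : 4 * m * linB R N * (rho * dotR e (Z rho x)) =
  2 * m * (linB R N * dotR e (Z rho x)) * (rho * 2) by ring.
by rewrite ler_wpM2r // mulr_ge0 // ltW.
Qed.

Lemma vanishing_excess (t : R) : 0 < t -> eventually (fun x => u x - M <= t).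
Proof.
apply: (improve_descent R (fun t => eventually (fun x => u x - M <= t))).
- by exists B.
- by move=> t1 t2 t12; apply: eventually_sub => x _ _ /le_trans; apply.
move=> m m0 hm.
have b0 := linB_gt0 R N.
have b64 : 64 <= linB R N by rewrite /linB lerDr; exact: mulr_ge0 (ler0n _ _) (ler0n _ _).
(* Where [e . z < h] the slab estimate gives [u - M < m / 2], below the barrier; so strictness is
   needed only for [e . z >= h]. *)
pose h := (8 * linB R N)^-1.
have b80 : 0 < 8 * linB R N by rewrite mulr_gt0.
have h0 : 0 < h by rewrite invr_gt0.
have h4 : 0 < h <= 4.
  by rewrite h0 /= invf_ple ?posrE //; lra.
have h80 : 0 < (h / 8) ^+ 2 by rewrite exprn_gt0 // divr_gt0.
pose lam := (188 * N%:R + 1) / (h / 8) ^+ 2.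
have lam0 : 0 < lam.
  apply: divr_gt0 => //; apply: ltr_wpDl => //; exact: mulr_ge0 (ler0n _ _) (ler0n _ _).
have hlam : 188 * N%:R + 1 <= lam * (h / 8) ^+ 2 by rewrite divfK // gt_eqF.
pose E := expR (57 * lam); have E0 : 0 < E by exact: expR_gt0.
(* [tau * E] is the largest possible drop of the barrier below [c], so the barrier stays above
   [m / 2]. *)
pose tau := m / (2 * E); have tau0 : 0 < tau by rewrite divr_gt0 // mulr_gt0.
have tauE : tau * E = m / 2 by rewrite /tau; field; rewrite gt_eqF.
have el1 : 1 < expR lam by rewrite expR_gt1.
(* The drop between the bounding spheres and the middle sphere is [2 * delta]: the barrier is at
   least [m + delta] on the former and at most [m - delta] on the latter. *)
pose delta := tau * (expR lam - 1) / 2.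
have delta0 : 0 < delta by rewrite divr_gt0 // mulr_gt0 // subr_gt0.
pose c := m + delta + tau.
pose theta := (tau * lam * expR (- (8 * lam))) ^+ (N - 1) * (h / 8) ^+ (N - 2).
have theta0 : 0 < theta.
  rewrite mulr_gt0 //; last by rewrite exprn_gt0 // divr_gt0.
  by rewrite exprn_gt0 // mulr_gt0 ?expR_gt0 // mulr_gt0.
have [r1 s1 h1] := hm (m + delta) ltac:(lra).
have [r2 s2 h2] := slab_estimate m m0 hm.
have [r3 s3 h3] := forcing_small theta theta0.
exists (m - delta); first lra.
apply: eventually_mid; exists (Num.max (Num.max r1 r2) r3).
  by apply: (scale_le _ _ s3); rewrite le_max lexx orbT.
move=> rho x s; rewrite !ge_max => /andP[/andP[r1s r2s] r3s] sx x4.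
have rr := s.1.
have wge z : 1 <= dotR z z <= 16 -> m / 2 <= expW R N f c tau lam z.
  move=> zz; apply: le_trans (expW_ge R N f ff c tau lam z (ltW tau0) (ltW lam0) zz).
  by rewrite -/E tauE /c; lra.
have hP := fun z => exp_jet R N f c tau lam z.
pose T z := tau * lam * expR (lam * bump R N f (-1) (-4) z).
pose P (z : V) := (- T z) *: bumpP R N f (-1) z.
pose Y (z : V) := (- T z) *: bumpY R N z +
    (- (T z * lam)) *: ((bumpP R N f (-1) z)^T *m bumpP R N f (-1) z).
have main : forall x, shell rho 16 x -> u x - M <= expW R N f c tau lam (Z rho x).
  apply: (comparison R N O g u a e kappa N2 openO weak_u du cdu cg cu ee kappa0 r0 M r00
    geo bd 16 rho (expW R N f c tau lam) P Y s).
  - move=> z z0 zz; have [j1 j2] := hP z; split => //.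
    by apply: le_trans (wge z zz); lra.
  - move=> y Oy ya zz sy.
    apply: le_trans (h1 y Oy ya (le_trans r1s (shell_far _ _ _ s sy))) _.
    apply: le_trans (expW_sphere R N f ff c tau lam _ (ltW tau0) (ltW lam0) zz).
    by rewrite /c; lra.
  - move=> y Oy ya sy z0 zz hw.
    have wy := wge _ zz; have uy : M < u y by lra.
    have hz : h <= dotR e (Z rho y).
      rewrite leNgt; apply/negP => zh.
      have := h2 y sy.1 ya (le_trans r2s (shell_far _ _ _ s sy)).
      have := shell_far _ _ _ s sy; rewrite (zmap_dot rho) // => fy sl.
      have : (u y - M) * rho <= 4 * m * linB R N * (rho * dotR e (Z rho y)).
        by apply: le_trans sl; rewrite ler_pM2l // subr_gt0.
      have -> : 4 * m * linB R N * (rho * dotR e (Z rho y)) =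
        4 * m * (linB R N * dotR e (Z rho y)) * rho by ring.
      rewrite ler_pM2r // => sl'.
      have bz : linB R N * dotR e (Z rho y) < 8^-1.
        have : linB R N * dotR e (Z rho y) < linB R N * h by rewrite ltr_pM2l.
        by rewrite /h invfM mulrCA divff ?mulr1 // gt_eqF.
      have : m * (linB R N * dotR e (Z rho y)) < m * 8^-1 by rewrite ltr_pM2l.
      lra.
    exact: (exp_super R N N2 e f ee ff ef tau lam h _ _ tau0 lam0 h4 hlam zz hz
      (h3 rho y s r3s Oy sy uy)).
apply: le_trans (main x sx) _.
apply: le_trans (expW_mid R N f ff c tau lam _ (ltW tau0) (ltW lam0) x4) _.
by rewrite /c /delta; lra.
Qed.

End Bounded.

End Estimates.

(** * The boundary near the singular point *)

Section Geometry.
Variables (R : realType) (N : nat).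
Notation V := 'rV[R]_N.

Lemma differentiable_lipschitz (f : V -> R) (x : V) : differentiable f x ->
  exists C d : R, [/\ 0 <= C, 0 < d & forall h : V, `|h| < d -> `|f (x + h) - f x| <= C * `|h|].
Proof.
move=> df; have dd := differentiable_derive R N f x.
have /eqaddoP/(_ 1 ltr01) /nbhs_ballP[d /= d0 hd] := diff_locally df.
pose C := \sum_i `|partial i f x| + 1.
exists C, d; split => //; first by rewrite addr_ge0 // sumr_ge0.
move=> h hh; have := hd h; rewrite -ball_normE /= sub0r normrN => /(_ hh).
rewrite !fctE /= mul1r [h + x]addrC => b.
have lin : `|'d f x h| <= (\sum_i `|partial i f x|) * `|h|.
  have [_] := dd h df; rewrite deriveE // => ->.
  rewrite mulr_suml; apply: le_trans (ler_norm_sum _ _ _) _; apply: ler_sum => i _.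
  by rewrite normrM mulrC ler_wpM2l // coord_le_norm.
have -> : f (x + h) - f x = (f (x + h) - (f x + 'd f x h)) + 'd f x h by ring.
apply: le_trans (ler_normD _ _) _.
rewrite /C mulrDl mul1r addrC; exact: lerD.
Qed.

Lemma orthogonal_unit (e : V) : (2 <= N)%N -> dotR e e = 1 ->
  exists f : V, dotR f f = 1 /\ dotR e f = 0.
Proof.
move=> N2 ee.
have [i ei] : exists i, e ord0 i != 0.
  apply: contrapT => nE; move: ee; rewrite /dotR big1 => [/eqP|i _].
    by rewrite eq_sym oner_eq0.
  have [->|ei] := eqVneq (e ord0 i) 0; first by rewrite mul0r.
  by case: nE; exists i.
have [j ji] : exists j : 'I_N, j != i.
  have N0 : (0 < N)%N by exact: leq_trans N2.
  have [i0|i0] := eqVneq (i : nat) 0%N.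
    by exists (Ordinal N2); rewrite -val_eqE /= i0.
  by exists (Ordinal N0); rewrite -val_eqE /= eq_sym.
pose f := e ord0 j *: evec R i - e ord0 i *: evec R j.
have ef : dotR e f = 0 by rewrite /f !dotE !dotR_evec; ring.
have f0 : f != 0.
  apply/negP => /eqP /rowP /(_ j); rewrite !mxE eqxx (eq_sym i) (negbTE ji) mulr0 mulr1 sub0r.
  by move/eqP; rewrite oppr_eq0 (negbTE ei).
have n0 := enorm_gt0 R N _ f0.
clearbody f; exists ((enorm f)^-1 *: f).
rewrite dotRZl !dotRZr ef mulr0 -enorm_sqr; split => //.
by field; rewrite gt_eqF.
Qed.

Lemma near_dist2 (a : V) (A : set V) : nbhs a A -> exists2 r : R, 0 < r &
  forall x : V, dotR (x - a) (x - a) < r -> A x.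
Proof.
move=> /nbhs_ballP[d /= d0 hd]; exists (d ^+ 2); first by rewrite exprn_gt0.
move=> x; rewrite -enorm_sqr => h; apply: hd; rewrite -ball_normE /= distrC.
apply: le_lt_trans (norm_le_enorm R N _) _.
by rewrite -(@ltr_pXn2r _ 2) ?nnegrE ?enorm_ge0 // ltW.
Qed.

(** [r a >= 0] since the open set [O] does not contain [a], and [r <= 0] on the closure since
    [r > 0] is an open condition excluded in [O]. *)
Lemma defining_function (O : set V) (a : V) : open O -> bdry O a -> C2_boundary O ->
  exists (r : V -> R) (d : R), [/\ Ck 2 r, grad r a != 0, 0 < d &
    forall x, closure O x -> `|x - a| < d -> r x <= r a].
Proof.
move=> openO ba /(_ a ba) [U [r [openU Ua Cr gr OU]]].
have ra : 0 <= r a.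
  rewrite leNgt; apply/negP => r0; apply: ba.2.
  have : [set x | U x /\ r x < 0] a by [].
  by rewrite -OU => -[Oa _]; rewrite /interior; exact: open_nbhs_nbhs.
have /nbhs_ballP[d /= d0 hd] : nbhs a U by exact: open_nbhs_nbhs.
exists r, d; split => // x Ox xd; apply: le_trans ra.
have Ux : U x by apply: hd; rewrite -ball_normE /= distrC.
rewrite leNgt; apply/negP => rx.
have cr : {for x, continuous r} by apply: differentiable_continuous; exact: Cr.1.
have n1 : nbhs x [set y | 0 < r y] by apply: (cr [set t | 0 < t]); exact: lt_nbhsr.
have n2 : nbhs x U by exact: open_nbhs_nbhs.
have [y [Oy [ry Uy]]] := Ox _ (filterI n1 n2).
have : (O `&` U) y by [].
by rewrite OU => -[_]; move: ry => /= h1 h2; have := lt_trans h1 h2; rewrite ltxx.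
Qed.

(** A one-sided second-order bound: the mean value theorem, with a gradient that is Lipschitz at [a]
    because its components are differentiable there. *)
Lemma gradient_lower_bound (r : V -> R) (a : V) : Ck 2 r ->
  exists C d : R, [/\ 0 <= C, 0 < d & forall h : V, `|h| < d ->
    dotR (grad r a) h - C * dotR h h <= r (a + h) - r a].
Proof.
move=> [dr cr].
have lip i : exists Cd : R * R, [/\ 0 <= Cd.1, 0 < Cd.2 & forall h : V, `|h| < Cd.2 ->
    `|partial i r (a + h) - partial i r a| <= Cd.1 * `|h|].
  have [C [d H]] := differentiable_lipschitz _ a ((cr i).1 a).
  by exists (C, d).
pose Cd i := projT1 (cid (lip i)).
have hCd i := projT2 (cid (lip i)).
pose d := \big[Num.min/1]_i (Cd i).2.
have d0 : 0 < d by apply: lt_bigmin => // i _; have [] := hCd i.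
exists (\sum_i (Cd i).1), d; split => //.
  by apply: sumr_ge0 => i _; have [] := hCd i.
move=> h hd.
pose p (t : R) := r (a + t *: h).
pose dp (t : R) := \sum_i h ord0 i * partial i r (a + t *: h).
have dr' x v : is_derive x v r (\sum_i v ord0 i * partial i r x).
  exact: differentiable_derive.
have hp t : is_derive t (1 : R) p (dp t) by exact: (is_derive_line.1 (dr' _ h)).
have cp : {within `[0 : R, 1], continuous p}.
  apply: continuous_subspaceT => t; exact: is_derive1_continuous (hp t).
have [c c01 hc] := MVT ltr01 (fun t _ => hp t) cp.
move: hc; rewrite /p /dp scale1r scale0r addr0 subr0 mulr1 => ->.
rewrite lerBlDr -lerBlDl /dotR -sumrB.
apply: le_trans (ler_norm _) _; apply: le_trans (ler_norm_sum _ _ _) _.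
rewrite mulr_suml; apply: ler_sum => i _; rewrite mxE.
have -> : partial i r a * h ord0 i - h ord0 i * partial i r (a + c *: h) =
  - (h ord0 i * (partial i r (a + c *: h) - partial i r a)) by ring.
rewrite normrN normrM.
have [C0 _ hi] := hCd i.
have hch : `|c *: h| <= `|h|.
  move: c01; rewrite in_itv /= => /andP[c0 c1].
  by rewrite normrZ ger0_norm ?(ltW c0) // -[leRHS]mul1r ler_wpM2r // ltW.
have b := hi (c *: h) (le_lt_trans hch (lt_le_trans hd (bigmin_le_cond _ _ _))).
apply: (@le_trans _ _ (`|h| * ((Cd i).1 * `|h|))).
  apply: ler_pM => //; first exact: coord_le_norm.
  by apply: le_trans (b _) _ => //; rewrite ler_wpM2l.
rewrite -/(dotR h h) mulrCA ler_wpM2l // -expr2 -enorm_sqr lerXn2r // ?nnegrE ?enorm_ge0 //.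
exact: norm_le_enorm.
Qed.

(** Near [a] the closure satisfies [e . (x - a) >= - (C / |G|) |x - a|^2]. Division by [|x - a|^2],
    which is what the inversion does, turns this parabolic bound into a constant, absorbed by
    [kappa = C / |G| + 1]. *)
Lemma inner_normal (O : set V) (a : V) : open O -> bdry O a -> C2_boundary O ->
  exists (e : V) (kappa r0 : R), [/\ dotR e e = 1, 0 <= kappa, 0 < r0 &
    forall x, closure O x -> x != a -> dotR (x - a) (x - a) < r0 ->
      1 <= dotR e (zmap R N a e kappa 1 x)].
Proof.
move=> openO ba C2; have [r [d1 [Cr gr d10 h1]]] := defining_function O a openO ba C2.
have [C [d2 [C0 d20 h2]]] := gradient_lower_bound r a Cr.
set G := grad r a in gr h2; have n0 := enorm_gt0 R N _ gr.
pose d := Num.min d1 d2; have d0 : 0 < d by rewrite lt_min d10.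
exists (- (enorm G)^-1 *: G), (C / enorm G + 1), (d ^+ 2); split.
- by rewrite dotRZl dotRZr -enorm_sqr; field; rewrite gt_eqF.
- by rewrite addr_ge0 // divr_ge0 // ltW.
- by rewrite exprn_gt0.
set e := - _ *: G => x Ox xa.
have s0 : 0 < dotR (x - a) (x - a) by rewrite dotR_gt0 // subr_eq0.
rewrite -{1}enorm_sqr => xd.
have hx : `|x - a| < d.
  apply: le_lt_trans (norm_le_enorm R N _) _.
  by rewrite -(@ltr_pXn2r _ 2) ?nnegrE ?enorm_ge0 // ltW.
have [hx1 hx2] : `|x - a| < d1 /\ `|x - a| < d2.
  by move: hx; rewrite lt_min => /andP.
have ee : dotR e e = 1 by rewrite /e dotRZl dotRZr -enorm_sqr; field; rewrite gt_eqF.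
rewrite /zmap invr1 scale1r [dotR e (_ + _)]dotRDr [dotR e (_ *: (x - a))]dotRZr.
rewrite [dotR e (_ *: e)]dotRZr ee mulr1.
have aE : a + (x - a) = x by rewrite addrC subrK.
have := h2 _ hx2; rewrite aE => h3; have := h1 x Ox hx1 => h4.
have h5 : dotR G (x - a) <= C * dotR (x - a) (x - a) by lra.
have : - (C / enorm G) <= (dotR (x - a) (x - a))^-1 * dotR e (x - a).
  rewrite [leRHS]mulrC ler_pdivlMr // /e dotRZl.
  have -> : - (C / enorm G) * dotR (x - a) (x - a) =
    (enorm G)^-1 * - (C * dotR (x - a) (x - a)) by ring.
  rewrite mulNr -mulrN ler_pM2l ?invr_gt0 //; lra.
lra.
Qed.

End Geometry.

(** * Continuity at the singular point *)

Section OneSided.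
Variables (R : realType) (N : nat) (O : set 'rV[R]_N) (a : 'rV[R]_N).
Notation V := 'rV[R]_N.
Hypotheses (N2 : (2 <= N)%N) (openO : open O) (ba : bdry O a) (C2 : C2_boundary O).

Let nOa : ~ O a.
Proof. by move=> Oa; apply: ba.2; rewrite /interior; exact: open_nbhs_nbhs. Qed.

Lemma partial_continuous (u : V -> R) x i : C1_closure_minus O a u -> O x ->
  {for x, continuous (partial i u)}.
Proof.
move=> [_ _ /(_ i)[G [cG GE]]] Ox.
have sub y : O y -> (closure O `\ a) y.
  by move=> Oy; split; [exact: subset_closure|move=> ya; apply: nOa; rewrite -ya].
have nO : \forall y \near x, O y by exact: open_nbhs_nbhs.
apply: (cont_near R N G); first by apply: filterS nO => y Oy; exact: GE.
move=> A GA; have /subspace_continuousP /(_ x (sub x Ox) A GA) h := cG.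
have h' : \forall y \near x, (closure O `\ a) y -> A (G y) by exact: h.
have h2 : \forall y \near x, A (G y) by apply: filterS2 h' nO => y hy Oy; exact: hy (sub y Oy).
exact: h2.
Qed.

(** Back to the original variable: [|Z 1 x|^2 * dist2 x >= 1 / 2 - kappa^2 * dist2 x], so
    [|Z 1 x| >= rho] once [2 (rho^2 + kappa^2) * dist2 x <= 1]. *)
Lemma eventually_near (e : V) (kappa r0 : R) (p : V -> Prop) : dotR e e = 1 ->
  eventually R N O a e kappa r0 p ->
  exists2 d : R, 0 < d & forall x, closure O x -> x != a -> `|x - a| < d -> p x.
Proof.
move=> ee [rho [rho0 _] h].
pose q := 2 * (rho ^+ 2 + kappa ^+ 2) * N%:R.
have n0 : 0 < N%:R :> R by rewrite ltr0n (leq_trans _ N2).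
have q0 : 0 < q.
  by rewrite mulr_gt0 // mulr_gt0 // ltr_pwDl ?exprn_gt0 ?sqr_ge0.
pose d := Num.min 1 q^-1.
have d0 : 0 < d by rewrite lt_min ltr01 invr_gt0.
exists d => // x Ox xa xd; apply: h => //.
have s0 := dist2_gt0 R N a x xa.
have hs : 2 * (rho ^+ 2 + kappa ^+ 2) * dotR (x - a) (x - a) <= 1.
  have h1 := enorm_sqr_le_norm R N (x - a).
  have h2 : `|x - a| ^+ 2 <= q^-1.
    have [x1 xq] : `|x - a| < 1 /\ `|x - a| < q^-1 by move: xd; rewrite lt_min => /andP.
    apply: le_trans (ltW xq); rewrite expr2 ler_piMl //; exact: ltW.
  apply: (@le_trans _ _ (q * `|x - a| ^+ 2)).
    have k0 : 0 < 2 * (rho ^+ 2 + kappa ^+ 2) by rewrite mulr_gt0 // ltr_pwDl ?exprn_gt0 ?sqr_ge0.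
    by rewrite /q -[leRHS]mulrA ler_wpM2l // ltW.
  by rewrite mulrC -ler_pdivlMr // mul1r.
have := zmap_sqn R N a e kappa ee 1 x ltr01 xa; rewrite expr1n mul1r -enorm_sqr => hz.
have := coord_dist2_2 R N a e kappa ee x => hc.
rewrite -(@ler_pXn2r _ 2) ?nnegrE ?enorm_ge0 ?(ltW rho0) //.
rewrite -(ler_pM2r s0) hz; lra.
Qed.

Lemma eventually_shrink (e : V) (kappa r0 r1 : R) (p : V -> Prop) : 0 < r1 ->
  eventually R N O a e kappa r0 p -> eventually R N O a e kappa r1 p.
Proof.
move=> r10 [rho [rho0 _] h]; have [rho' s'] := scale_ex R kappa r1 r10.
exists (Num.max rho rho').
  by apply: scale_le s' _; rewrite le_max lexx orbT.
by move=> x Ox xa; rewrite ge_max => /andP[h1 _]; exact: h.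
Qed.

Lemma lower_bound_segment (g : R -> R) (x y : R) : x <= y -> continuous g ->
  exists2 G : R, 0 <= G & forall r, x <= r <= y -> - G <= g r.
Proof.
move=> xy cg; have [c _ hc] := EVT_min xy (continuous_subspaceT cg).
exists `|g c| => // r hr; have := hc r; rewrite in_itv /= => /(_ hr).
by apply: le_trans; rewrite lerNl -normrN ler_norm.
Qed.

(** Two passes with different levels: the first, at a high level, bounds [u] above near [a]; the
    second, at [phi a + eps / 2], uses this bound to drive the excess below [eps / 2]. *)
Lemma upper_limit (g : R -> R) (u phi : V -> R) : continuous g ->
  (exists c : R, 0 < c /\ exists M : R,
     forall r : R, M <= r -> c * r ^+ (2 * N - 1) <= g r) ->
  C1_closure_minus O a u -> weak_solution O g u -> {for a, continuous phi} ->
  (forall x, bdry O x -> x != a -> u x = phi x) ->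
  forall eps : R, 0 < eps -> exists2 d : R, 0 < d &
    forall x, closure O x -> x != a -> `|x - a| < d -> u x <= phi a + eps.
Proof.
move=> cg [c [c0 [M1 hM1]]] Cu weak_u cphi uphi eps eps0.
have [cu du _] := Cu.
have cdu x i : O x -> {for x, continuous (partial i u)} by exact: partial_continuous.
have [e [kappa [r0 [ee kappa0 r00 geo]]]] := inner_normal R N O a openO ba C2.
have [f [ff ef]] := orthogonal_unit R N e N2 ee.
have near_phi (t : R) : 0 < t -> exists2 r : R, 0 < r &
    forall x, bdry O x -> x != a -> dotR (x - a) (x - a) < r -> u x <= phi a + t.
  move=> t0; have n1 : nbhs a [set y | phi y < phi a + t].
    by apply: (cphi [set s | s < phi a + t]); apply: lt_nbhsl; rewrite ltrDl.
  have [r r10 hr] := near_dist2 R N a _ n1.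
  by exists r => // x bx xa /hr; rewrite (uphi x bx xa) => /ltW.
have shrink (r : R) : 0 < r -> exists r' : R, [/\ 0 < r', r' <= r & r' <= r0].
  by move=> r10; exists (Num.min r r0); rewrite lt_min r10 r00 !ge_min !lexx orbT.
have [B [B0 [rB [rB0 hB]]]] : exists B : R, 0 < B /\ exists r : R, 0 < r /\
    eventually R N O a e kappa r (fun x => u x <= B).
  have [r1 r10 h1] := near_phi 1 ltr01.
  have [r [rr0 rr1 rr2]] := shrink r1 r10.
  (* [M >= 0] gives [(u - M) ^+ (2N - 1) <= u ^+ (2N - 1)] when [u > M], and [M >= M1] puts such
     values in the growth range of [g]. *)
  pose M := Num.max (Num.max (phi a + 1) M1) 0.
  have M0 : 0 <= M by rewrite le_max lexx orbT.
  have MM1 : M1 <= M by rewrite !le_max lexx orbT.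
  have Mphi : phi a + 1 <= M by rewrite !le_max lexx.
  have geo' x : closure O x -> x != a -> dotR (x - a) (x - a) < r ->
      1 <= dotR e (zmap R N a e kappa 1 x).
    by move=> Ox xa xr; apply: geo => //; exact: lt_le_trans xr rr2.
  have bd x : bdry O x -> x != a -> dotR (x - a) (x - a) < r -> u x <= M.
    move=> bx xa xr; apply: le_trans Mphi; apply: h1 => //.
    exact: lt_le_trans xr rr1.
  have growth x : O x -> M < u x -> c * (u x - M) ^+ (2 * N - 1) <= g (u x).
    move=> Ox ux; apply: le_trans (hM1 (u x) _); last by lra.
    by rewrite ler_pM2l // lerXn2r ?nnegrE //; lra.
  have [B B0 hB] := bounded_above R N O g u a e f kappa N2 openO weak_u du cdu cg cu
    ee ff ef kappa0 r M rr0 geo' bd c c0 growth.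
  exists (B + M); split; first lra.
  exists r; split => //; apply: eventually_sub hB => x _ _; lra.
have [r1 r10 h1] := near_phi (eps / 2) ltac:(lra).
have [r [rr0 rr1 rr2]] := shrink r1 r10.
pose M := phi a + eps / 2.
pose B' := `|B - M|.
have [G G0 hG] := lower_bound_segment g M (M + B') ltac:(by rewrite lerDl normr_ge0) cg.
have geo' x : closure O x -> x != a -> dotR (x - a) (x - a) < r ->
    1 <= dotR e (zmap R N a e kappa 1 x).
  by move=> Ox xa xr; apply: geo => //; exact: lt_le_trans xr rr2.
have bd x : bdry O x -> x != a -> dotR (x - a) (x - a) < r -> u x <= M.
  by move=> bx xa xr; apply: h1 => //; exact: lt_le_trans xr rr1.
have uB : eventually R N O a e kappa r (fun x => u x - M <= B').
  apply: (eventually_shrink e kappa rB r) => //.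
  apply: eventually_sub hB => x _ _ ux; apply: le_trans (ler_norm _).
  lra.
have ev := vanishing_excess R N O g u a e f kappa N2 openO weak_u du cdu cg cu
    ee ff ef kappa0 r M rr0 geo' bd B' G uB G0 hG (eps / 2) ltac:(lra).
have [d d0 hd] := eventually_near e kappa r _ ee ev.
by exists d => // x Ox xa xd; have := hd x Ox xa xd; rewrite /M; lra.
Qed.

Lemma partialN (f : V -> R) x i : differentiable f x ->
  partial i (fun y => - f y) x = - partial i f x.
Proof.
move=> df; apply: partialE; apply: is_deriveN; exact: diff_partial.
Qed.

Lemma gradN (f : V -> R) x : differentiable f x -> grad (fun y => - f y) x = - grad f x.
Proof. by move=> df; apply/rowP => i; rewrite !mxE partialN. Qed.

Lemma smoothN (f : V -> R) : smooth f -> smooth (fun x => - f x).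
Proof.
move=> sf k.
have := Ck_sum R N k unit [:: tt] (fun=> -1) (fun=> f) (fun=> sf k).
rewrite (_ : (fun x => _) = (fun x => - f x)) //.
by apply/funext => x; rewrite big_seq1 mulN1r.
Qed.

(** The N-Laplacian is odd, so [- u] solves the equation with [- g (- r)]; the test function is
    negated as well. Lower bounds for [u] thus come from [upper_limit]. *)
Lemma weak_solutionN (g : R -> R) (u : V -> R) : (forall x, O x -> differentiable u x) ->
  weak_solution O g u -> weak_solution O (fun r => - g (- r)) (fun x => - u x).
Proof.
move=> du weak_u zeta sz [K [cK KO Kz]].
have sz' := smoothN zeta sz.
rewrite -[RHS](weak_u _ sz'); last by exists K; split => // x /Kz ->; rewrite oppr0.
congr (integral_RN _); apply/funext => x; case: ifPn => // /set_mem Ox.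
rewrite !gradN; [|exact: (sz 1).1|exact: du].
by rewrite opprK -scaleN1r enormZ normrN1 mul1r !dotE; ring.
Qed.

Lemma C1_closure_minusN (u : V -> R) : C1_closure_minus O a u ->
  C1_closure_minus O a (fun x => - u x).
Proof.
move=> [cu du dG]; split.
- by move=> x; exact: (continuousN (cu x)).
- by move=> x Ox; apply: differentiableN; exact: du.
- move=> i; have [G [cG GE]] := dG i; exists (fun x => - G x); split.
    by move=> x; exact: (continuousN (cG x)).
  by move=> x Ox; rewrite GE // partialN //; exact: du.
Qed.

End OneSided.

Theorem theorem3p1 (R : realType) (N : nat) (O : set 'rV[R]_N) (a : 'rV[R]_N)
    (g : R -> R) (u phi : 'rV[R]_N -> R) :
  (2 <= N)%N ->
  domain_compact_C2_boundary O ->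
  bdry O a ->
  continuous g ->
  (exists c : R, 0 < c /\ exists M : R,
     forall r : R, M <= r -> c * r ^+ (2 * N - 1) <= g r) ->
  (exists c : R, 0 < c /\ exists M : R,
     forall r : R, r <= M -> g r <= - c * `|r| ^+ (2 * N - 1)) ->
  C1_closure_minus O a u ->
  weak_solution O g u ->
  C1_on_boundary phi ->
  (forall x, bdry O x -> x != a -> u x = phi x) ->
  exists v : 'rV[R]_N -> R,
    {within closure O, continuous v} /\
    (forall x, closure O x -> x != a -> v x = u x).
Proof.
move=> N2 [openO _ _ _ C2] ba cg gp [c [c0 [M hM]]] Cu weak_u [dphi _] uphi.
have cphi : {for a, continuous phi} by apply: differentiable_continuous; exact: dphi.
have up := upper_limit R N O a N2 openO ba C2 g u phi cg gp Cu weak_u cphi uphi.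
have lo : forall eps : R, 0 < eps -> exists2 d : R, 0 < d &
    forall x, closure O x -> x != a -> `|x - a| < d -> - u x <= - phi a + eps.
  apply: (upper_limit R N O a N2 openO ba C2 (fun r => - g (- r)) (fun x => - u x)
    (fun x => - phi x)).
  - move=> r; apply: (@continuousN _ _ _ (fun r => g (- r))).
    by apply: (@continuous_comp _ _ _ (fun r : R => - r) g); [exact: opp_continuous|exact: cg].
  - exists c; split => //; exists (Num.max 0 (- M)) => r; rewrite ge_max => /andP[r0 rM].
    have := hM (- r); rewrite normrN (ger0_norm r0) mulNr lerNr; apply.
    by rewrite lerNl.
  - exact: C1_closure_minusN.
  - by apply: weak_solutionN => //; have [] := Cu.
  - exact: (continuousN cphi).
  - by move=> x bx xa; rewrite uphi.
have [cu _ _] := Cu.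
(* The two one-sided bounds squeeze [u] towards [phi a] at [a]; elsewhere points stay away from [a],
   and the continuity of [u] is inherited. *)
exists (fun x => if x == a then phi a else u x); split; last first.
  by move=> x _ /negbTE ->.
apply/subspace_continuousP => x Ox; have [->|xa] := eqVneq x a.
  apply/cvgrPdist_le => eps eps0; rewrite /from_subspace /= eqxx.
  have [d1 d10 h1] := up eps eps0; have [d2 d20 h2] := lo eps eps0.
  have n1 : \forall y \near a, `|y - a| < d1 by apply: near_norm_lt; rewrite subrr normr0.
  have n2 : \forall y \near a, `|y - a| < d2 by apply: near_norm_lt; rewrite subrr normr0.
  apply: filterS2 n1 n2 => y y1 y2 Oy; have [_|ya] := eqVneq y a.
    by rewrite subrr normr0 ltW.
  have := h1 y Oy ya y1; have := h2 y Oy ya y2.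
  by move=> *; rewrite ler_norml; apply/andP; split; lra.
rewrite /from_subspace /= (negbTE xa) => A uA.
have /subspace_continuousP /(_ x) := cu.
move=> /(_ (conj Ox (elimN eqP xa)) A uA) h0.
have h : \forall y \near x, (closure O `\ a) y -> A (u y) by exact: h0.
have n1 : \forall y \near x, 0 < `|y - a|.
  by apply: near_norm_gt; rewrite normr_gt0 subr_eq0.
suff : \forall y \near x, closure O y -> A (if y == a then phi a else u y) by [].
apply: filterS2 h n1 => y hy ya Oy.
have ya' : y != a by rewrite -subr_eq0 -normr_gt0.
by rewrite /= (negbTE ya'); apply: hy; split => //; apply/eqP.
Qed.
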